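(* Let $\mathscr{G}$ be a connected proper regular Lie groupoid with basepoint $a\in\mathscr{G}_0$, let $\mathrm{K}_a(\mathscr{G})$ be the Lie group of ineffective arrows of $\mathscr{G}$ at $a$, and let $\partial:\pi_1(\mathscr{G},a)\to\pi_0(\mathrm{Aut}(\mathrm{K}_a(\mathscr{G})))$ be the monodromy map of $\mathscr{G}$. If $\mathscr{G}$ is Morita equivalent to the translation groupoid associated to an action of a connected compact Lie group on a smooth manifold, then there exists a faithful unitary representation $r:\mathrm{K}_a(\mathscr{G})\to\mathrm{U}(m)$ such that $\partial(\pi_1(\mathscr{G},a))\subset\pi_0(\mathrm{W}_r(\mathrm{K}_a(\mathscr{G})))$.
   Context: Groupoids. A topological groupoid $\mathscr{G}$ is a small category with all arrows invertible, with topologies on its sets of objects $\mathscr{G}_0$ and arrows $\mathscr{G}_1$ making all structure maps (source $\mathrm{s}$, target $\mathrm{t}$, product, units, inverse) continuous; $gg'$ is defined if $\mathrm{s}(g)=\mathrm{t}(g')$. $\mathscr{G}_x$ is the isotropy group of arrows from $x$ to $x$. A Lie groupoid is a topological groupoid such that $\mathscr{G}_0,\mathscr{G}_1$ are smooth manifolds, all structure maps are smooth, and the source map is a submersion; $\mathscr{G}_0$ and the source fibers are assumed Hausdorff. It is proper if it is Hausdorff and $(\mathrm{s},\mathrm{t}):\mathscr{G}_1\to\mathscr{G}_0\times\mathscr{G}_0$ is proper, and regular if all isotropy groups have the same dimension. Connected means path-connected as a groupoid: any two objects can be joined by a finite chain of paths in $\mathscr{G}_0$ and arrows of $\mathscr{G}$.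 The translation groupoid $G\ltimes M$ of a smooth left action of $G$ on $M$ has objects $M$ and arrows $G\times M$. Principal bundles. A principal $\mathscr{G}$-bundle over $\mathscr{H}$ is a space $P$ with a left $\mathscr{H}$-action along $\pi:P\to\mathscr{H}_0$ and a right $\mathscr{G}$-action along $\epsilon:P\to\mathscr{G}_0$ such that $\pi$ has local sections around every point of $\mathscr{H}_0$; $\pi(pg)=\pi(p)$, $\epsilon(hp)=\epsilon(p)$, $h(pg)=(hp)g$; and $P\times_{\mathscr{G}_0}\mathscr{G}_1\to P\times_{\mathscr{H}_0}P$, $(p,g)\mapsto(p,pg)$, is a homeomorphism. For Lie groupoids it is smooth if $P$ is a smooth manifold, all structure maps are smooth, $\pi$ is a surjective submersion, and the last map is a diffeomorphism. The Morita category of Lie groupoids has as morphisms the isomorphism classes of smooth principal bundles, with composition the tensor product $Q\otimes_{\mathscr{H}}P=(Q\times_{\mathscr{H}_0}P)/\mathscr{H}$. Two Lie groupoids are Morita equivalent if they are isomorphic in it. Fundamental group. A topological space is viewed as a groupoid with only unit arrows. A principal $(\mathscr{G},a)$-bundle over $(I,\partial I)$, $I=[0,1]$, is a (topological) principal $\mathscr{G}$-bundle $P$ over $I$ with a section $\sigma:\partial I\to P$ of $\pi$ such that $\epsilon(\sigma(b))=a$ for $b\in\partial I$. $\pi_1(\mathscr{G},a)$ is the group of homotopy classes of such bundles (homotopies being such bundles over $(I\times I,\partial I\times I)$, with local sections of the bundle around each point of $\partial I\times I$ that agree with the marked section), with product given by concatenation. Ineffective arrows. For $x\in\mathscr{G}_0$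 let $\mathcal{O}_x$ be the orbit of $x$ and $\mathrm{N}_x\mathscr{G}=T_x\mathscr{G}_0/T_x\mathcal{O}_x$. An arrow $g$ from $x$ to $x'$ induces a linear isomorphism $\nu(g,-):\mathrm{N}_x\mathscr{G}\to\mathrm{N}_{x'}\mathscr{G}$ determined by $\nu(g,[(d_g\mathrm{s})(v)])=[(d_g\mathrm{t})(v)]$ for $v\in T_g\mathscr{G}_1$. This gives a representation $\nu_x:\mathscr{G}_x\to\mathrm{GL}(\mathrm{N}_x\mathscr{G})$, and $\mathrm{K}_x(\mathscr{G})=\mathrm{Ker}(\nu_x)$. For $\mathscr{G}$ proper, $\mathrm{K}_x(\mathscr{G})$ is a compact Lie group. Monodromy map. Put $K=\mathrm{K}_a(\mathscr{G})$ and let $\rho:K\to\mathscr{G}_a$ be the inclusion. Let $\mathrm{hom}(K,\mathscr{G})$ be the space (compact-open topology) of pairs consisting of an object $x$ and a continuous homomorphism $\varphi:K\to\mathscr{G}_x$; let $\omega(\varphi)=x$; $\mathscr{G}$ acts on it from the right along $\omega$ by $(\varphi g)(k)=g^{-1}\varphi(k)g$. Let $\mathscr{G}^K=\mathrm{hom}(K,\mathscr{G})\rtimes\mathscr{G}$ be the translation groupoid and $\mathscr{G}^K_\rho$ its path-component containing $\rho$. The homomorphism $\omega:\mathscr{G}^K_\rho\to\mathscr{G}$ induced by $\omega$ is a Serre fibration, all objects of $\mathscr{G}^K_\rho$ are isomorphisms onto groups $\mathrm{K}_x(\mathscr{G})$, and its fiber over $a$ is Morita equivalent to a union of path-components of $\mathrm{Aut}(\mathrm{K}_a(\mathscr{G}))$.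 The monodromy map $\partial:\pi_1(\mathscr{G},a)\to\pi_0(\mathrm{Aut}(\mathrm{K}_a(\mathscr{G})))$ is the connecting homomorphism of the associated long exact homotopy sequence. Explicitly: for a class $[(P,\sigma)]$ there is a continuous map $\bar\epsilon:P\to\mathrm{hom}(K,\mathscr{G})$ with $\omega\circ\bar\epsilon=\epsilon$, $\bar\epsilon(pg)=\bar\epsilon(p)g$ and $\bar\epsilon(\sigma(0))=\rho$, and $\partial[(P,\sigma)]$ is the class of $\bar\epsilon(\sigma(1))\in\mathrm{Aut}(\mathrm{K}_a(\mathscr{G}))$ (exchanging the roles of the endpoints $0,1$ replaces the class by its inverse and does not change the image of $\partial$). $\mathrm{W}_r$. For a faithful unitary representation $r:L\to\mathrm{U}(m)$ of a compact Lie group $L$, $\mathrm{W}_r(L)$ is the subgroup of $\mathrm{Aut}(L)$ of those automorphisms $\alpha$ for which $r\circ\alpha\circ r^{-1}:r(L)\to r(L)$ is the restriction of an inner automorphism of $\mathrm{U}(m)$. $\pi_0(\mathrm{W}_r(L))$ is regarded as the subgroup of $\pi_0(\mathrm{Aut}(L))$ of classes represented by elements of $\mathrm{W}_r(L)$. *)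

(* Defs.v *)
(* Based on MathComp-Analysis, together with the complex numbers R[i] of
   mathcomp-real-closed and the unitary matrices of MathComp's spectral.v. *)
From HB Require Import structures.
From Stdlib Require Import Relation_Operators.
From mathcomp Require Import all_boot all_order all_algebra.
From mathcomp Require Import complex spectral.
From mathcomp Require Import all_classical all_reals all_analysis.

Set Implicit Arguments.
Unset Strict Implicit.
Unset Printing Implicit Defensive.

Import Order.TTheory GRing.Theory Num.Theory.
Import numFieldNormedType.Exports.

Local Open Scope classical_set_scope.
Local Open Scope ring_scope.

(** * Smooth manifolds

  Convention throughout: structures are split into raw data (records) and
  predicates stating the axioms.  Partially defined operations (products of
  arrows, actions) are total functions, whose values are only ever used on
  their domain.  Manifolds need not be Hausdorff, second countable or
  equidimensional; the Hausdorff property is imposed where it is meant. *)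

(* For f defined near x: all iterated directional derivatives exist and are
   differentiable on one neighbourhood of x, i.e. f is of class C^oo there. *)
Definition smooth_rV (R : realType) (n m : nat) (f : 'rV[R]_n -> 'rV[R]_m)
    (x : 'rV[R]_n) : Prop :=
  \forall y \near x, forall vs : seq 'rV[R]_n,
    differentiable (foldr (fun v (g : 'rV[R]_n -> 'rV[R]_m) z => 'D_v g z) f vs) y.

Record chart (R : realType) (M : Type) := Chart {
  dim : nat ;
  dom : set M ;
  coord : M -> 'rV[R]_dim ;
  param : 'rV[R]_dim -> M  (* inverse of coord, meaningful on coord @` dom *)
}.
Arguments param {R M} c v.

Definition is_chart (R : realType) (M : topologicalType) (c : chart R M) : Prop :=
  [/\ open (dom c), open (coord c @` dom c),
      (forall x, dom c x -> {for x, continuous (coord c)}),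
      (forall x, dom c x -> {for coord c x, continuous (param c)}) &
      (forall x, dom c x -> param c (coord c x) = x)].

Definition smooth_transition (R : realType) (M : topologicalType)
    (c c' : chart R M) : Prop :=
  forall x, dom c x -> dom c' x -> smooth_rV (coord c' \o param c) (coord c x).

Record charted (R : realType) := Charted {
  space :> topologicalType ;
  atlas : set (chart R space)
}.
Arguments atlas {R} M c : rename.

Definition smooth_manifold (R : realType) (M : charted R) : Prop :=
  [/\ (forall c, atlas M c -> is_chart c),
      (forall x : M, exists2 c, atlas M c & dom c x) &
      (forall c c', atlas M c -> atlas M c' -> smooth_transition c c')].

Definition prod_chart (R : realType) (M N : Type) (c : chart R M)
    (d : chart R N) : chart R (M * N) :=
  {| dim := dim c + dim d ;
     dom := dom c `*` dom d ;
     coord := fun p => row_mx (coord c p.1) (coord d p.2) ;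
     param := fun v => (param c (lsubmx v), param d (rsubmx v)) |}.

Definition charted_prod (R : realType) (M N : charted R) : charted R :=
  {| space := (M * N)%type ;
     atlas := [set e | exists c d,
                 [/\ atlas M c, atlas N d & e = prod_chart c d]] |}.

(* F is of class C^oo on a neighbourhood of x. *)
Definition smooth_at (R : realType) (M N : charted R) (F : M -> N) (x : M) :
    Prop :=
  {for x, continuous F} /\
  forall c c', atlas M c -> atlas N c' -> dom c x -> dom c' (F x) ->
    smooth_rV (coord c' \o F \o param c) (coord c x).

Definition smooth (R : realType) (M N : charted R) (F : M -> N) : Prop :=
  forall x, smooth_at F x.

(* Smoothness on an arbitrary subset, by local smooth extension.  On an embedded
   submanifold A of M (the fibred products along submersions below) this is
   smoothness for the submanifold structure. *)
Definition smooth_on (R : realType) (M N : charted R) (A : set M) (F : M -> N) :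
    Prop :=
  forall x, A x -> exists2 F' : M -> N,
    smooth_at F' x & \forall y \near x, A y -> F' y = F y.

(** ** Tangent spaces *)

(* A tangent vector at x is the family of its coordinate vectors in the charts
   of the atlas around x, extended by 0 to the other charts. *)
Definition tvector (R : realType) (M : charted R) :=
  forall c : chart R M, 'rV[R]_(dim c).

Definition tangent (R : realType) (M : charted R) (x : M) : set (tvector M) :=
  [set v | (forall c c', atlas M c -> atlas M c' -> dom c x -> dom c' x ->
              v c' = 'd (coord c' \o param c) (coord c x) (v c)) /\
           (forall c, ~ (atlas M c /\ dom c x) -> v c = 0)].

(* The graph of d_x F : T_x M -> T_(F x) N. *)
Definition differential (R : realType) (M N : charted R) (F : M -> N) (x : M)
    (v : tvector M) (w : tvector N) : Prop :=
  [/\ tangent x v, tangent (F x) w &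
      forall c c', atlas M c -> atlas N c' -> dom c x -> dom c' (F x) ->
        w c' = 'd (coord c' \o F \o param c) (coord c x) (v c)].

Definition submersion (R : realType) (M N : charted R) (F : M -> N) : Prop :=
  smooth F /\
  forall x w, tangent (F x) w -> exists v, differential F x v w.

(* S is an embedded submanifold of dimension d, by slice charts. *)
Definition submanifold (R : realType) (M : charted R) (S : set M) (d : nat) :
    Prop :=
  forall x, S x -> exists c : chart R M,
    [/\ is_chart c,
        (forall c', atlas M c' -> smooth_transition c c' /\ smooth_transition c' c),
        dom c x, (d <= dim c)%N &
        forall y, dom c y ->
          (S y <-> forall j : 'I_(dim c), (d <= j)%N -> coord c y 0 j = 0)].

(** ** The unit interval *)

Definition unit_interval (R : realType) : topologicalType :=
  set_type (`[0, 1]%classic : set R).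

Lemma unit_interval0 (R : realType) : (0 : R) \in (`[0, 1]%classic : set R).
Proof. by rewrite inE /= in_itv /= lexx ler01. Qed.

Lemma unit_interval1 (R : realType) : (1 : R) \in (`[0, 1]%classic : set R).
Proof. by rewrite inE /= in_itv /= lexx ler01. Qed.

Definition i0 (R : realType) : unit_interval R := exist _ 0 (unit_interval0 R).
Definition i1 (R : realType) : unit_interval R := exist _ 1 (unit_interval1 R).

(** * Groupoids *)

Record groupoid (Ob Ar : Type) := Groupoid {
  src : Ar -> Ob ;
  tgt : Ar -> Ob ;
  mul : Ar -> Ar -> Ar ;  (* mul g g' is meant for src g = tgt g' *)
  unit_ar : Ob -> Ar ;
  inv_ar : Ar -> Ar
}.

Definition is_groupoid (Ob Ar : Type) (G : groupoid Ob Ar) : Prop :=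
  (forall x, src G (unit_ar G x) = x /\ tgt G (unit_ar G x) = x) /\
  (forall g g', src G g = tgt G g' ->
     src G (mul G g g') = src G g' /\ tgt G (mul G g g') = tgt G g) /\
  (forall g g' g'', src G g = tgt G g' -> src G g' = tgt G g'' ->
     mul G g (mul G g' g'') = mul G (mul G g g') g'') /\
  (forall g, mul G (unit_ar G (tgt G g)) g = g /\
             mul G g (unit_ar G (src G g)) = g) /\
  (forall g, [/\ src G (inv_ar G g) = tgt G g, tgt G (inv_ar G g) = src G g,
                 mul G g (inv_ar G g) = unit_ar G (tgt G g) &
                 mul G (inv_ar G g) g = unit_ar G (src G g)]).

Definition topological_groupoid (Ob Ar : topologicalType) (G : groupoid Ob Ar) :
    Prop :=
  is_groupoid G /\
  [/\ continuous (src G), continuous (tgt G), continuous (unit_ar G),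
      continuous (inv_ar G) &
      {within [set p | src G p.1 = tgt G p.2],
         continuous (fun p : Ar * Ar => mul G p.1 p.2)}].

Definition unit_groupoid (X : Type) : groupoid X X :=
  {| src := id ; tgt := id ; mul := fun x _ => x ; unit_ar := id ;
     inv_ar := id |}.

Definition isotropy (Ob Ar : Type) (G : groupoid Ob Ar) (x : Ob) : set Ar :=
  [set g | src G g = x /\ tgt G g = x].

Definition lie_groupoid (R : realType) (G0 G1 : charted R) (G : groupoid G0 G1) :
    Prop :=
  topological_groupoid G /\
  [/\ smooth_manifold G0, smooth_manifold G1, hausdorff_space G0 &
      forall x : G0, hausdorff_space (set_type (src G @^-1` [set x]))] /\
  [/\ submersion (src G), smooth (tgt G), smooth (unit_ar G), smooth (inv_ar G) &
      @smooth_on R (charted_prod G1 G1) G1 [set p | src G p.1 = tgt G p.2]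
        (fun p => mul G p.1 p.2)].

Definition proper_groupoid (Ob Ar : topologicalType) (G : groupoid Ob Ar) :
    Prop :=
  [/\ hausdorff_space Ob, hausdorff_space Ar &
      forall C : set (Ob * Ob), compact C ->
        compact ((fun g => (src G g, tgt G g)) @^-1` C)].

Definition regular_groupoid (R : realType) (G0 G1 : charted R)
    (G : groupoid G0 G1) : Prop :=
  exists d : nat, forall x : G0, submanifold (isotropy G x) d.

Definition path_joined (R : realType) (X : topologicalType) (x y : X) : Prop :=
  exists gamma : unit_interval R -> X,
    [/\ continuous gamma, gamma (i0 R) = x & gamma (i1 R) = y].

Definition connected_groupoid (R : realType) (Ob Ar : topologicalType)
    (G : groupoid Ob Ar) : Prop :=
  forall x y : Ob, clos_refl_trans Ob
    (fun x y => path_joined R x y \/ exists g, src G g = x /\ tgt G g = y) x y.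

(** ** Translation groupoids *)

Record group_data (L : Type) := GroupData {
  gmul : L -> L -> L ;
  gone : L ;
  ginv : L -> L
}.

Definition lie_group (R : realType) (L : charted R) (gL : group_data L) : Prop :=
  [/\ smooth_manifold L, hausdorff_space L,
      @smooth R (charted_prod L L) L (fun p => gmul gL p.1 p.2) &
      smooth (ginv gL)] /\
  [/\ associative (gmul gL), left_id (gone gL) (gmul gL) &
      left_inverse (gone gL) (ginv gL) (gmul gL)].

Definition smooth_left_action (R : realType) (L M : charted R)
    (gL : group_data L) (act : L -> M -> M) : Prop :=
  [/\ @smooth R (charted_prod L M) M (fun p => act p.1 p.2),
      (forall x, act (gone gL) x = x) &
      (forall h h' x, act (gmul gL h h') x = act h (act h' x))].

(* The arrow (h, x) goes from x to h x. *)
Definition translation_groupoid (R : realType) (L M : charted R)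
    (gL : group_data L) (act : L -> M -> M) : groupoid M (charted_prod L M) :=
  @Groupoid M (charted_prod L M)
    (fun g => g.2)
    (fun g => act g.1 g.2)
    (fun g g' => (gmul gL g.1 g'.1, g'.2))
    (fun x => (gone gL, x))
    (fun g => (ginv gL g.1, act g.1 g.2)).

(** * Principal bundles *)

Record bibundle (H0 H1 G0 G1 P : Type) := Bibundle {
  proj : P -> H0 ;
  moment : P -> G0 ;
  lact : H1 -> P -> P ;  (* lact h p is meant for src h = proj p *)
  ract : P -> G1 -> P    (* ract p g is meant for moment p = tgt g *)
}.

Definition homeo_between (X Y : topologicalType) (A : set X) (B : set Y)
    (f : X -> Y) : Prop :=
  (forall x, A x -> B (f x)) /\ {within A, continuous f} /\
  exists f' : Y -> X,
    [/\ (forall y, B y -> A (f' y)), {within B, continuous f'},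
        (forall x, A x -> f' (f x) = x) & (forall y, B y -> f (f' y) = y)].

Definition diffeo_between (R : realType) (M N : charted R) (A : set M)
    (B : set N) (f : M -> N) : Prop :=
  (forall x, A x -> B (f x)) /\ smooth_on A f /\
  exists f' : N -> M,
    [/\ (forall y, B y -> A (f' y)), smooth_on B f',
        (forall x, A x -> f' (f x) = x) & (forall y, B y -> f (f' y) = y)].

(* Principal G-bundles over H. *)
Definition principal_bundle (H0 H1 G0 G1 P : topologicalType)
    (H : groupoid H0 H1) (G : groupoid G0 G1) (B : bibundle H0 H1 G0 G1 P) :
    Prop :=
  [/\ continuous (proj B), continuous (moment B),
      {within [set z | src H z.1 = proj B z.2],
         continuous (fun z : H1 * P => lact B z.1 z.2)} &
      {within [set z | moment B z.1 = tgt G z.2],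
         continuous (fun z : P * G1 => ract B z.1 z.2)}] /\
  [/\ (forall h p, src H h = proj B p ->
         proj B (lact B h p) = tgt H h /\ moment B (lact B h p) = moment B p),
      (forall p, lact B (unit_ar H (proj B p)) p = p) &
      (forall h h' p, src H h = tgt H h' -> src H h' = proj B p ->
         lact B (mul H h h') p = lact B h (lact B h' p))] /\
  [/\ (forall p g, moment B p = tgt G g ->
         moment B (ract B p g) = src G g /\ proj B (ract B p g) = proj B p),
      (forall p, ract B p (unit_ar G (moment B p)) = p) &
      (forall p g g', moment B p = tgt G g -> src G g = tgt G g' ->
         ract B p (mul G g g') = ract B (ract B p g) g')] /\
  (forall h p g, src H h = proj B p -> moment B p = tgt G g ->
     lact B h (ract B p g) = ract B (lact B h p) g) /\
  (forall x : H0, exists (U : set H0) (tau : H0 -> P),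
     [/\ open U, U x, {within U, continuous tau} &
         forall y, U y -> proj B (tau y) = y]) /\
  homeo_between [set z : P * G1 | moment B z.1 = tgt G z.2]
    [set z : P * P | proj B z.1 = proj B z.2]
    (fun z => (z.1, ract B z.1 z.2)).

Definition smooth_principal_bundle (R : realType) (H0 H1 G0 G1 P : charted R)
    (H : groupoid H0 H1) (G : groupoid G0 G1) (B : bibundle H0 H1 G0 G1 P) :
    Prop :=
  principal_bundle H G B /\ smooth_manifold P /\
  [/\ submersion (proj B), set_surj [set: P] [set: H0] (proj B),
      smooth (moment B),
      @smooth_on R (charted_prod H1 P) P [set z | src H z.1 = proj B z.2]
        (fun z => lact B z.1 z.2) &
      @smooth_on R (charted_prod P G1) P [set z | moment B z.1 = tgt G z.2]
        (fun z => ract B z.1 z.2)] /\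
  @diffeo_between R (charted_prod P G1) (charted_prod P P)
    [set z | moment B z.1 = tgt G z.2] [set z | proj B z.1 = proj B z.2]
    (fun z => (z.1, ract B z.1 z.2)).

(* The identity morphism of G in the Morita category. *)
Definition unit_bibundle (G0 G1 : Type) (G : groupoid G0 G1) :
    bibundle G0 G1 G0 G1 G1 :=
  {| proj := tgt G ; moment := src G ; lact := mul G ; ract := mul G |}.

(* E is isomorphic to the tensor product of Q and P over H: there is an
   equivariant map phi from the fibred product of Q and P over H0 to E, which is
   a surjective submersion (the last clause: it has smooth local sections through
   every point) and whose fibres are the orbits of (q, p) h = (q h, h^-1 p).
   Equivalently, phi induces an isomorphism from the quotient by H onto E. *)
Definition tensor_iso (R : realType) (K0 K1 H0 H1 G0 G1 TQ TP TE : charted R)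
    (K : groupoid K0 K1) (H : groupoid H0 H1) (G : groupoid G0 G1)
    (Q : bibundle K0 K1 H0 H1 TQ) (P : bibundle H0 H1 G0 G1 TP)
    (E : bibundle K0 K1 G0 G1 TE) : Prop :=
  let D : set (TQ * TP) := [set z | moment Q z.1 = proj P z.2] in
  exists phi : TQ * TP -> TE,
    @smooth_on R (charted_prod TQ TP) TE D phi /\
    set_surj D [set: TE] phi /\
    (forall q p q' p', D (q, p) -> D (q', p') ->
       (phi (q, p) = phi (q', p') <->
        exists h, [/\ tgt H h = moment Q q, q' = ract Q q h &
                      p' = lact P (inv_ar H h) p])) /\
    (forall q p, D (q, p) ->
       [/\ proj E (phi (q, p)) = proj Q q, moment E (phi (q, p)) = moment P p,
           (forall k, src K k = proj Q q ->
              phi (lact Q k q, p) = lact E k (phi (q, p))) &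
           (forall g, moment P p = tgt G g ->
              phi (q, ract P p g) = ract E (phi (q, p)) g)]) /\
    (forall z, D z -> exists tau : TE -> TQ * TP,
       [/\ @smooth_at R TE (charted_prod TQ TP) tau (phi z), tau (phi z) = z &
           \forall e \near phi z, D (tau e) /\ phi (tau e) = e]).

(* Isomorphism in the Morita category. *)
Definition morita_equivalent (R : realType) (G0 G1 H0 H1 : charted R)
    (G : groupoid G0 G1) (H : groupoid H0 H1) : Prop :=
  exists (TP TQ : charted R) (P : bibundle H0 H1 G0 G1 TP)
         (Q : bibundle G0 G1 H0 H1 TQ),
    [/\ smooth_principal_bundle H G P, smooth_principal_bundle G H Q,
        tensor_iso G H G Q P (unit_bibundle G) &
        tensor_iso H G H P Q (unit_bibundle H)].

(** * The fundamental group *)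

(* Data of a G-bundle over X with a section msec; only the restriction of msec
   to the marked subset A of X below is meaningful. *)
Record marked_bundle (G0 G1 X : Type) := MarkedBundle {
  total : topologicalType ;
  bundle :> bibundle X X G0 G1 total ;
  msec : X -> total
}.

(* Principal (G, a)-bundles over (X, A), with local sections around the points
   of A that agree with the marked one. *)
Definition marked_principal (G0 G1 X : topologicalType) (G : groupoid G0 G1)
    (a : G0) (A : set X) (B : marked_bundle G0 G1 X) : Prop :=
  [/\ principal_bundle (unit_groupoid X) G B,
      (forall b, A b -> proj B (msec B b) = b /\ moment B (msec B b) = a) &
      forall b, A b -> exists (U : set X) (tau : X -> total B),
        [/\ open U, U b, {within U, continuous tau},
            (forall y, U y -> proj B (tau y) = y) &
            (forall y, U y -> A y -> tau y = msec B y)]].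

Definition boundary (R : realType) : set (unit_interval R) := [set i0 R; i1 R].
Arguments boundary : clear implicits.

Definition loop_bundle (R : realType) (G0 G1 : topologicalType) :=
  marked_bundle G0 G1 (unit_interval R).

(* Q, over I x I, restricts to B over I x {s}, up to isomorphism. *)
Definition restricts_to (R : realType) (G0 G1 : topologicalType)
    (G : groupoid G0 G1)
    (Q : marked_bundle G0 G1 (unit_interval R * unit_interval R)%type)
    (s : unit_interval R) (B : loop_bundle R G0 G1) : Prop :=
  exists f : total B -> total Q,
    [/\ homeo_between [set: total B] [set q | (proj Q q).2 = s] f,
        (forall p, proj Q (f p) = (proj B p, s) /\ moment Q (f p) = moment B p),
        (forall p g, moment B p = tgt G g -> f (ract B p g) = ract Q (f p) g) &
        (forall b, boundary R b -> f (msec B b) = msec Q (b, s))].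

Definition homotopic (R : realType) (G0 G1 : topologicalType)
    (G : groupoid G0 G1) (a : G0) (B B' : loop_bundle R G0 G1) : Prop :=
  exists Q : marked_bundle G0 G1 (unit_interval R * unit_interval R)%type,
    [/\ marked_principal G a (boundary R `*` setT) Q,
        restricts_to G Q (i0 R) B & restricts_to G Q (i1 R) B'].

(* The underlying set of the fundamental group: C is a homotopy class.  Classes
   are plain predicates because [set] does not apply to the (large) type of all
   bundles, for universe reasons. *)
Definition pi1 (R : realType) (G0 G1 : topologicalType)
    (G : groupoid G0 G1) (a : G0) (C : loop_bundle R G0 G1 -> Prop) : Prop :=
  exists2 B : loop_bundle R G0 G1, marked_principal G a (boundary R) B &
    forall B', C B' <->
      marked_principal G a (boundary R) B' /\ homotopic G a B B'.

(** * Ineffective arrows *)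

(* The tangent space at x of the orbit of x: the orbit is the image of the source
   fibre of x under the target map, which has constant rank there. *)
Definition orbit_tangent (R : realType) (G0 G1 : charted R)
    (G : groupoid G0 G1) (x : G0) : set (tvector G0) :=
  [set w | exists2 v, differential (src G) (unit_ar G x) v (fun _ => 0) &
                      differential (tgt G) (unit_ar G x) v w].

(* Equality of classes in N_x G = T_x G0 / T_x O_x. *)
Definition normal_eq (R : realType) (G0 G1 : charted R)
    (G : groupoid G0 G1) (x : G0) (u u' : tvector G0) : Prop :=
  [/\ tangent x u, tangent x u' &
      orbit_tangent G x (fun c => u' c - u c)].

(* The graph of nu(g, -), on representatives of classes of normal vectors. *)
Definition normal_action (R : realType) (G0 G1 : charted R)
    (G : groupoid G0 G1) (g : G1) (u u' : tvector G0) : Prop :=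
  exists v w w',
    [/\ differential (src G) g v w, differential (tgt G) g v w',
        normal_eq G (src G g) u w & normal_eq G (tgt G g) u' w'].

Definition ineffective (R : realType) (G0 G1 : charted R)
    (G : groupoid G0 G1) (x : G0) : set G1 :=
  isotropy G x `&`
  [set g | forall u u', normal_action G g u u' -> normal_eq G x u u'].

(* K_x(G) with the subspace topology; k1 k2 = k3 in this group is expressed by
   [kmul k1 k2 k3]. *)
Definition ineff (R : realType) (G0 G1 : charted R) (G : groupoid G0 G1)
    (x : G0) : topologicalType := set_type (ineffective G x).

Definition ineff_val (R : realType) (G0 G1 : charted R) (G : groupoid G0 G1)
    (x : G0) (k : ineff G x) : G1 := set_val k.

Definition kmul (R : realType) (G0 G1 : charted R) (G : groupoid G0 G1)
    (x : G0) (k1 k2 k3 : ineff G x) : Prop :=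
  ineff_val k3 = mul G (ineff_val k1) (ineff_val k2).

Definition aut_ineff (R : realType) (G0 G1 : charted R)
    (G : groupoid G0 G1) (x : G0) :
    set {compact-open, ineff G x -> ineff G x} :=
  [set alpha : ineff G x -> ineff G x |
    [/\ homeo_between [set: ineff G x] [set: ineff G x] alpha &
        forall k1 k2 k3, kmul k1 k2 k3 ->
          kmul (alpha k1) (alpha k2) (alpha k3)]].

(* The path-component of alpha in Aut(K_x(G)). *)
Definition aut_component (R : realType) (G0 G1 : charted R)
    (G : groupoid G0 G1) (x : G0) (alpha : ineff G x -> ineff G x) :
    set {compact-open, ineff G x -> ineff G x} :=
  [set beta | exists gamma :
     unit_interval R -> {compact-open, ineff G x -> ineff G x},
     [/\ continuous gamma, (forall s, aut_ineff (gamma s)),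
         gamma (i0 R) = alpha & gamma (i1 R) = beta]].

(** * The monodromy map *)

(* phi is a continuous homomorphism from K = K_a(G) to the isotropy group at x,
   i.e. an element of hom(K, G) with omega(phi) = x. *)
Definition hom_at (R : realType) (G0 G1 : charted R) (G : groupoid G0 G1)
    (a x : G0) (phi : {compact-open, ineff G a -> G1}) : Prop :=
  [/\ continuous (phi : ineff G a -> G1),
      (forall k, isotropy G x (phi k)) &
      forall k1 k2 k3, kmul k1 k2 k3 -> phi k3 = mul G (phi k1) (phi k2)].

(* ebar is an equivariant lift of the moment map of (P, sigma) to hom(K, G),
   starting from the inclusion rho at sigma(0). *)
Definition monodromy_lift (R : realType) (G0 G1 : charted R)
    (G : groupoid G0 G1) (a : G0) (B : loop_bundle R G0 G1)
    (ebar : total B -> {compact-open, ineff G a -> G1}) : Prop :=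
  [/\ continuous ebar, (forall p, hom_at (moment B p) (ebar p)),
      (forall p g, moment B p = tgt G g -> forall k,
         ebar (ract B p g) k = mul G (inv_ar G g) (mul G (ebar p k) g)) &
      ebar (msec B (i0 R)) = @ineff_val R G0 G1 G a].

(* The graph of the monodromy map, from pi_1(G, a) to pi_0(Aut(K_a(G))). *)
Definition monodromy (R : realType) (G0 G1 : charted R)
    (G : groupoid G0 G1) (a : G0) (C : loop_bundle R G0 G1 -> Prop)
    (A : set {compact-open, ineff G a -> ineff G a}) : Prop :=
  exists (B : loop_bundle R G0 G1)
         (ebar : total B -> {compact-open, ineff G a -> G1})
         (alpha : ineff G a -> ineff G a),
    [/\ C B, monodromy_lift ebar, aut_ineff alpha,
        ebar (msec B (i1 R)) = @ineff_val R G0 G1 G a \o alpha &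
        A = aut_component alpha].

Definition monodromy_image (R : realType) (G0 G1 : charted R)
    (G : groupoid G0 G1) (a : G0) :
    set (set {compact-open, ineff G a -> ineff G a}) :=
  [set A | exists2 C : loop_bundle R G0 G1 -> Prop, pi1 G a C & monodromy C A].
Arguments monodromy_image {R G0 G1} G a A.

(** * Unitary representations *)

Definition unitary_representation (R : realType) (G0 G1 : charted R)
    (G : groupoid G0 G1) (a : G0) (m : nat) (r : ineff G a -> 'M[R[i]]_m) :
    Prop :=
  [/\ (forall k, r k \is unitarymx),
      (forall k1 k2 k3, kmul k1 k2 k3 -> r k3 = r k1 *m r k2) &
      forall i j, continuous (fun k => complex.Re (r k i j)) /\
                  continuous (fun k => complex.Im (r k i j))].

Definition W (R : realType) (G0 G1 : charted R) (G : groupoid G0 G1) (a : G0)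
    (m : nat) (r : ineff G a -> 'M[R[i]]_m) :
    set {compact-open, ineff G a -> ineff G a} :=
  [set alpha : ineff G a -> ineff G a |
    aut_ineff alpha /\
    exists2 u : 'M[R[i]]_m, u \is unitarymx &
      forall k, r (alpha k) = u *m r k *m invmx u].

(* pi_0(W_r), as a subset of pi_0(Aut(K_a(G))). *)
Definition pi0_W (R : realType) (G0 G1 : charted R) (G : groupoid G0 G1)
    (a : G0) (m : nat) (r : ineff G a -> 'M[R[i]]_m) :
    set (set {compact-open, ineff G a -> ineff G a}) :=
  [set aut_component alpha | alpha in W r].

(* Main.v *)
(* Let Q realize the equivalence with the translation groupoid of L on M.  A loop
   g of G at the image of a point q of Q acts on q as an arrow (h, x) of the
   translation groupoid, g q = q (h, x), and g |-> h is an injective homomorphism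
   to L.  Composed with a faithful orthogonal representation of the compact Lie
   group L, it gives a faithful representation r of K_a(G).  Along a loop (P, sigma)
   the lift of the moment map to hom(K, G) yields in the same way, over each
   t in I, a representation of K, well defined up to equivalence.  It varies
   continuously along local sections of P and Q, and nearby orthogonal
   representations are equivalent, so its class does not depend on t.  At the end
   points it is the class of r and that of r \o alpha, and equivalent unitary
   representations are unitarily equivalent; hence alpha lies in W_r itself.

   The faithful representation of L comes from the Peter-Weyl theorem (with von
   Neumann's mean instead of Haar measure) and the absence of small subgroups.
   That K_a(G) is compact and closed under products is shown on curves, whose
   velocities are lifted through the source submersion. *)
From HB Require Import structures.
Require Import Defs.
From mathcomp Require Import all_boot all_order all_algebra.
From mathcomp Require Import complex spectral.
From mathcomp Require Import all_classical all_reals all_analysis.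
From mathcomp Require Import ring lra.
Set Implicit Arguments.
Unset Strict Implicit.
Unset Printing Implicit Defensive.
Import Order.TTheory GRing.Theory Num.Theory.
Import numFieldNormedType.Exports.
Local Open Scope classical_set_scope.
Local Open Scope ring_scope.

Local Notation coord := Defs.coord.
Local Notation dim := Defs.dim.
Local Notation mul := Defs.mul.
Local Notation proj := Defs.proj.

(** * Invariant means on compact groups *)

(** The analytic obstacle is that continuous functions with the inner product of the mean are not
    complete. A spectral theorem is replaced by a maximizing sequence whose images under convolution
    are equicontinuous, hence converge uniformly along an ultrafilter. The statement that nearby
    orthogonal representations are equivalent needs two facts on K = K_a(G): compactness, which
    makes nearness along the loop uniform over K, and closure under products, by which products of
    values of the lift are again values of the lift. For the latter, the product of G is smooth only
    through local extensions on a fibred product; differentiating it along curves avoids describing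
    the tangent space of that product. The class over a point t must not depend on the chosen points
    of P and Q, so it is stated for all of them: changing a point conjugates by an arrow.
    Principality makes only the right action on Q free. Injectivity of r needs the left action to be
    free, and this comes from the inverse bibundle of the Morita equivalence. *)

Lemma finite_cover (T : topologicalType) (U : T -> set T) :
  compact [set: T] -> (forall x, nbhs x (U x)) ->
  exists s : seq T, forall x, exists2 y, y \in s & U y x.
Proof.
move=> /compact_near_coveringP cT nU.
(* Finite sequences directed by inclusion form a filter: a point covered by one sequence stays
   covered by all larger ones. *)
pose F := filter_from [set: seq T] (fun s => [set s' : seq T | {subset s <= s'}]).
have FF : Filter F.
  apply: filter_from_filter; first by exists [::].
  move=> s s' _ _; exists (s ++ s') => // u h; split=> x xs.
    by apply: h; rewrite mem_cat xs.
  by apply: h; rewrite mem_cat xs orbT.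
have [|s _ /(_ s)] := cT _ F (fun (s : seq T) x => exists2 y, y \in s & U y x) FF.
  move=> x _; exists (U x, [set s' : seq T | {subset [:: x] <= s'}]) => /=.
    by split; [exact: nU|exists [:: x]].
  by move=> [x' s] /= [Ux' xs]; exists x => //; apply: xs; rewrite inE.
by move=> h; exists s => x; exact: h.
Qed.

(** Joint continuity is asked only along the slice over [y0], since families built from local
    sections are controlled only near their base point. *)
Lemma tube_at (R : realType) (X Y : topologicalType) (F : X -> Y -> R) (y0 : Y) :
  compact [set: X] -> (forall x, {for (x, y0), continuous (fun p : X * Y => F p.1 p.2)}) ->
  forall e : R, 0 < e -> \forall y \near y0, forall x, `|F x y - F x y0| < e.
Proof.
move=> /compact_near_coveringP cX cF e e0.
have := cX Y (nbhs y0) (fun y x => `|F x y - F x y0| < e) _.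
move=> H; suff: \forall y \near y0, [set: X] `<=` (fun x => `|F x y - F x y0| < e).
  by apply: filterS => y + x; apply.
apply: H => x _.
have /cvgrPdist_lt /(_ (e / 2)) := cF x.
rewrite divr_gt0// => /(_ isT) [[A B]/= [Ax By] AB].
exists (A, B) => //= -[x' y] /= [Ax' By'].
have /= := AB (x', y) (conj Ax' By').
have /= := AB (x', y0) (conj Ax' (nbhs_singleton By)).
rewrite -[F x' y - _](subrKA (F x y0)) [X in _ -> _ -> _ < X](splitr e) => h1 h2.
rewrite (le_lt_trans (ler_normD _ _))// ltrD//.
by rewrite distrC.
Qed.

Lemma tube (R : realType) (X Y : topologicalType) (F : X -> Y -> R) (y0 : Y) :
  compact [set: X] -> continuous (fun p : X * Y => F p.1 p.2) ->
  forall e : R, 0 < e -> \forall y \near y0, forall x, `|F x y - F x y0| < e.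
Proof. by move=> cX cF; apply: tube_at cX _ => x; exact: cF. Qed.

Definition compact_group (L : topologicalType) (gL : group_data L) :=
  [/\ continuous (fun p : L * L => gmul gL p.1 p.2), continuous (ginv gL) &
      compact [set: L]] /\
  [/\ associative (gmul gL), left_id (gone gL) (gmul gL) &
      left_inverse (gone gL) (ginv gL) (gmul gL)].

(** * Finite averages of translates *)

Section Averages.
Variables (R : realType) (L : Type).
Implicit Types (f : L -> R) (a : L -> L -> L) (s : seq L).

(** The map [a] will be left or right translation. A list may repeat elements, so these are the
    averages with rational weights. *)
Definition avg a s f x : R := (size s)%:R^-1 * \sum_(g <- s) f (a g x).

Lemma avg_ext a s f f' : f =1 f' -> avg a s f =1 avg a s f'.
Proof. by move=> ff' x; rewrite /avg; under eq_bigr do rewrite ff'. Qed.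

Lemma avgD a s f f' x : avg a s (fun x => f x + f' x) x = avg a s f x + avg a s f' x.
Proof. by rewrite /avg big_split mulrDr. Qed.

Lemma avgZ a s c f x : avg a s (fun x => c * f x) x = c * avg a s f x.
Proof. by rewrite /avg -mulr_sumr mulrCA. Qed.

Lemma size_gt0R s : (0 < size s)%N -> 0 < (size s)%:R :> R.
Proof. by rewrite ltr0n. Qed.

Lemma avg_cst a s (c : R) x : (0 < size s)%N -> avg a s (fun=> c) x = c.
Proof.
move=> /size_gt0R s0; rewrite /avg big_const_seq count_predT iter_addr addr0.
by rewrite -[c *+ _]mulr_natl mulrA mulVf ?mul1r// gt_eqF.
Qed.

Lemma avg_le a s f f' : (forall x, f x <= f' x) ->
  forall x, avg a s f x <= avg a s f' x.
Proof.
move=> ff' x; rewrite /avg ler_wpM2l ?invr_ge0//.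
by apply: ler_sum => g _; exact: ff'.
Qed.

Lemma avg_le_cst a s f (M : R) : (0 < size s)%N -> (forall x, f x <= M) ->
  forall x, avg a s f x <= M.
Proof. by move=> s0 fM x; rewrite -(avg_cst a M x s0); exact: avg_le. Qed.

Lemma avg_dist a s f f' (e : R) : (0 < size s)%N -> (forall x, `|f x - f' x| <= e) ->
  forall x, `|avg a s f x - avg a s f' x| <= e.
Proof.
move=> s0 ff' x; have := avg_le_cst a s0 ff' x; apply: le_trans.
rewrite /avg -mulrBr normrM ger0_norm ?invr_ge0// ler_wpM2l ?invr_ge0//.
by rewrite -sumrB; exact: ler_norm_sum.
Qed.

Lemma avg_dist_cst a s f (c e : R) : (0 < size s)%N -> (forall x, `|f x - c| <= e) ->
  forall x, `|avg a s f x - c| <= e.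
Proof. by move=> s0 fc x; rewrite -[X in _ - X](avg_cst a c x s0); exact: avg_dist. Qed.

Lemma avg_comm a b s t f x : (forall g h y, b h (a g y) = a g (b h y)) ->
  avg a s (avg b t f) x = avg b t (avg a s f) x.
Proof.
move=> ab; rewrite /avg -!mulr_sumr mulrCA; congr (_ * (_ * _)).
by rewrite exchange_big; apply: eq_bigr => h _; apply: eq_bigr => g _; rewrite ab.
Qed.

Definition approx a f (c : R) := forall e : R, 0 < e ->
  exists2 s, (0 < size s)%N & forall x, `|avg a s f x - c| <= e.

(** Averaging by both lists at once gives a function close to [c] and, as the translations commute,
    also close to [d]. Applied to left against right translations, this is the source of the
    uniqueness and invariance of the mean. *)
Lemma approx_uniq a b f (c d : R) : inhabited L ->
  (forall g h y, b h (a g y) = a g (b h y)) ->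
  approx a f c -> approx b f d -> c = d.
Proof.
move=> [x] ab ac bd; apply/eqP; rewrite -subr_eq0 -normr_le0.
apply/ler_addgt0Pl => e e0; rewrite addr0.
have e20 : 0 < e / 2 by rewrite divr_gt0.
have [s s0 hs] := ac _ e20; have [t t0 ht] := bd _ e20.
have h1 := avg_dist_cst b t0 hs x; have h2 := avg_dist_cst a s0 ht x.
rewrite (avg_comm _ _ _ _ ab) in h2.
rewrite -(subrKA (avg b t (avg a s f) x)) (splitr e).
by rewrite (le_trans (ler_normD _ _))// lerD// distrC.
Qed.

End Averages.

(** * Von Neumann's mean and its properties *)

Section HaarMean.
Variables (R : realType) (L : topologicalType) (gL : group_data L).
Hypothesis hG : compact_group gL.
Local Notation "x ** y" := (gmul gL x y) (at level 40, left associativity).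
Local Notation "x ^~1" := (ginv gL x) (at level 30).
Local Notation e1 := (gone gL).
Implicit Types (f : L -> R) (s : seq L).

Lemma cgroupA : associative (gmul gL). Proof. by have [_ []] := hG. Qed.
Lemma cgroup1l x : e1 ** x = x. Proof. by have [_ []] := hG. Qed.
Lemma cgroupVl x : x ^~1 ** x = e1. Proof. by have [_ []] := hG. Qed.
Lemma cgroupVr x : x ** x ^~1 = e1.
Proof.
rewrite -[LHS]cgroup1l -{1}(cgroupVl (x ^~1)) -cgroupA (cgroupA _ x) cgroupVl.
by rewrite cgroup1l cgroupVl.
Qed.
Lemma cgroup1r x : x ** e1 = x.
Proof. by rewrite -(cgroupVl x) cgroupA cgroupVr cgroup1l. Qed.
Lemma cgroupKl x y : x ^~1 ** (x ** y) = y.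
Proof. by rewrite cgroupA cgroupVl cgroup1l. Qed.
Lemma cgroupVKl x y : x ** (x ^~1 ** y) = y.
Proof. by rewrite cgroupA cgroupVr cgroup1l. Qed.
Lemma cgroupK x y : y ** x ** x ^~1 = y.
Proof. by rewrite -cgroupA cgroupVr cgroup1r. Qed.
Lemma cgroupVK x y : y ** x ^~1 ** x = y.
Proof. by rewrite -cgroupA cgroupVl cgroup1r. Qed.
Lemma cgroupV_uniq x y : x ** y = e1 -> y = x ^~1.
Proof. by move=> xy; rewrite -(cgroupKl x y) xy cgroup1r. Qed.
Lemma cgroupVV x : (x ^~1) ^~1 = x.
Proof. by symmetry; apply: cgroupV_uniq; rewrite cgroupVl. Qed.
Lemma cgroupV1 : e1 ^~1 = e1.
Proof. by symmetry; apply: cgroupV_uniq; rewrite cgroup1l. Qed.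
Lemma cgroupVM x y : (x ** y) ^~1 = y ^~1 ** x ^~1.
Proof. by symmetry; apply: cgroupV_uniq; rewrite cgroupA cgroupK cgroupVr. Qed.

Lemma cgroup_compact : compact [set: L]. Proof. by have [[]] := hG. Qed.
Lemma cgroup_cvgV (T : Type) (F : set_system T) (u : T -> L) (x : L) : Filter F ->
  u @ F --> x -> (fun t => (u t) ^~1) @ F --> x ^~1.
Proof. by move=> FF ux; have [[_ + _] _] := hG => /(_ x); apply: cvg_comp ux. Qed.
Lemma cgroup_cvgM (T : Type) (F : set_system T) (u v : T -> L) (x y : L) : Filter F ->
  u @ F --> x -> v @ F --> y -> (fun t => u t ** v t) @ F --> x ** y.
Proof.
move=> FF ux vy; have [[+ _ _] _] := hG => /(_ (x, y)).
by move=> /(cvg_comp _ _ (cvg_pair ux vy)).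
Qed.

Lemma sum_cont (X : topologicalType) (I : Type) (r : seq I) (F : I -> X -> R) :
  (forall i, continuous (F i)) -> continuous (fun x => \sum_(i <- r) F i x).
Proof.
move=> cF; elim: r => [|i r ih].
  by under eq_fun do rewrite big_nil; exact: cst_continuous.
by under eq_fun do rewrite big_cons; move=> x; exact: cvgD (cF i x) (ih x).
Qed.

Lemma avg_cont a s f : (forall g, continuous (a g)) -> continuous f ->
  continuous (avg a s f).
Proof.
move=> ca cf x; rewrite /avg; apply: cvgM; first exact: cvg_cst.
apply: (sum_cont (F := fun g x => f (a g x))) => g y.
by apply: continuous_comp; [exact: ca|exact: cf].
Qed.

Let lm := gmul gL.
Let rm : L -> L -> L := fun g x => x ** g.

Lemma lm_cont g : continuous (lm g).
Proof. by move=> x; apply: cgroup_cvgM; [exact: cvg_cst|exact: cvg_id]. Qed.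
Lemma lrm g h y : rm h (lm g y) = lm g (rm h y).
Proof. by rewrite /rm /lm cgroupA. Qed.

Lemma avg_avg s t f x :
  avg lm s (avg lm t f) x = avg lm [seq h ** g | g <- s, h <- t] f x.
Proof.
rewrite /avg size_allpairs natrM invfM -mulrA; congr (_ * _).
rewrite -mulr_sumr; congr (_ * _); rewrite big_allpairs_dep.
by apply: eq_bigr => g _; apply: eq_bigr => h _; rewrite /lm cgroupA.
Qed.

Lemma allpairs_gt0 s t : (0 < size s)%N -> (0 < size t)%N ->
  (0 < size [seq h ** g | g <- s, h <- t])%N.
Proof. by rewrite size_allpairs muln_gt0 => -> ->. Qed.

Lemma cont_bounded f : continuous f -> exists M, forall x, `|f x| <= M.
Proof.
move=> cf; have := continuous_compact (A := [set: L]) (f := f).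
move=> /(_ (continuous_subspaceT cf) cgroup_compact)/compact_bounded.
move=> [M [_ HM]]; exists (M + 1) => x; apply: (HM (M + 1)); first by rewrite ltrDl.
by exists x.
Qed.

(** All left averages of [f] share one modulus of continuity under right multiplication, so [eta]
    does not depend on [s]. If an average dips by more than [d] below one of its values, finitely
    many translates spread the dip over the whole group. *)
Lemma avg_decrease f (d : R) : continuous f -> 0 < d -> exists2 eta, 0 < eta &
  forall s M, (0 < size s)%N -> (forall x, avg lm s f x <= M) ->
    (exists x y, avg lm s f x < avg lm s f y - d) ->
    exists2 s', (0 < size s')%N & forall x, avg lm s' f x <= M - eta.
Proof.
move=> cf d0; have d2 : 0 < d / 2 by rewrite divr_gt0.
have cF : continuous (fun p : L * L => f (p.1 ** p.2)).
  move=> p; apply: continuous_comp; last exact: cf.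
  by have [[+ _ _] _] := hG; apply.
have := @tube R L L (fun x v => f (x ** v)) e1 cgroup_compact cF _ d2.
set V := [set v | forall x, `|f (x ** v) - f (x ** e1)| < d / 2] => nV.
(* Every [x] is [y ** v] with [y] in [c] and [v] in [V]; left translation by [x0 ** y ^~1] carries
   it to [x0 ** v], where the average is low. *)
have [|c hc] := @finite_cover L (fun y => [set x | V (y ^~1 ** x)]) cgroup_compact.
  move=> y; have : y ^~1 ** x @[x --> y] --> e1.
    rewrite -(cgroupVl y); exact: lm_cont.
  exact.
have c0 : (0 < size c)%N by case: (hc e1) => y; case: (c).
have sc := size_gt0R R c0.
exists (d / 2 / (size c)%:R); first by rewrite divr_gt0.
move=> s M s0 hM [x0 [y0 xy]]; set h := avg lm s f in hM xy.
have hV x v : V v -> h (x ** v) <= h x + d / 2.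
  move=> Vv; rewrite -lerBlDl; apply: le_trans (ler_norm _) _.
  rewrite -mulrBr -sumrB normrM ger0_norm ?invr_ge0//.
  rewrite ler_pdivrMl ?size_gt0R// (le_trans (ler_norm_sum _ _ _))//.
  rewrite -sum1_size natr_sum mulr_suml; apply: ler_sum => g _.
  by rewrite mul1r; apply: ltW; have := Vv (lm g x); rewrite /lm cgroupA cgroup1r.
exists [seq h ** g | g <- [seq x0 ** y ^~1 | y <- c], h <- s].
  by apply: allpairs_gt0; rewrite ?size_map.
move=> x; rewrite -avg_avg /avg size_map big_map.
rewrite ler_pdivrMl// mulrBr (mulrC _ (d / 2 / _)) divfK ?gt_eqF//.
rewrite -[leLHS]/(\sum_(y <- c) h (x0 ** y ^~1 ** x)).
have [y yc Vy] := hc x.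
(* One summand is at most [M - d / 2], the others at most [M]; dividing by the length of [c] gives
   the gain [eta]. *)
rewrite (big_rem y yc)/= (perm_size (perm_to_rem yc))/= addrC.
rewrite -natr1 mulrDl mul1r -addrA; apply: lerD.
  have -> : (size (rem y c))%:R * M = \sum_(z <- rem y c) M.
    by rewrite big_const_seq count_predT iter_addr addr0 mulr_natl.
  by apply: ler_sum => z _; exact: hM.
rewrite -cgroupA; apply: le_trans (hV _ _ Vy) _.
have := hM y0; have := xy; rewrite -/h; lra.
Qed.

(** Otherwise the upper bound could be lowered by [eta] any number of times, while every average
    stays above the lower bound of [f]. *)
Lemma avg_osc f (d : R) : continuous f -> 0 < d -> exists2 s, (0 < size s)%N &
  forall x y, `|avg lm s f x - avg lm s f y| <= d.
Proof.
move=> cf d0; apply: contrapT => nos.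
have [eta eta0 dec] := avg_decrease cf d0.
have [M hM] := cont_bounded cf.
have H n : exists2 s, (0 < size s)%N & forall x, avg lm s f x <= M - n%:R * eta.
  elim: n => [|n [s s0 hs]].
    exists [:: e1] => // x; apply: avg_le_cst => // z.
    by rewrite mul0r subr0 (le_trans (ler_norm _)).
  have [|s' s'0 hs'] := dec _ _ s0 hs.
    apply: contrapT => nxy; apply: nos; exists s => // x y.
    rewrite ler_norml; apply/andP; split.
      rewrite lerBrDr addrC leNgt; apply/negP => xy; apply: nxy; exists x, y.
      by move: xy; rewrite ltrBrDr addrC; lra.
    rewrite lerBlDr leNgt; apply/negP => xy; apply: nxy; exists y, x; lra.
  by exists s' => // x; rewrite -natr1 mulrDl mul1r opprD addrA.
pose n := Num.truncn ((M + M) / eta); have [s s0 hs] := H n.+1.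
have := hs e1; apply/negP; rewrite -ltNge.
have : avg lm s (fun=> - M) e1 <= avg lm s f e1.
  by apply: avg_le => x; have := hM x; rewrite ler_norml => /andP[].
rewrite avg_cst//; apply: lt_le_trans.
have : (M + M) / eta < n.+1%:R.
  exact: truncnS_gt.
rewrite ltr_pdivrMr//; lra.
Qed.

(** The constant is the infimum of the upper bounds of averages: an average of small oscillation
    whose upper bound is near this infimum is near it everywhere. *)
Lemma approx_left_ex f : continuous f -> exists c, approx lm f c.
Proof.
move=> cf; pose S := [set M : R | exists2 s, (0 < size s)%N & forall x, avg lm s f x <= M].
have [M0 hM0] := cont_bounded cf.
have S0 : S !=set0.
  exists M0, [:: e1] => // x; apply: avg_le_cst => // z.
  by rewrite (le_trans (ler_norm _)).
have Sb : has_lbound S.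
  exists (- M0) => M [s s0 hs]; apply: le_trans (hs e1).
  rewrite -(avg_cst lm (- M0) e1 s0); apply: avg_le => x.
  by have := hM0 x; rewrite ler_norml => /andP[].
exists (inf S) => e e0; have e20 : 0 < e / 2 by rewrite divr_gt0.
have [M [t t0 ht] Mlt] := inf_adherent e20 (conj S0 Sb).
have [s s0 hs] := avg_osc (avg_cont (s := t) lm_cont cf) e20.
have u0 := allpairs_gt0 s0 t0.
exists [seq h ** g | g <- s, h <- t] => // x.
have up : forall y, avg lm s (avg lm t f) y <= M by exact: avg_le_cst.
have [y hy] : exists y, inf S - e / 2 <= avg lm s (avg lm t f) y.
  apply: contrapT => /forallNP ny.
  have : S (inf S - e / 2).
    exists [seq h ** g | g <- s, h <- t] => // y; rewrite -avg_avg.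
    by apply: ltW; rewrite ltNge; apply/negP; exact: ny.
  by move=> /(ge_inf Sb); rewrite leNgt ltrBlDr ltrDl e20.
rewrite -avg_avg; have := hs x y; have := up x.
rewrite !ler_norml => ? /andP[? ?]; apply/andP; split; lra.
Qed.

Lemma approx_right_ex f : continuous f -> exists c, approx rm f c.
Proof.
move=> cf; have [|c hc] := @approx_left_ex (f \o ginv gL).
  by move=> x; apply: continuous_comp; [have [[_ + _] _] := hG; exact|exact: cf].
exists c => e /hc [s s0 hs]; exists (map (ginv gL) s).
  by rewrite size_map.
move=> x; have := hs (x ^~1); rewrite /avg size_map big_map.
suff -> : \sum_(g <- s) (f \o ginv gL) (lm g (x ^~1)) =
          \sum_(j <- s) f (rm (j ^~1) x) by [].
by apply: eq_bigr => g _ /=; rewrite /lm /rm cgroupVM cgroupVV.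
Qed.

(* Von Neumann's mean: the only constant that is a uniform limit of averages of
   left translates of f (0 if there is none). *)
Definition haar f : R := xget 0 (approx (gmul gL) f).

Lemma haarP f : continuous f -> approx lm f (haar f).
Proof. by move=> cf; have [c hc] := approx_left_ex cf; apply: (xgetI 0 hc). Qed.

Lemma haarPr f : continuous f -> approx rm f (haar f).
Proof.
move=> cf; have [c hc] := approx_right_ex cf.
by rewrite (approx_uniq (inhabits e1) lrm (haarP cf) hc).
Qed.

Lemma haar_left f c : continuous f -> approx lm f c -> haar f = c.
Proof.
by move=> cf hc; rewrite (approx_uniq (inhabits e1) lrm hc (haarPr cf)).
Qed.

Lemma haar_right f c : continuous f -> approx rm f c -> haar f = c.
Proof. by move=> cf hc; apply: (approx_uniq (inhabits e1) lrm (haarP cf) hc). Qed.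

(** A list good for [f] is followed by one good for the averaged [h]. The second averaging keeps [f]
    nearly constant, and the first does not change the mean of [h]. *)
Lemma haarD f h : continuous f -> continuous h ->
  haar (fun x => f x + h x) = haar f + haar h.
Proof.
move=> cf ch; apply: haar_left; first by move=> x; exact: cvgD (cf x) (ch x).
move=> e e0; have e20 : 0 < e / 2 by rewrite divr_gt0.
have [s s0 hs] := haarP cf e20.
have csh : continuous (avg lm s h) := avg_cont (s := s) lm_cont ch.
have hsh : haar (avg lm s h) = haar h.
  apply: haar_right => // d d0; have [t t0 ht] := haarPr ch d0.
  exists t => // x; rewrite -(avg_comm s t h x lrm); exact: avg_dist_cst.
have [t t0 ht] := haarP csh e20; exists [seq h ** g | g <- t, h <- s].
  exact: allpairs_gt0.
move=> x; rewrite -avg_avg (avg_ext _ _ (avgD lm s f h)) avgD opprD addrACA.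
rewrite (splitr e) (le_trans (ler_normD _ _))// lerD//; last by rewrite -hsh.
exact: avg_dist_cst.
Qed.

Lemma haarZ c f : continuous f -> haar (fun x => c * f x) = c * haar f.
Proof.
move=> cf; apply: haar_left; first by move=> x; apply: cvgM (cf x); exact: cvg_cst.
move=> e e0; have c0 : 0 < `|c| + 1 by rewrite ltr_wpDl.
have [|s s0 hs] := haarP cf (e := e / (`|c| + 1)); first by rewrite divr_gt0.
exists s => // x; rewrite avgZ -mulrBr normrM.
have := hs x; rewrite ler_pdivlMr// mulrDr mulr1 mulrC.
by apply: le_trans; rewrite lerDl.
Qed.

Lemma haarB f h : continuous f -> continuous h ->
  haar (fun x => f x - h x) = haar f - haar h.
Proof.
move=> cf ch; rewrite -[- haar h]mulN1r -haarZ// -haarD//.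
  by congr haar; apply/funext => x; rewrite mulN1r.
by move=> x; apply: cvgM (ch x); exact: cvg_cst.
Qed.

Lemma haar_cst c : haar (fun=> c) = c.
Proof.
apply: haar_left; first exact: cst_continuous.
by move=> e e0; exists [:: e1] => // x; rewrite avg_cst// subrr normr0 ltW.
Qed.

Lemma haar_ge0 f : continuous f -> (forall x, 0 <= f x) -> 0 <= haar f.
Proof.
move=> cf f0; apply/ler_addgt0Pl => e e0.
have [s s0 hs] := haarP cf e0; have := hs e1.
rewrite ler_norml => /andP[_]; rewrite lerBlDl addrC; apply: le_trans.
by rewrite -(avg_cst lm 0 e1 s0); exact: avg_le.
Qed.

Lemma haar_le f h : continuous f -> continuous h -> (forall x, f x <= h x) ->
  haar f <= haar h.
Proof.
move=> cf ch fh; rewrite -subr_ge0 -haarB//; apply: haar_ge0.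
  by move=> x; exact: cvgB (ch x) (cf x).
by move=> x; rewrite subr_ge0.
Qed.

Lemma haar_dist f h e : continuous f -> continuous h ->
  (forall x, `|f x - h x| <= e) -> `|haar f - haar h| <= e.
Proof.
move=> cf ch fh; rewrite -haarB// ler_norml.
have cfh : continuous (fun x => f x - h x) by move=> x; exact: cvgB (cf x) (ch x).
apply/andP; split.
  rewrite -(haar_cst (- e)); apply: haar_le => //; first exact: cst_continuous.
  by move=> x; have := fh x; rewrite ler_norml => /andP[].
rewrite -[leRHS](haar_cst e); apply: haar_le => //; first exact: cst_continuous.
by move=> x; have := fh x; rewrite ler_norml => /andP[].
Qed.

(** The mean is also approximated by right averages, and these commute with left translation. *)
Lemma haar_lshift f g : continuous f -> haar (fun x => f (g ** x)) = haar f.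
Proof.
move=> cf; apply: haar_right.
  by move=> x; apply: continuous_comp; [exact: lm_cont|exact: cf].
move=> e e0; have [s s0 hs] := haarPr cf e0; exists s => // x.
rewrite /avg; under eq_bigr do rewrite cgroupA; exact: hs.
Qed.

Lemma haar_inv f : continuous f -> haar (fun x => f (x ^~1)) = haar f.
Proof.
move=> cf; apply: haar_right.
  move=> x; apply: continuous_comp; last exact: cf.
  by have [[_ + _] _] := hG; apply.
move=> e e0; have [s s0 hs] := haarP cf e0; exists (map (ginv gL) s).
  by rewrite size_map.
move=> x; have := hs (x ^~1); rewrite /avg size_map big_map.
by under [X in _ -> `|_ * X - _| <= _]eq_bigr do rewrite cgroupVM cgroupVV.
Qed.

(** Finitely many translates of the region where [f] exceeds half of [f x0] cover the group, so some
    average of [f], which has the same mean, is bounded below by a positive constant. *)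
Lemma haar_gt0 f x0 : continuous f -> (forall x, 0 <= f x) -> 0 < f x0 ->
  0 < haar f.
Proof.
move=> cf f0 fx0.
have n0 : nbhs x0 [set x | f x0 / 2 < f x].
  apply: (cf x0 [set y | f x0 / 2 < y]); apply: open_nbhs_nbhs.
  by split; [exact: open_gt|rewrite /= ltr_pdivrMr// ltr_pMr// ltr1n].
have [|c hc] := @finite_cover L (fun y => [set x | f x0 / 2 < f (x0 ** y ^~1 ** x)])
  cgroup_compact.
  move=> y; have : x0 ** y ^~1 ** x @[x --> y] --> x0.
    by rewrite -{2}(cgroupVK y x0); exact: lm_cont.
  by move=> /(_ _ n0).
have c0 : (0 < size c)%N by case: (hc e1) => y; case: (c).
pose s := [seq x0 ** y ^~1 | y <- c].
have s0 : (0 < size s)%N by rewrite size_map.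
have low x : f x0 / 2 / (size c)%:R <= avg lm s f x.
  rewrite /avg size_map mulrC ler_wpM2l ?invr_ge0// big_map.
  have [y yc /= /ltW hy] := hc x; apply: le_trans hy _.
  by rewrite (big_rem y yc)/= lerDl sumr_ge0.
have -> : haar f = haar (avg lm s f).
  symmetry; apply: haar_right; first exact: (avg_cont (s := s) lm_cont cf).
  move=> d d0; have [t t0 ht] := haarPr cf d0.
  exists t => // x; rewrite -(avg_comm s t f x lrm); exact: avg_dist_cst.
apply: lt_le_trans (_ : haar (fun=> f x0 / 2 / (size c)%:R) <= _).
  by rewrite haar_cst !divr_gt0// ltr0n.
apply: haar_le => //; first exact: cst_continuous.
exact: (avg_cont (s := s) lm_cont cf).
Qed.

Lemma section_cont (X Y : topologicalType) (F : X -> Y -> R) x :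
  continuous (fun p : X * Y => F p.1 p.2) -> continuous (F x).
Proof.
move=> cF y; apply: (cvg_comp (fun y => (x, y)) _ _ (cF (x, y))).
by apply: cvg_pair; [exact: cvg_cst|exact: cvg_id].
Qed.

Lemma swap_cont (X Y Z : topologicalType) (F : X -> Y -> Z) :
  continuous (fun p : X * Y => F p.1 p.2) ->
  continuous (fun p : Y * X => F p.2 p.1).
Proof.
move=> cF p; apply: (cvg_comp (fun p => (p.2, p.1)) _ _ (cF (p.2, p.1))).
by apply: cvg_pair; [exact: cvg_snd|exact: cvg_fst].
Qed.

Lemma haar_param (X : topologicalType) (F : X -> L -> R) :
  continuous (fun p : X * L => F p.1 p.2) -> continuous (fun x => haar (F x)).
Proof.
move=> cF x; apply/cvgrPdist_le => e e0.
have := @tube R L X (fun y x => F x y) x cgroup_compact (swap_cont cF) _ e0.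
apply: filterS => x' hx'; rewrite distrC; apply: haar_dist.
- exact: section_cont.
- exact: section_cont.
- by move=> y; exact: ltW.
Qed.

Lemma haar_simultaneous (fs : seq (L -> R)) e : 0 < e ->
  (forall f, List.In f fs -> continuous f) ->
  exists2 s, (0 < size s)%N &
    forall f, List.In f fs -> forall x, `|avg lm s f x - haar f| <= e.
Proof.
move=> e0; elim: fs => [|f fs ih] cfs; first by exists [:: e1].
have [|s s0 hs] := ih; first by move=> h hh; apply: cfs; right.
have cf : continuous f by apply: cfs; left.
have csf : continuous (avg lm s f) := avg_cont (s := s) lm_cont cf.
have hsh : haar (avg lm s f) = haar f.
  apply: haar_right => // d d0; have [t t0 ht] := haarPr cf d0.
  exists t => // x; rewrite -(avg_comm s t f x lrm); exact: avg_dist_cst.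
have [t t0 ht] := haarP csf e0; exists [seq h ** g | g <- t, h <- s].
  exact: allpairs_gt0.
move=> h [<-|hin] x; rewrite -avg_avg; first by rewrite -hsh.
by apply: avg_dist_cst => // y; exact: hs.
Qed.

Lemma haar_uniform (X : topologicalType) (F : X -> L -> R) e :
  compact [set: X] -> continuous (fun p : X * L => F p.1 p.2) -> 0 < e ->
  exists2 s, (0 < size s)%N &
    forall x y, `|avg lm s (F x) y - haar (F x)| <= e.
Proof.
move=> cX cF e0; have e30 : 0 < e / 3 by rewrite divr_gt0.
have [|c hc] := @finite_cover X (fun x' => [set x | forall y, `|F x y - F x' y| < e / 3]) cX.
  move=> x'; exact: (@tube R L X (fun y x => F x y) x' cgroup_compact (swap_cont cF) _ e30).
have [|s s0 hs] := @haar_simultaneous (map F c) _ e30.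
  by move=> f /List.in_map_iff[x [<- _]]; exact: section_cont.
exists s => // x y; have [x' x'c hx'] := hc x.
have Fx' : List.In (F x') (map F c).
  apply/List.in_map_iff; exists x'; split => //.
  by elim: (c) x'c => //= z c' ih; rewrite inE => /orP[/eqP->|/ih]; [left|right].
have h1 := hs _ Fx' y.
have h2 : `|avg lm s (F x) y - avg lm s (F x') y| <= e / 3.
  by apply: avg_dist => // z; exact: ltW.
have h3 : `|haar (F x) - haar (F x')| <= e / 3.
  by apply: haar_dist; try exact: section_cont; move=> z; exact: ltW.
move: h1 h2 h3; rewrite !ler_norml => /andP[? ?] /andP[? ?] /andP[? ?].
by apply/andP; split; lra.
Qed.

(** A list that works uniformly in [x] replaces one of the two means by a finite average, which
    passes through the other by linearity. *)
Lemma haar_fubini (F : L -> L -> R) :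
  continuous (fun p : L * L => F p.1 p.2) ->
  haar (fun x => haar (F x)) = haar (fun y => haar (fun x => F x y)).
Proof.
move=> cF; symmetry; apply: haar_left.
  by apply: haar_param; exact: swap_cont.
move=> e e0; have [s s0 hs] := haar_uniform cgroup_compact cF e0.
exists s => // y.
have cFy z : continuous (fun x => F x z).
  exact: (section_cont (F := fun y x => F x y) (swap_cont cF)).
have csum s' : continuous (fun x => \sum_(g <- s') F x (lm g y)).
  by apply: sum_cont => g; exact: cFy.
suff -> : avg lm s (fun y => haar (fun x => F x y)) y = haar (fun x => avg lm s (F x) y).
  apply: haar_dist => //; last exact: haar_param.
  by rewrite /avg => x; apply: cvgM; [exact: cvg_cst|exact: csum].
rewrite /avg haarZ//; congr (_ * _).
elim: (s) => [|g s' ih].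
  by rewrite big_nil -[LHS](haar_cst 0); congr haar; apply/funext => x; rewrite big_nil.
rewrite big_cons ih -haarD//.
by congr haar; apply/funext => x; rewrite big_cons.
Qed.

End HaarMean.

(** * The Peter-Weyl theorem *)

Lemma normr_le_sq (R : realDomainType) (x y : R) : 0 <= y -> x * x <= y * y -> `|x| <= y.
Proof. by move=> y0; rewrite -!expr2 -(real_normK (num_real x)) ler_pXn2r. Qed.

Lemma eq0_le_eps (R : realFieldType) (c x : R) :
  (forall e, 0 < e -> `|x| <= c * e) -> x = 0.
Proof.
move=> h; apply/eqP; rewrite -normr_le0; apply/ler_addgt0Pl => e e0; rewrite addr0.
have c0 : 0 < `|c| + 1 by rewrite ltr_wpDl.
apply: le_trans (h (e / (`|c| + 1)) _) _; first by rewrite divr_gt0.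
rewrite mulrCA ger_pMr// ler_pdivrMr// mul1r.
by rewrite (le_trans (ler_norm _))// lerDl.
Qed.

Lemma fmap_ultra (T T' : Type) (f : T -> T') (U : set_system T) :
  UltraFilter U -> UltraFilter (f @ U).
Proof.
move=> UU; split=> [|G GP UG]; first exact: fmap_proper_filter.
rewrite predeqE => B; split=> [GB|]; last exact: UG.
have [//|nB] := in_ultra_setVsetC (f @^-1` B) UU.
have : G (B `&` ~` B) by apply: filterI => //; exact: UG.
by rewrite setICr => /filter_not_empty.
Qed.

Section PeterWeyl.
Variables (R : realType) (L : topologicalType) (gL : group_data L).
Hypothesis hG : compact_group gL.
Local Notation "x ** y" := (gmul gL x y) (at level 40, left associativity).
Local Notation "x ^~1" := (ginv gL x) (at level 30).
Local Notation e1 := (gone gL).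
Local Notation haar := (haar gL).
Implicit Types (f h u : L -> R).

Lemma mul_cont (X : topologicalType) (f h : X -> R) :
  continuous f -> continuous h -> continuous (fun x => f x * h x).
Proof. by move=> cf ch x; exact: cvgM (cf x) (ch x). Qed.
Lemma scale_cont c f : continuous f -> continuous (fun x => c * f x).
Proof. by move=> cf; apply: mul_cont => //; exact: cst_continuous. Qed.
Lemma add_cont f h : continuous f -> continuous h -> continuous (fun x => f x + h x).
Proof. by move=> cf ch x; exact: cvgD (cf x) (ch x). Qed.
Lemma sub_cont f h : continuous f -> continuous h -> continuous (fun x => f x - h x).
Proof. by move=> cf ch x; exact: cvgB (cf x) (ch x). Qed.
Lemma lshift_cont g f : continuous f -> continuous (fun x => f (g ** x)).
Proof. by move=> cf x; apply: continuous_comp; [exact: (lm_cont hG)|exact: cf]. Qed.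
Lemma inv_cont f : continuous f -> continuous (fun x => f (x ^~1)).
Proof.
move=> cf x; apply: continuous_comp; last exact: cf.
by have [[_ + _] _] := hG; apply.
Qed.

(** * The inner product given by the mean *)

Definition ip f h : R := haar (fun x => f x * h x).
Local Notation nsq f := (ip f f).

Lemma ipC f h : ip f h = ip h f.
Proof. by rewrite /ip; congr haar; apply/funext => x; rewrite mulrC. Qed.
Lemma ipDl f f' h : continuous f -> continuous f' -> continuous h ->
  ip (fun x => f x + f' x) h = ip f h + ip f' h.
Proof.
move=> cf cf' ch; rewrite /ip -(haarD hG); [|exact: mul_cont|exact: mul_cont].
by congr haar; apply/funext => x; rewrite mulrDl.
Qed.
Lemma ipZl c f h : continuous f -> continuous h ->
  ip (fun x => c * f x) h = c * ip f h.
Proof.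
move=> cf ch; rewrite /ip -(haarZ hG); last exact: mul_cont.
by congr haar; apply/funext => x; rewrite mulrA.
Qed.
Lemma ipBl f f' h : continuous f -> continuous f' -> continuous h ->
  ip (fun x => f x - f' x) h = ip f h - ip f' h.
Proof.
move=> cf cf' ch; rewrite /ip -(haarB hG); [|exact: mul_cont|exact: mul_cont].
by congr haar; apply/funext => x; rewrite mulrBl.
Qed.
Lemma ipBr f h h' : continuous f -> continuous h -> continuous h' ->
  ip f (fun x => h x - h' x) = ip f h - ip f h'.
Proof. by move=> *; rewrite ipC ipBl// !(ipC f). Qed.
Lemma ipZr c f h : continuous f -> continuous h ->
  ip f (fun x => c * h x) = c * ip f h.
Proof. by move=> *; rewrite ipC ipZl// (ipC f). Qed.
Lemma ip_suml (I : Type) (r : seq I) (F : I -> L -> R) h :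
  (forall i, continuous (F i)) -> continuous h ->
  ip (fun x => \sum_(i <- r) F i x) h = \sum_(i <- r) ip (F i) h.
Proof.
move=> cF ch; elim: r => [|i r ih].
  rewrite big_nil -[RHS](haar_cst hG 0); congr haar; apply/funext => x.
  by rewrite big_nil mul0r.
rewrite big_cons -ih -ipDl//; last by apply: sum_cont.
by congr ip; apply/funext => x; rewrite big_cons.
Qed.
Lemma ip_shift g f h : continuous f -> continuous h ->
  ip (fun x => f (g ** x)) (fun x => h (g ** x)) = ip f h.
Proof. by move=> cf ch; rewrite /ip -[RHS](haar_lshift hG g)//; exact: mul_cont. Qed.
Lemma nsq_ge0 f : continuous f -> 0 <= nsq f.
Proof.
move=> cf; apply: (haar_ge0 hG) => [|x]; first exact: mul_cont.
by rewrite -expr2 sqr_ge0.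
Qed.
Lemma nsq_eq0 f : continuous f -> nsq f = 0 -> forall x, f x = 0.
Proof.
move=> cf n0 x; apply/eqP; apply: contra_eqT n0 => fx; rewrite gt_eqF//.
apply: (haar_gt0 (x0 := x) hG) => [|y|]; first exact: mul_cont.
  by rewrite -expr2 sqr_ge0.
by rewrite -expr2 exprn_even_gt0.
Qed.
Lemma nsq_le (f : L -> R) M : continuous f -> (forall x, f x * f x <= M) -> nsq f <= M.
Proof.
move=> cf hM; rewrite -[leRHS](haar_cst hG M); apply: (haar_le hG) => //.
  exact: mul_cont.
exact: cst_continuous.
Qed.
Lemma nsqZ c f : continuous f -> nsq (fun x => c * f x) = c * c * nsq f.
Proof. by move=> cf; rewrite ipZl ?ipZr ?mulrA//; exact: scale_cont. Qed.
Lemma nsqB f h : continuous f -> continuous h ->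
  nsq (fun x => f x - h x) = nsq f - ip f h *+ 2 + nsq h.
Proof.
move=> cf ch; rewrite ipBl ?ipBr//; last exact: sub_cont.
by rewrite (ipC h f) mulr2n; ring.
Qed.

Lemma cauchy_schwarz f h : continuous f -> continuous h ->
  ip f h * ip f h <= nsq f * nsq h.
Proof.
move=> cf ch; have [n0|n0] := eqVneq (nsq h) 0.
  have -> : ip f h = 0.
    rewrite -(haar_cst hG 0); congr haar; apply/funext => x.
    by rewrite (nsq_eq0 ch n0) mulr0.
  by rewrite n0 !mulr0.
have np : 0 < nsq h by rewrite lt_neqAle eq_sym n0 nsq_ge0.
have := nsq_ge0 (sub_cont cf (scale_cont (c := ip f h / nsq h) ch)).
rewrite nsqB ?nsqZ ?ipZr//; last exact: scale_cont.
have -> : nsq f - (ip f h / nsq h * ip f h) *+ 2 + ip f h / nsq h * (ip f h / nsq h) * nsq h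
  = nsq f - ip f h * ip f h / nsq h by rewrite mulr2n; field.
by rewrite subr_ge0 ler_pdivrMr.
Qed.

(** * Convolution with a symmetric kernel and its eigenspaces *)

Section Kernel.
Variable k : L -> R.
Hypothesis ck : continuous k.
Hypothesis sk : forall x, k (x ^~1) = k x.

Definition convol f x : R := haar (fun y => k (x ^~1 ** y) * f y).
Local Notation T := convol.
Local Notation kap := (nsq k).

Lemma kernel_cont : continuous (fun p : L * L => k (p.1 ^~1 ** p.2)).
Proof.
move=> p; apply: continuous_comp; last exact: ck.
apply: (cgroup_cvgM hG); last exact: cvg_snd.
by apply: (cgroup_cvgV hG); exact: cvg_fst.
Qed.

Lemma kernel_mul_cont f : continuous f ->
  continuous (fun p : L * L => k (p.1 ^~1 ** p.2) * f p.2).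
Proof.
move=> cf p; apply: cvgM; first exact: kernel_cont.
by apply: continuous_comp; [exact: cvg_snd|exact: cf].
Qed.

Lemma convol_cont f : continuous f -> continuous (T f).
Proof.
move=> cf; exact: (haar_param hG (F := fun x y => k (x ^~1 ** y) * f y) (kernel_mul_cont cf)).
Qed.

Lemma convol_ip f x : T f x = ip (fun y => k (x ^~1 ** y)) f. Proof. by []. Qed.

Lemma convolB f h : continuous f -> continuous h ->
  T (fun x => f x - h x) = (fun x => T f x - T h x).
Proof. by move=> cf ch; apply/funext => x; rewrite convol_ip ipBr//; exact: lshift_cont. Qed.
Lemma convolZ c f : continuous f -> T (fun x => c * f x) = (fun x => c * T f x).
Proof. by move=> cf; apply/funext => x; rewrite convol_ip ipZr//; exact: lshift_cont. Qed.

Lemma convol_bound f x : continuous f -> T f x * T f x <= kap * nsq f.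
Proof.
move=> cf; apply: le_trans (cauchy_schwarz _ cf) _; first exact: lshift_cont.
by rewrite (ip_shift (x ^~1) ck ck).
Qed.

Lemma nsq_convol f : continuous f -> nsq (T f) <= kap * nsq f.
Proof.
move=> cf; apply: nsq_le; first exact: convol_cont.
by move=> x; exact: convol_bound.
Qed.

Lemma convol_sym f h : continuous f -> continuous h -> ip (T f) h = ip f (T h).
Proof.
move=> cf ch; rewrite /ip.
have cF : continuous (fun p : L * L => k (p.1 ^~1 ** p.2) * f p.2 * h p.1).
  move=> p; apply: cvgM; first exact: kernel_mul_cont.
  by apply: continuous_comp; [exact: cvg_fst|exact: ch].
transitivity (haar (fun x => haar (fun y => k (x ^~1 ** y) * f y * h x))).
  congr haar; apply/funext => x; rewrite mulrC -(haarZ hG).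
    by congr haar; apply/funext => y; rewrite mulrC.
  by apply: mul_cont => //; exact: lshift_cont.
rewrite (haar_fubini hG cF); congr haar; apply/funext => y; rewrite -(haarZ hG).
  congr haar; apply/funext => x.
  by rewrite -[k (y ^~1 ** x)]sk (cgroupVM hG) (cgroupVV hG); ring.
by apply: mul_cont => //; exact: lshift_cont.
Qed.

Lemma convol_shift g f x : continuous f -> T (fun y => f (g ** y)) x = T f (g ** x).
Proof.
move=> cf; rewrite /convol -(haar_lshift hG g (f := fun y => k ((g ** x) ^~1 ** y) * f y)).
  by congr haar; apply/funext => y; rewrite (cgroupVM hG) -(cgroupA hG) (cgroupKl hG).
by apply: mul_cont => //; exact: lshift_cont.
Qed.

(** By Cauchy-Schwarz the variation is controlled by the norm of the difference of two translated
    kernels, which does not involve [f]. This takes the place of compactness of the operator. *)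
Lemma convol_equicont x0 (e : R) : 0 < e -> \forall x \near x0,
  forall f, continuous f -> nsq f <= 1 -> `|T f x - T f x0| <= e.
Proof.
move=> e0.
have cG : continuous (fun p : L * L => k (p.1 ^~1 ** p.2) - k (x0 ^~1 ** p.2)).
  move=> p; apply: cvgB; first exact: kernel_cont.
  by apply: (cvg_comp snd (fun y => k (x0 ^~1 ** y)) cvg_snd); exact: lshift_cont.
have cD := haar_param hG (F := fun x y => (k (x ^~1 ** y) - k (x0 ^~1 ** y)) *
   (k (x ^~1 ** y) - k (x0 ^~1 ** y))) (mul_cont cG cG).
have /cvgrPdist_le /(_ (e * e) (mulr_gt0 e0 e0)) := cD x0.
apply: filterS => x; rewrite (_ : haar _ = 0); last first.
  rewrite -[RHS](haar_cst hG); congr haar; apply/funext => y.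
  by rewrite subrr mul0r.
rewrite sub0r normrN => hx f cf nf; apply: normr_le_sq; first exact: ltW.
have cs y : continuous (fun z => k (y ^~1 ** z)) by exact: lshift_cont.
rewrite !convol_ip -ipBl//.
apply: le_trans (cauchy_schwarz (sub_cont (cs x) (cs x0)) cf) _.
apply: le_trans (le_trans (ler_norm _) hx).
by rewrite ler_piMr// nsq_ge0//; exact: sub_cont.
Qed.

(* [T^2] rather than [T]: only positive eigenvalues occur. *)
Definition eigen nu u := continuous u /\ forall x, T (T u) x = nu * u x.

Lemma eigen_convol nu u : eigen nu u -> eigen nu (T u).
Proof.
move=> [cu Eu]; split; first exact: convol_cont.
by move=> x; rewrite (_ : T (T u) = fun x => nu * u x) ?convolZ//; exact/funext.
Qed.

Definition eigen_orth f := continuous f /\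
  forall nu u, 0 < nu -> eigen nu u -> ip f u = 0.

Lemma eigen_orth_convol f : eigen_orth f -> eigen_orth (T f).
Proof.
move=> [cf of_]; split; first exact: convol_cont.
move=> nu u nu0 Eu; rewrite convol_sym//; last by case: Eu.
by apply: of_ nu0 _; exact: eigen_convol.
Qed.

Lemma eigen_orthZ c f : eigen_orth f -> eigen_orth (fun x => c * f x).
Proof.
move=> [cf of_]; split; first exact: scale_cont.
move=> nu u nu0 Eu; rewrite ipZl//; last by case: Eu.
by rewrite (of_ _ _ nu0 Eu) mulr0.
Qed.

(* A maximizing sequence for [nsq (T f)] on the unit ball of the orthogonal
   complement of all eigenfunctions would produce one more eigenfunction. *)
Lemma convol_eigen_orth f x : eigen_orth f -> T f x = 0.
Proof.
move=> of0; apply: contrapT => Tfx.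
have cf0 : continuous f by case: of0.
pose S := [set m | exists2 f, eigen_orth f /\ nsq f <= 1 & m = nsq (T f)].
have Sub : has_ubound S.
  exists kap => m [h [[ch _] nh] ->]; apply: le_trans (nsq_convol ch) _.
  by rewrite ler_piMr// nsq_ge0.
have normalize h : eigen_orth h -> nsq h != 0 ->
    S (nsq (T h) / nsq h).
  move=> oh nh0; have ch : continuous h by case: oh.
  have nhp : 0 < nsq h by rewrite lt_neqAle eq_sym nh0 nsq_ge0.
  have s2 : (Num.sqrt (nsq h))^-1 * (Num.sqrt (nsq h))^-1 = (nsq h)^-1.
    by rewrite -invfM -expr2 sqr_sqrtr// ltW.
  exists (fun x => (Num.sqrt (nsq h))^-1 * h x).
    split; first exact: eigen_orthZ.
    by rewrite nsqZ// s2 mulVf.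
  by rewrite convolZ// nsqZ ?s2 1?mulrC//; exact: convol_cont.
have nf0 : nsq f != 0.
  apply/eqP => n0; apply: Tfx; rewrite -(haar_cst hG 0); congr haar.
  by apply/funext => y; rewrite (nsq_eq0 cf0 n0) mulr0.
pose mu := sup S.
have mu0 : 0 < mu.
  apply: lt_le_trans (ub_le_sup Sub (normalize _ of0 nf0)).
  rewrite divr_gt0//; last by rewrite lt_neqAle eq_sym nf0 nsq_ge0.
  rewrite lt_neqAle nsq_ge0 ?andbT; last exact: convol_cont.
  by apply/eqP => /esym n0; apply: Tfx; apply: nsq_eq0 n0 _; exact: convol_cont.
have Smu h : eigen_orth h -> nsq (T h) <= mu * nsq h.
  move=> oh; have ch : continuous h by case: oh.
  have [n0|n0] := eqVneq (nsq h) 0.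
    by have := nsq_convol ch; rewrite n0 !mulr0.
  have np : 0 < nsq h by rewrite lt_neqAle eq_sym n0 nsq_ge0.
  by rewrite -ler_pdivrMr//; apply: (ub_le_sup Sub); exact: normalize.
have hS : has_sup S by split => //; exists (nsq (T f) / nsq f); exact: normalize.
have /choice [F hF] : forall n : nat, exists h,
    [/\ eigen_orth h, nsq h <= 1 & mu - n.+1%:R^-1 < nsq (T h)].
  move=> n; have [|m [h [oh nh] ->] hm] := sup_adherent (eps := n.+1%:R^-1) _ hS.
    by rewrite invr_gt0.
  by exists h.
have oF n : eigen_orth (F n) by have [] := hF n.
have cF n : continuous (F n) by have [] := oF n.
have cTF n : continuous (T (F n)) by exact: convol_cont.
have nF n : nsq (F n) <= 1 by have [] := hF n.
(* An ultrafilter gives limits at all points of the group at once, without extracting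
   subsequences. *)
have [U [UU ooU]] := @ultraFilterLemma nat \oo _.
have kap0 : 0 <= kap by exact: nsq_ge0.
(* The bound [kap + 1] stands for the square root of [kap], which it dominates. *)
have bF n y : `|T (F n) y| <= kap + 1.
  apply: normr_le_sq; first by rewrite addr_ge0.
  apply: le_trans (convol_bound _ (cF n)) _.
  have : kap * nsq (F n) <= kap by rewrite ler_piMr.
  by have := kap0; nra.
have gex y : exists p : R, (fun n => T (F n) y) @ U --> p.
  have := @segment_compact R (- (kap + 1)) (kap + 1).
  rewrite compact_ultra => /(_ ((fun n => T (F n) y) @ U)) [||p [_ hp]].
    exact: fmap_ultra.
    by apply: (@filterE _ U) => n /=; rewrite in_itv/= -ler_norml.
  by exists p.
(* The candidate is the limit of the images [T (F n)], which are equicontinuous, and not of the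
   [F n]. *)
pose g y := projT1 (cid (gex y)).
have hg y : (fun n => T (F n) y) @ U --> g y by exact: projT2 (cid (gex y)).
have gequi y0 (e : R) : 0 < e -> \forall y \near y0,
    `|g y - g y0| <= e /\ forall n, `|T (F n) y - T (F n) y0| <= e.
  move=> e0; apply: filterS (convol_equicont y0 e0) => y hy; split; last first.
    by move=> n; exact: hy.
  have hcv : (fun n => `|T (F n) y - T (F n) y0|) @ U --> `|g y - g y0|.
    by apply: cvg_norm; exact: cvgB.
  apply: (closed_cvg (fun z => z <= e) _ _ _ hcv); first exact: closed_le.
  by apply: filterE => n; exact: hy.
have cg : continuous g.
  move=> y0; apply/cvgrPdist_le => e /(gequi y0); apply: filterS => y [+ _].
  by rewrite distrC.
have unif (e : R) : 0 < e -> \forall n \near U, forall y, `|g y - T (F n) y| <= e.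
  move=> e0; have e30 : 0 < e / 3 by rewrite divr_gt0.
  have := cgroup_compact hG; rewrite compact_near_coveringP.
  move=> /(_ _ U (fun n y => `|g y - T (F n) y| <= e) _) H.
  have : \forall n \near U, [set: L] `<=` (fun y => `|g y - T (F n) y| <= e).
    apply: H => y0 _; have /cvgrPdist_le /(_ _ e30) hn := hg y0.
    exists ([set y | `|g y - g y0| <= e / 3 /\ forall n, `|T (F n) y - T (F n) y0| <= e / 3],
            [set n | `|g y0 - T (F n) y0| <= e / 3]).
      by split => //=; exact: gequi.
    move=> [y n] /= [[h1 h2] h3]; have := h2 n; move: h1 h3.
    rewrite !ler_norml => /andP[? ?] /andP[? ?] /andP[? ?].
    by apply/andP; split; lra.
  by apply: filterS => n hn y; exact: hn.
have nunif (e : R) : 0 < e ->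
    \forall n \near U, nsq (fun y => g y - T (F n) y) <= e * e.
  move=> e0; apply: filterS (unif e e0) => n hn; apply: nsq_le; first exact: sub_cont.
  by move=> y; rewrite -!expr2 -(real_normK (num_real (_ - _))) lerXn2r ?nnegrE// ltW.
have near_e (e : R) : 0 < e -> \forall n \near U, n.+1%:R^-1 <= e.
  by move=> e0; apply: ooU; apply: filterS (near_infty_natSinv_lt (PosNum e0)) => n /ltW.
have og : eigen_orth g.
  split=> // nu u nu0 Eu; have cu : continuous u by case: Eu.
  apply: (@eq0_le_eps _ (nsq u + 1)) => e e0.
  have [n hn] : exists n, nsq (fun y => g y - T (F n) y) <= e * e.
    exact: filter_ex (nunif e e0).
  have -> : ip g u = ip (fun y => g y - T (F n) y) u.
    rewrite ipBl// ((eigen_orth_convol (oF n)).2 _ _ nu0 Eu) subr0 //.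
  have u0 := nsq_ge0 cu.
  apply: normr_le_sq; first by rewrite mulr_ge0 ?ltW// ltr_wpDl.
  apply: le_trans (cauchy_schwarz _ cu) _; first exact: sub_cont.
  apply: le_trans (ler_wpM2r u0 hn) _.
  rewrite mulrACA [leRHS]mulrC ler_wpM2l ?mulr_ge0 ?ltW//; nra.
(* If [g] vanished, [nsq (T (F n))] would become arbitrarily small along [U], while it approaches
   [mu > 0]. *)
have ng : nsq g != 0.
  apply/eqP => n0.
  have [e [e0 e_1 e3]] : exists e, [/\ 0 < e, e <= 1 & e <= mu / 3].
    exists (Num.min 1 (mu / 3)); rewrite lt_min ltr01 divr_gt0//.
    by rewrite !ge_min !lexx orbT.
  have [n [hn hn']] : exists n, nsq (fun y => g y - T (F n) y) <= e * e /\ n.+1%:R^-1 <= e.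
    exact: filter_ex (filterI (nunif e e0) (near_e e e0)).
  have /(nsq_eq0 cg) g0 := n0.
  have : nsq (fun y => g y - T (F n) y) = nsq (T (F n)).
    by rewrite /ip; congr haar; apply/funext => y; rewrite g0 sub0r mulrNN.
  have [_ _] := hF n.
  move=> hlt heq; have : e * e <= e by rewrite ler_piMr// ltW.
  rewrite heq in hn; move: hlt hn'; move: (n.+1%:R^-1) => z hlt hn'; lra.
(* For [h = F n], expanding the square and bounding [nsq (T (T h))] by [mu * nsq (T h)] shows that
   the squared norm of [T (T h) - mu h] is at most [mu * (mu - nsq (T h))]. This tends to 0 because
   [h] nearly attains the supremum. *)
have Eg : eigen mu g.
  split => // y; apply/eqP; rewrite -subr_eq0; apply/eqP.
  apply: (@eq0_le_eps _ (kap + (kap + mu) + mu)) => e e0.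
  have [n [[hn1 hn2] hn3]] : exists n, (nsq (fun y => g y - T (F n) y) <= e * e /\
      n.+1%:R^-1 <= e * e) /\ forall y, `|g y - T (F n) y| <= e.
    apply: filter_ex (filterI (filterI (nunif e e0) (near_e _ (mulr_gt0 e0 e0))) (unif e e0)).
  have cTTF : continuous (T (T (F n))) by exact: convol_cont.
  have cd : continuous (fun y => g y - T (F n) y) by exact: sub_cont.
  have cmF : continuous (fun y => mu * F n y) by exact: scale_cont.
  have h1 : `|T (T (fun y => g y - T (F n) y)) y| <= kap * e.
    apply: normr_le_sq; first by rewrite mulr_ge0// ltW.
    apply: le_trans (convol_bound _ (convol_cont cd)) _.
    have := nsq_convol cd; have := ler_wpM2l kap0 hn1; have := kap0; nra.
  have h2 : `|T (fun y => T (T (F n)) y - mu * F n y) y| <= (kap + mu) * e.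
    apply: normr_le_sq; first by rewrite mulr_ge0 ?ltW// ltr_wpDl.
    apply: le_trans (convol_bound _ (sub_cont cTTF cmF)) _.
    rewrite nsqB// nsqZ// ipZr// (_ : ip (T (T (F n))) (F n) = nsq (T (F n))); last first.
      by rewrite convol_sym.
    have [_ _ h] := hF n; have := Smu _ (eigen_orth_convol (oF n)).
    have nFn := nF n; rewrite mulr2n.
    set a := nsq (T (T (F n))); set b := nsq (T (F n)) in h *; move=> ab.
    have : a - (mu * b + mu * b) + mu * mu * nsq (F n) <= mu * (e * e).
      have : mu * mu * nsq (F n) <= mu * mu by rewrite ler_piMr// ltW// mulr_gt0.
      have : mu * (mu - b) <= mu * (e * e) by move: hn2 h; move: (n.+1%:R^-1) => z hn2 h; apply: ler_wpM2l; [exact: ltW|lra].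
      by nra.
    move=> /(ler_wpM2l kap0) /le_trans; apply.
    rewrite [leRHS]mulrACA [leLHS]mulrA; apply: ler_wpM2r; first by rewrite mulr_ge0// ltW.
    by nra.
  have h3 := hn3 y.
  have -> : T (T g) y - mu * g y = T (T (fun y => g y - T (F n) y)) y +
      T (fun y => T (T (F n)) y - mu * F n y) y - mu * (g y - T (F n) y).
    by rewrite !convolB ?convolZ//; [ring|exact: convol_cont..].
  have h4 : `|mu * (g y - T (F n) y)| <= mu * e.
    by rewrite normrM gtr0_norm// ler_wpM2l// ltW.
  apply: le_trans (ler_normB _ _) _; rewrite [leRHS]mulrDl lerD//.
  by apply: le_trans (ler_normD _ _) _; rewrite [leRHS]mulrDl lerD.
(* Here [g] is an eigenfunction that is orthogonal to all eigenfunctions, itself included. *)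
by move/eqP: ng; apply; case: og => _ h; apply: (h mu).
Qed.

Lemma eigenB nu u v : eigen nu u -> eigen nu v -> eigen nu (fun x => u x - v x).
Proof.
move=> [cu Eu] [cv Ev]; split; first exact: sub_cont.
by move=> x; rewrite !convolB ?mulrBr ?Eu ?Ev//; exact: convol_cont.
Qed.

Lemma eigenZ nu c u : eigen nu u -> eigen nu (fun x => c * u x).
Proof.
move=> [cu Eu]; split; first exact: scale_cont.
by move=> x; rewrite !convolZ ?Eu 1?mulrCA//; exact: convol_cont.
Qed.

Lemma eigen0 nu : eigen nu (fun=> 0).
Proof.
have T0 : T (fun=> 0) = fun=> 0.
  apply/funext => x; rewrite -[RHS](haar_cst hG 0); congr haar.
  by apply/funext => y; rewrite mulr0.
by split; [exact: cst_continuous|move=> x; rewrite !T0 mulr0].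
Qed.

Lemma eigen_sum nu (n : nat) (c : nat -> R) (u : nat -> L -> R) :
  (forall i, (i < n)%N -> eigen nu (u i)) ->
  eigen nu (fun x => \sum_(i < n) c i * u i x).
Proof.
elim: n => [|n ih] Eu.
  rewrite (_ : (fun _ => _) = fun=> 0); first exact: eigen0.
  by apply/funext => x; rewrite big_ord0.
rewrite (_ : (fun _ => _) = fun x => \sum_(i < n) c i * u i x - (- c n) * u n x).
  apply: eigenB; last by apply: eigenZ; exact: Eu.
  by apply: ih => i ilt; apply: Eu; rewrite ltnS ltnW.
by apply/funext => x; rewrite big_ord_recr/= mulNr opprK.
Qed.

Lemma eigen_shift nu g u : eigen nu u -> eigen nu (fun x => u (g ** x)).
Proof.
move=> [cu Eu]; split; first exact: lshift_cont.
move=> x; rewrite (_ : T (fun x => u (g ** x)) = fun x => T u (g ** x)).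
  by rewrite convol_shift ?Eu//; exact: convol_cont.
by apply/funext => y; rewrite convol_shift.
Qed.

Definition orthonormal nu n (u : nat -> L -> R) :=
  (forall i, eigen nu (u i)) /\
  forall i j, (i < n)%N -> (j < n)%N -> ip (u i) (u j) = (i == j)%:R.

Lemma lin_comb_cont n (c : 'I_n -> R) (u : nat -> L -> R) :
  (forall i, continuous (u i)) -> continuous (fun x => \sum_(i < n) c i * u i x).
Proof.
by move=> cu; apply: (sum_cont (F := fun (i : 'I_n) x => c i * u i x)) => i; exact: scale_cont.
Qed.

Lemma ip_lin_comb n (c : 'I_n -> R) (u : nat -> L -> R) h :
  (forall i, continuous (u i)) -> continuous h ->
  ip (fun x => \sum_(i < n) c i * u i x) h = \sum_(i < n) c i * ip (u i) h.
Proof.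
move=> cu ch; rewrite (@ip_suml _ _ (fun (i : 'I_n) x => c i * u i x))//.
  by apply: eq_bigr => i _; rewrite ipZl.
by move=> i; exact: scale_cont.
Qed.

Lemma orthonormal_coef nu n (u : nat -> L -> R) (c : 'I_n -> R) (j : 'I_n) :
  orthonormal nu n u -> ip (fun x => \sum_(i < n) c i * u i x) (u j) = c j.
Proof.
move=> [Eu ou]; have cu i : continuous (u i) by case: (Eu i).
rewrite ip_lin_comb// (bigD1 j)//= ou// eqxx mulr1 big1 ?addr0// => i ij.
by rewrite ou// (_ : (_ == _) = false) ?mulr0//; apply/negbTE.
Qed.

Lemma bessel nu n (u : nat -> L -> R) f : orthonormal nu n u -> continuous f ->
  \sum_(i < n) ip f (u i) * ip f (u i) <= nsq f.
Proof.
move=> ou cf; have [Eu ou'] := ou; have cu i : continuous (u i) by case: (Eu i).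
pose c (i : 'I_n) := ip f (u i).
pose p x := \sum_(i < n) c i * u i x.
have cp : continuous p by exact: lin_comb_cont.
have := nsq_ge0 (sub_cont cf cp); rewrite nsqB//.
have -> : ip f p = \sum_(i < n) c i * c i.
  by rewrite ipC ip_lin_comb//; apply: eq_bigr => i _; rewrite (ipC (u i)).
have -> : nsq p = \sum_(i < n) c i * c i.
  rewrite ip_lin_comb//; apply: eq_bigr => i _; congr (_ * _).
  by rewrite ipC (orthonormal_coef c i ou).
by rewrite mulr2n; lra.
Qed.

(** The Hilbert-Schmidt bound: for the kernel translated to [x], Bessel's inequality bounds the sum
    of the squares of [nu * u i x] by [kap * kap], and the mean over [x] turns this into a bound on
    [n]. *)
Lemma eigen_dim nu n (u : nat -> L -> R) : orthonormal nu n u -> n%:R * (nu * nu) <= kap * kap.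
Proof.
move=> ou; have [Eu ou'] := ou; have cu i : continuous (u i) by case: (Eu i).
have kap0 : 0 <= kap by exact: nsq_ge0.
have cm i : continuous (fun x => nu * nu * (u i x * u i x)).
  by apply: scale_cont; exact: mul_cont.
have csum m : continuous (fun x => \sum_(i < m) nu * nu * (u i x * u i x)).
  by apply: (sum_cont (F := fun (i : 'I_m) x => nu * nu * (u i x * u i x))) => i.
have -> : n%:R * (nu * nu) = haar (fun x => \sum_(i < n) nu * nu * (u i x * u i x)).
  have -> : haar (fun x => \sum_(i < n) nu * nu * (u i x * u i x)) =
      \sum_(i < n) haar (fun x => nu * nu * (u i x * u i x)).
    elim: (n) => [|m ih].
      rewrite big_ord0 -[RHS](haar_cst hG 0); congr haar; apply/funext => x.
      by rewrite big_ord0.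
    rewrite big_ord_recr/= -ih -(haarD hG)//.
    by congr haar; apply/funext => x; rewrite big_ord_recr.
  rewrite (eq_bigr (fun=> nu * nu)); first by rewrite sumr_const card_ord mulr_natl.
  move=> i _; rewrite (haarZ hG); last by exact: mul_cont.
  by rewrite -[haar _]/(nsq (u i)) ou'// eqxx mulr1.
rewrite -[leRHS](haar_cst hG); apply: (haar_le hG).
- exact: csum.
- exact: cst_continuous.
move=> x; pose kx y := k (x ^~1 ** y); have ckx : continuous kx by exact: lshift_cont.
apply: le_trans (_ : nsq (T kx) <= _); last first.
  apply: le_trans (nsq_convol ckx) _.
  by rewrite (ip_shift (x ^~1) ck ck).
apply: le_trans (bessel ou (convol_cont ckx)).
apply: ler_sum => i _; rewrite (convol_sym ckx (cu i)).
have [_ Eui] := Eu i; rewrite -[ip kx _]/(T (T (u i)) x) Eui.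
by rewrite mulrACA.
Qed.

(** By Gram-Schmidt an orthonormal family that does not span can be lengthened, and [eigen_dim]
    bounds its length. *)
Lemma eigen_basis nu : 0 < nu -> exists n (u : nat -> L -> R), orthonormal nu n u /\
  forall v, eigen nu v -> forall x, v x = \sum_(i < n) ip v (u i) * u i x.
Proof.
move=> nu0; apply: contrapT => nob.
have H n : exists u : nat -> L -> R, orthonormal nu n u.
  elim: n => [|n [u ou]].
    by exists (fun _ _ => 0); split => // i; exact: eigen0.
  have [Eu ou'] := ou; have cu i : continuous (u i) by case: (Eu i).
  have [v [Ev nv]] : exists v, eigen nu v /\
      ~ forall x, v x = \sum_(i < n) ip v (u i) * u i x.
    apply: contrapT => nv; apply: nob; exists n, u; split => // v Ev.
    by apply: contrapT => nvx; apply: nv; exists v.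
  have [cv _] := Ev.
  pose w x := v x - \sum_(i < n) ip v (u i) * u i x.
  have Ew : eigen nu w.
    by apply: eigenB => //; apply: (eigen_sum (fun i => ip v (u i))).
  have [cw _] := Ew.
  have wu i : (i < n)%N -> ip w (u i) = 0.
    move=> ilt; rewrite ipBl//; last exact: lin_comb_cont.
    by rewrite (orthonormal_coef (fun i => ip v (u i)) (Ordinal ilt) ou) subrr.
  have nw : nsq w != 0.
    apply/eqP => /(nsq_eq0 cw) w0; apply: nv => x.
    by apply/eqP; rewrite -subr_eq0; apply/eqP; exact: w0.
  have nwp : 0 < nsq w by rewrite lt_neqAle eq_sym nw nsq_ge0.
  pose c := (Num.sqrt (nsq w))^-1.
  have cc : c * c * nsq w = 1.
    by rewrite -invfM -expr2 sqr_sqrtr ?mulVf// ltW.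
  exists (fun i => if i == n then fun x => c * w x else u i); split.
    by move=> i; case: ifP => // _; exact: eigenZ.
  move=> i j hi hj.
  have lt_n l : (l < n.+1)%N -> l != n -> (l < n)%N.
    by move=> hl nl; rewrite ltn_neqAle nl -ltnS.
  have {}hi := lt_n i hi; have {}hj := lt_n j hj.
  have [->|ni] := eqVneq i n; have [jn|nj] := eqVneq j n.
  - by rewrite nsqZ// cc.
  - by rewrite ipZl// wu ?hj// mulr0.
  - by rewrite jn ipZr// ipC wu ?hi// mulr0 (negbTE ni).
  - by rewrite ou' ?hi ?hj.
have [u /eigen_dim] := H (Num.truncn (kap * kap / (nu * nu))).+1.
rewrite -ler_pdivlMr ?mulr_gt0// leNgt => /negP; apply; exact: truncnS_gt.
Qed.

End Kernel.

(** * Orthogonal representations on eigenspaces *)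

Definition orth_rep n (r : L -> 'M[R]_n) :=
  [/\ forall g g', r (g ** g') = r g *m r g', forall g, (r g)^T *m r g = 1%:M &
      forall i j, continuous (fun g => r g i j)].

(** The convolution commutes with left translations, so these act on the eigenspace; as they
    preserve the inner product, their matrices in an orthonormal basis are orthogonal. *)
Lemma eigen_rep k nu : continuous k -> (forall x, k (x ^~1) = k x) -> 0 < nu ->
  exists n (r : L -> 'M[R]_n), orth_rep r /\
  forall g, r g = 1%:M -> forall u, eigen k nu u -> forall x, u (g ^~1 ** x) = u x.
Proof.
move=> ck sk nu0; have [n [u [ou full]]] := eigen_basis ck sk nu0.
have [Eu ou'] := ou; have cu i : continuous (u i) by case: (Eu i).
pose sh g f x : R := f (g ^~1 ** x).
have csh g i : continuous (sh g (u i)) by exact: lshift_cont.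
have Esh g i : eigen k nu (sh g (u i)) by exact: eigen_shift.
pose r g : 'M[R]_n := \matrix_(i < n, j < n) ip (sh g (u j)) (u i).
have shE g (j : 'I_n) x : sh g (u j) x = \sum_(i < n) r g i j * u i x.
  by rewrite (full _ (Esh g j)); apply: eq_bigr => i _; rewrite mxE.
have coef (c : 'I_n -> R) (i : 'I_n) : ip (fun x => \sum_(j < n) c j * u j x) (u i) = c i.
  exact: orthonormal_coef ou.
exists n, r; split; [split|].
- move=> g h; apply/matrixP => i j; rewrite !mxE.
  rewrite -[RHS](coef (fun i => \sum_(l < n) r g i l * r h l j)).
  congr ip; apply/funext => x.
  rewrite /sh (cgroupVM hG) -(cgroupA hG) -[LHS]/(sh h (u j) (g ^~1 ** x)) shE.
  under eq_bigr => l _ do rewrite -[u l _]/(sh g (u l) x) shE mulr_sumr.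
  rewrite exchange_big; apply: eq_bigr => i' _; rewrite mulr_suml.
  by apply: eq_bigr => l _; ring.
- move=> g; apply/matrixP => i j; rewrite !mxE.
  transitivity (ip (sh g (u i)) (sh g (u j))); last first.
    by rewrite (ip_shift (g ^~1) (cu i) (cu j)) ou'.
  rewrite [in RHS](_ : sh g (u j) = fun x => \sum_(l < n) r g l j * u l x); last first.
    by apply/funext => x; exact: shE.
  rewrite ipC ip_lin_comb//; apply: eq_bigr => l _.
  by rewrite (ipC (u l)) !mxE mulrC.
- move=> i j; rewrite (_ : (fun g => _) = fun g => haar (fun y => u j (g ^~1 ** y) * u i y)).
    apply: (haar_param hG (F := fun g y => u j (g ^~1 ** y) * u i y)).
    exact: (kernel_mul_cont (cu j) (cu i)).
  by apply/funext => g; rewrite mxE.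
- move=> g rg v Ev x.
  have shu (i : 'I_n) : u i (g ^~1 ** x) = u i x.
    rewrite -[LHS]/(sh g (u i) x) shE rg (bigD1 i)//= !mxE eqxx mul1r big1 ?addr0//.
    by move=> j ji; rewrite !mxE (negbTE ji) mul0r.
  by rewrite !(full _ Ev); apply: eq_bigr => i _; rewrite shu.
Qed.

(** The kernel is adapted to [w] and to the point [x]: it symmetrizes [y |-> w (x ** y)]. The
    convolution at [x] is then the inner product of [k] with one summand of [k], and inversion
    exchanges the two summands; so [k] has norm 0, whereas its value at the unit is twice [w x]. *)
Lemma convol_symm_eq0 (w : L -> R) : continuous w ->
  (forall k : L -> R, continuous k -> (forall x, k (x ^~1) = k x) -> forall x, convol k w x = 0) ->
  forall x, w x = 0.
Proof.
move=> cw hw x; pose k y := w (x ** y) + w (x ** y ^~1).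
have c1 : continuous (fun y => w (x ** y)) by exact: lshift_cont.
have c2 : continuous (fun y => w (x ** y ^~1)) by exact: (inv_cont c1).
have ck : continuous k by exact: add_cont.
have sk y : k (y ^~1) = k y by rewrite /k (cgroupVV hG) addrC.
have e : haar (fun y => k y * w (x ** y)) = 0.
  rewrite -[RHS](hw k ck sk x) /convol.
  rewrite -[RHS](haar_lshift hG x); first by congr haar; apply/funext => y; rewrite (cgroupKl hG).
  by apply: mul_cont => //; exact: lshift_cont.
have : nsq k = 0.
  rewrite /ip (_ : (fun y => _) = fun y => k y * w (x ** y) + k y * w (x ** y ^~1)).
    rewrite (haarD hG); [|exact: mul_cont|exact: mul_cont].
    rewrite e add0r -(haar_inv hG); last exact: mul_cont.
    by rewrite -[RHS]e; congr haar; apply/funext => y; rewrite sk (cgroupVV hG).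
  by apply/funext => y; rewrite -mulrDr.
move=> /(nsq_eq0 ck) /(_ e1); rewrite /k (cgroupV1 hG) (cgroup1r hG).
by move=> /eqP; rewrite -mulr2n mulrn_eq0 => /eqP.
Qed.

(** If [g] were trivial in every representation, it would fix all eigenfunctions. Then
    [f x - f (g ** x)] is orthogonal to them, is killed by every symmetric convolution, and
    vanishes; a Urysohn function for the unit and [g] contradicts this. *)
Lemma peter_weyl_separates g : hausdorff_space L -> g <> e1 ->
  exists n (r : L -> 'M[R]_n), orth_rep r /\ r g <> 1%:M.
Proof.
move=> hL ge; apply: contrapT => nor.
have fixg k nu u : continuous k -> (forall x, k (x ^~1) = k x) -> 0 < nu ->
    eigen k nu u -> forall x, u (g ^~1 ** x) = u x.
  move=> ck sk nu0; have [n [r [rr H]]] := eigen_rep ck sk nu0.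
  move: u; apply: H; apply: contrapT => rg; apply: nor; exists n, r; split => //.
have inv f x : continuous f -> f x = f (g ** x).
  move=> cf; apply/eqP; rewrite -subr_eq0; apply/eqP.
  have cfg : continuous (fun x => f (g ** x)) by exact: lshift_cont.
  apply: (convol_symm_eq0 (w := fun x => f x - f (g ** x))); first exact: sub_cont.
  move=> k ck sk y; apply: (convol_eigen_orth ck sk).
  split=> [|nu u nu0 Eu]; first exact: sub_cont.
  have [cu _] := Eu; rewrite ipBl//.
  rewrite -(ip_shift (g ^~1) cfg cu).
  suff -> : ip (fun x => f (g ** (g ^~1 ** x))) (fun x => u (g ^~1 ** x)) = ip f u.
    by rewrite subrr.
  by congr ip; apply/funext => z; rewrite ?(cgroupVKl hG)// (fixg _ _ _ ck sk nu0 Eu).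
have cl x : closed [set x : L] by apply: accessible_closed_set1; exact: hausdorff_accessible.
have := compact_normal hL (cgroup_compact hG) => /(@normal_separatorP R).
move=> /(_ [set e1] [set g] (cl _) (cl _)) H.
have /H : [set e1] `&` [set g] = set0 by rewrite -subset0 => x [/= -> /esym].
move=> /(@uniform_separatorP _ R) [f [cf _ f0 f1]].
have fe : f e1 = 0 by apply: f0; exists e1.
have fg : f g = 1 by apply: f1; exists g.
by have := inv f e1 cf; rewrite (cgroup1r hG) fe fg => /eqP; rewrite eq_sym oner_eq0.
Qed.

End PeterWeyl.

(** * Velocities of curves *)

Section Velocity.
Variable R : realType.
Implicit Types V W : normedModType R.

Lemma diff_eps V W (f : V -> W) p : differentiable f p ->
  forall e : R, 0 < e -> \forall x \near p, `|f x - f p - 'd f p (x - p)| <= e * `|x - p|.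
Proof.
move=> /diff_locally df e e0.
have : \forall h \near (0 : V), `|f (h + p) - f p - 'd f p h| <= e * `|h|.
  have /eqaddoP /(_ e e0) := df.
  by apply: filterS => h /=; rewrite /= opprD addrA.
rewrite [X in _ -> X](near_shift 0) subr0; apply: filterS => h /=.
by rewrite addrK.
Qed.

(** A derivative at 0 alone, with no regularity elsewhere: curves may therefore be chosen pointwise,
    by solving an equation for each [h] separately. *)
Definition vel V (b : R -> V) (v : V) :=
  forall e : R, 0 < e -> \forall h \near (0 : R), `|b h - b 0 - h *: v| <= e * `|h|.

Lemma vel_near V (b b' : R -> V) v : (\forall h \near (0 : R), b h = b' h) ->
  vel b v -> vel b' v.
Proof.
move=> bb' vb e /vb; have b0 := nbhs_singleton bb'.
by apply: filterS2 bb' => h <-; rewrite -b0.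
Qed.

Lemma vel_lipschitz V (b : R -> V) v : vel b v ->
  \forall h \near (0 : R), `|b h - b 0| <= (`|v| + 1) * `|h|.
Proof.
move=> /(_ _ ltr01); apply: filterS => h hb.
rewrite -[b h - b 0](subrK (h *: v)) (le_trans (ler_normD _ _))//.
by rewrite normrZ addrC mulrDl lerD// mulrC.
Qed.

Lemma vel_cvg V (b : R -> V) v : vel b v -> b @ (0 : R) --> b 0.
Proof.
move=> /vel_lipschitz vb; apply/cvgrPdist_le => e e0.
have v1 : 0 < `|v| + 1 by rewrite ltr_wpDl.
near=> h; rewrite distrC.
have /le_trans : `|b h - b 0| <= (`|v| + 1) * `|h| by near: h.
apply; rewrite -ler_pdivlMl//.
near: h; apply/nbhs_ballP; exists ((`|v| + 1)^-1 * e); first by rewrite /= mulr_gt0 ?invr_gt0.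
by move=> z /=; rewrite /ball_ /= sub0r normrN => /ltW.
Unshelve. all: by end_near. Qed.

Lemma near0_pos (P : R -> Prop) : (\forall h \near (0 : R), P h) ->
  exists2 h, 0 < h & P h.
Proof.
move=> P0; have [d /= d0 H] := (nbhs_ballP _ _).1 P0.
have d2 : 0 < d / 2 by rewrite divr_gt0.
exists (d / 2) => //; apply: H.
by rewrite -ball_normE /= sub0r normrN gtr0_norm// ltr_pdivrMr// ltr_pMr// ltr1n.
Qed.

Lemma vel_uniq V (b : R -> V) v w : vel b v -> vel b w -> v = w.
Proof.
move=> vb wb; apply/eqP; rewrite -subr_eq0 -normr_le0; apply/ler_addgt0Pl => e e0.
rewrite addr0; have e2 : 0 < e / 2 by rewrite divr_gt0.
have [h h0 [h1 h2]] := near0_pos (filterI (vb _ e2) (wb _ e2)).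
rewrite -(ler_pM2l h0) -{1}(gtr0_norm h0) -normrZ scalerBr.
rewrite -[h *: v - _](subrKA (b h - b 0)) (le_trans (ler_normD _ _))//.
move: h1 h2; rewrite (gtr0_norm h0) (distrC (h *: v)); lra.
Qed.

Lemma vel_line V (p v : V) : vel (fun h => p + h *: v) v.
Proof.
move=> e e0; apply: filterE => h.
by rewrite scale0r addr0 (addrC p) addrK subrr normr0 mulr_ge0// ltW.
Qed.

Lemma vel_cst V (p : V) : vel (fun=> p) 0.
Proof. by move=> e e0; apply: filterE => h; rewrite subrr scaler0 subrr normr0 mulr_ge0// ltW. Qed.

Lemma vel_diff V W (f : V -> W) (b : R -> V) v :
  differentiable f (b 0) -> vel b v -> vel (f \o b) ('d f (b 0) v).
Proof.
move=> df vb e e0.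
have [k k0 hk] := linear_lipschitz (diff_continuous df).
have v1 : 0 < `|v| + 1 by rewrite ltr_wpDl.
have e1 : 0 < e / 2 / (`|v| + 1) by rewrite !divr_gt0.
have e2 : 0 < e / 2 / k by rewrite !divr_gt0.
near=> h.
have h1 : `|f (b h) - f (b 0) - 'd f (b 0) (b h - b 0)| <= e / 2 / (`|v| + 1) * `|b h - b 0|.
  near: h; exact: (vel_cvg vb (diff_eps df e1)).
have h2 : `|b h - b 0| <= (`|v| + 1) * `|h|.
  by near: h; exact: vel_lipschitz.
have h3 : `|b h - b 0 - h *: v| <= e / 2 / k * `|h| by near: h; exact: vb.
have -> : (f \o b) h - (f \o b) 0 - h *: 'd f (b 0) v =
    (f (b h) - f (b 0) - 'd f (b 0) (b h - b 0)) + 'd f (b 0) (b h - b 0 - h *: v).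
  have -> : 'd f (b 0) (b h - b 0 - h *: v) = 'd f (b 0) (b h - b 0) - h *: 'd f (b 0) v.
    by rewrite linearB linearZ.
  by rewrite addrA subrK.
rewrite (le_trans (ler_normD _ _))// (splitr e) mulrDl lerD//.
  apply: le_trans h1 _; apply: le_trans (ler_wpM2l (ltW e1) h2) _.
  by rewrite mulrA divfK// gt_eqF.
apply: le_trans (hk _) _; apply: le_trans (ler_wpM2l (ltW k0) h3) _.
by rewrite mulrA (mulrC k) divfK// gt_eqF.
Unshelve. all: by end_near. Qed.

Lemma mx_norm_le m n (A : 'M[R]_(m, n)) (e : R) : 0 <= e ->
  (forall i j, `|A i j| <= e) -> `|A| <= e.
Proof.
move=> e0 h; rewrite [leLHS]/Num.norm /= mx_normrE; apply/bigmax_leP; split => // i _.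
Qed.

Lemma mx_entry_le m n (A : 'M[R]_(m, n)) i j : `|A i j| <= `|A|.
Proof.
rewrite [leRHS]/Num.norm /= mx_normrE.
by apply: (le_bigmax _ (fun ij : 'I_m * 'I_n => `|A ij.1 ij.2|) (i, j)).
Qed.

Lemma row_mx_norm_le m n (u : 'rV[R]_m) (v : 'rV[R]_n) (e : R) :
  `|u| <= e -> `|v| <= e -> `|row_mx u v| <= e.
Proof.
move=> ue ve; apply: mx_norm_le; first by rewrite (le_trans _ ue).
move=> i j; case: (split_ordP j) => k ->; rewrite ?row_mxEl ?row_mxEr.
  exact: le_trans (mx_entry_le _ _ _) ue.
exact: le_trans (mx_entry_le _ _ _) ve.
Qed.

Lemma vel_row m n (b : R -> 'rV[R]_m) (c : R -> 'rV[R]_n) v w :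
  vel b v -> vel c w -> vel (fun h => row_mx (b h) (c h)) (row_mx v w).
Proof.
move=> vb vc e e0; apply: filterS2 (vb _ e0) (vc _ e0) => h hb hc.
by rewrite opp_row_mx add_row_mx scale_row_mx opp_row_mx add_row_mx row_mx_norm_le.
Qed.

Lemma cvg_row_mx (T : Type) (F : set_system T) m n (b : T -> 'rV[R]_m) (c : T -> 'rV[R]_n)
    (x : 'rV[R]_m) (y : 'rV[R]_n) :
  Filter F -> b @ F --> x -> c @ F --> y -> (fun t => row_mx (b t) (c t)) @ F --> row_mx x y.
Proof.
move=> FF /cvgrPdist_le bx /cvgrPdist_le cy; apply/cvgrPdist_le => e e0.
apply: filterS2 (bx _ e0) (cy _ e0) => t hb hc.
by rewrite opp_row_mx add_row_mx row_mx_norm_le.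
Qed.

End Velocity.

(** * Compact Lie groups are linear *)

Section Charts.
Variables (R : realType) (M : topologicalType) (c : chart R M).
Hypothesis hc : is_chart c.

Lemma chart_nbhs x : dom c x -> nbhs x (dom c).
Proof. by case: hc => od _ _ _ _ dx; exact: open_nbhs_nbhs. Qed.

Lemma chart_image_nbhs x : dom c x -> nbhs (coord c x) (coord c @` dom c).
Proof.
by case: hc => _ od _ _ _ dx; apply: open_nbhs_nbhs; split => //; exists x.
Qed.

Lemma chartK x : dom c x -> param c (coord c x) = x.
Proof. by case: hc => _ _ _ _; apply. Qed.

Lemma chart_cvg x : dom c x -> coord c @ x --> coord c x.
Proof. by case: hc => _ _ h _ _; exact: h. Qed.

Lemma param_cvg x : dom c x -> param c @ (coord c x) --> x.
Proof.
by move=> dx; case: hc => _ _ _ h _; have := h x dx; rewrite /prop_for /continuous_at chartK.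
Qed.

Lemma chart_paramK x : dom c x ->
  \forall z \near coord c x, dom c (param c z) /\ coord c (param c z) = z.
Proof.
move=> dx; apply: filterS (chart_image_nbhs dx) => z [y dy <-].
by rewrite chartK.
Qed.

End Charts.

Lemma smooth_rV_diff (R : realType) n m (f : 'rV[R]_n -> 'rV[R]_m) x :
  smooth_rV f x -> differentiable f x.
Proof. by move=> /nbhs_singleton /(_ [::]). Qed.

Lemma lie_compact_group (R : realType) (L : charted R) (gL : group_data L) :
  lie_group gL -> compact [set: L] -> compact_group gL.
Proof.
move=> [[_ _ sm si] [ha h1 hV]] cL; split; split => //.
- by move=> p; have [] := sm p.
- by move=> x; have [] := si x.
Qed.

(* In a chart at the unit squaring has derivative [2 *: id], so it pushes points
   away from the unit. *)
Lemma no_small_subgroups (R : realType) (L : charted R) (gL : group_data L) :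
  lie_group gL -> exists V : set L, nbhs (gone gL) V /\
    forall g, (forall n, V (iter n (fun y => gmul gL y y) g)) -> g = gone gL.
Proof.
move=> [[[charts cover _] hL sm si] [ha h1l hVl]].
set e1 := gone gL.
have h1r x : gmul gL x e1 = x.
  have r1 : forall x, gmul gL x (ginv gL x) = e1.
    move=> y; rewrite -[LHS]h1l -{1}(hVl (ginv gL y)) -ha (ha _ y) hVl.
    by rewrite h1l hVl.
  by rewrite /e1 -(hVl x) ha r1 h1l.
have [c ac de] := cover e1; have ic := charts c ac.
set x0 := coord c e1.
pose m (z : 'rV[R]_(dim c + dim c)) : 'rV[R]_(dim c) :=
  coord c (gmul gL (param c (lsubmx z)) (param c (rsubmx z))).
have dm : differentiable m (row_mx x0 x0).
  have [_ /(_ (prod_chart c c) c)] := sm (e1, e1).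
  move=> H; apply: smooth_rV_diff; apply: H => //; first by exists c, c.
  by rewrite /= h1l.
have mE x y : m (row_mx x y) = coord c (gmul gL (param c x) (param c y)).
  by rewrite /m row_mxKl row_mxKr.
have pe : param c x0 = e1 by exact: chartK.
have nearx0 v : \forall h \near (0 : R), coord c (param c (x0 + h *: v)) = x0 + h *: v.
  have := vel_cvg (vel_line x0 v); rewrite scale0r addr0 => H.
  have H' : \forall h \near (0 : R), dom c (param c (x0 + h *: v)) /\
      coord c (param c (x0 + h *: v)) = x0 + h *: v := H _ (chart_paramK ic de).
  by apply: filterS H' => h [].
(* Multiplying a curve by the unit gives back the curve, and uniqueness of velocities identifies the
   partial derivative. *)
have Dl v : 'd m (row_mx x0 x0) (row_mx v 0) = v.
  have := vel_row (vel_line x0 v) (vel_cst x0); set b := (X in vel X _) => vb.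
  have b0 : b 0 = row_mx x0 x0 by rewrite /b scale0r addr0.
  have dm' : differentiable m (b 0) by rewrite b0.
  rewrite -b0; apply: vel_uniq (vel_diff dm' vb) _; apply: vel_near (vel_line x0 v).
  by apply: filterS (nearx0 v) => h hh; rewrite /= mE pe h1r.
have Dr v : 'd m (row_mx x0 x0) (row_mx 0 v) = v.
  have := vel_row (vel_cst x0) (vel_line x0 v); set b := (X in vel X _) => vb.
  have b0 : b 0 = row_mx x0 x0 by rewrite /b scale0r addr0.
  have dm' : differentiable m (b 0) by rewrite b0.
  rewrite -b0; apply: vel_uniq (vel_diff dm' vb) _; apply: vel_near (vel_line x0 v).
  by apply: filterS (nearx0 v) => h hh; rewrite /= mE pe h1l.
have D2 v : 'd m (row_mx x0 x0) (row_mx v v) = v + v.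
  have -> : row_mx v v = row_mx v 0 + row_mx 0 v by rewrite add_row_mx addr0 add0r.
  by rewrite linearD Dl Dr.
(* The derivative doubles vectors; allowing an error of 1/2 leaves the expansion factor 3/2. *)
have exp : \forall x \near x0, 3 / 2 * `|x - x0| <= `|m (row_mx x x) - x0|.
  have e0 : (0 : R) < 1 / 2 by rewrite divr_gt0.
  have cv : (fun x => row_mx x x) @ x0 --> row_mx x0 x0.
    by apply: (@cvg_row_mx R _ (nbhs x0) _ _ id id); exact: cvg_id.
  have H : \forall x \near x0, `|m (row_mx x x) - m (row_mx x0 x0) -
      'd m (row_mx x0 x0) (row_mx x x - row_mx x0 x0)| <=
      1 / 2 * `|row_mx x x - row_mx x0 x0| := cv _ (diff_eps dm e0).
  apply: filterS H => x.
  rewrite opp_row_mx add_row_mx D2 (mE x0 x0) pe h1l -/x0.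
  have : `|row_mx (x - x0) (x - x0)| <= `|x - x0| by exact: row_mx_norm_le.
  set z := m _ - x0; set w := x - x0 => hw hz.
  have : `|w + w| <= `|z| + `|z - (w + w)|.
    by rewrite -[X in `|X| <= _](subKr z) ler_normB.
  rewrite -mulr2n normrMn mulr2n; lra.
have [d /= d0 hd] := (nbhs_ballP _ _).1 (filterI exp (chart_paramK ic de)).
pose V := dom c `&` [set g | `|coord c g - x0| < d].
have sqV g : V g -> 3 / 2 * `|coord c g - x0| <= `|coord c (gmul gL g g) - x0|.
  move=> [dg gd]; have [|+ _] := hd (coord c g).
    by rewrite -ball_normE /= distrC.
  by rewrite mE (chartK ic dg).
exists V; split.
  apply: filterI; first exact: (chart_nbhs ic).
  have := chart_cvg ic de => /cvgrPdist_lt /(_ _ d0).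
  by apply: filterS => g; rewrite distrC.
move=> g hg; have dg : dom c g by have [] := hg 0.
have grow n : (3 / 2) ^+ n * `|coord c g - x0| <=
    `|coord c (iter n (fun y => gmul gL y y) g) - x0|.
  elim: n => [|n ih]; first by rewrite expr0 mul1r.
  apply: le_trans (sqV _ (hg n)); rewrite exprS -mulrA ler_wpM2l//.
suff c0 : coord c g = x0 by rewrite -(chartK ic dg) c0.
apply/eqP; rewrite -subr_eq0 -normr_eq0; apply/negPn/negP => n0.
have np : 0 < `|coord c g - x0| by rewrite lt_neqAle eq_sym n0 normr_ge0.
(* A linear lower bound for the powers is enough to leave the ball of radius [d]. *)
have lin n : n%:R / 2 <= (3 / 2 : R) ^+ n.
  elim: n => [|n ih]; first by rewrite mul0r expr0.
  have : 1 <= (3 / 2 : R) ^+ n by rewrite exprn_ege1//; lra.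
  rewrite exprS -[n.+1%:R]natr1; move: (_ ^+ n) (n%:R) ih => y z h; lra.
have [n hn] : exists n : nat, 2 * (d / `|coord c g - x0|) < n%:R.
  by eexists; exact: truncnS_gt.
have := lin n; have := grow n; have [_ /=] := hg n.
move=> h1 /le_lt_trans /(_ h1); rewrite -ltr_pdivlMr//.
move: (_ ^+ n) (d / _) (n%:R) hn => x y z; lra.
Qed.

(** * Assembling a faithful representation *)

Section FaithfulRep.
Variables (R : realType) (L : topologicalType) (gL : group_data L).
Hypothesis hG : compact_group gL.

Lemma orth_rep1 n (r : L -> 'M[R]_n) : orth_rep gL r -> r (gone gL) = 1%:M.
Proof.
move=> [rM rO _].
by rewrite -(rO (gone gL)) -{3}(cgroup1l hG (gone gL)) rM mulmxA rO mul1mx.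
Qed.

Lemma orth_rep_sum n n' (r : L -> 'M[R]_n) (r' : L -> 'M[R]_n') :
  orth_rep gL r -> orth_rep gL r' ->
  orth_rep gL (fun g => block_mx (r g) 0 0 (r' g)).
Proof.
move=> [rM rO rc] [rM' rO' rc']; split.
- by move=> g g'; rewrite mulmx_block !mul0mx !mulmx0 !addr0 !add0r rM rM'.
- move=> g; rewrite tr_block_mx mulmx_block !trmx0 !mul0mx !mulmx0 !addr0 !add0r rO rO'.
  by rewrite -scalar_mx_block.
- move=> i j; case: (split_ordP i) => i' ->; case: (split_ordP j) => j' ->.
  + by under eq_fun do rewrite block_mxEul; exact: rc.
  + by under eq_fun do rewrite block_mxEur mxE; exact: cst_continuous.
  + by under eq_fun do rewrite block_mxEdl mxE; exact: cst_continuous.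
  + by under eq_fun do rewrite block_mxEdr; exact: rc'.
Qed.

Lemma orth_rep_neq1 n (r : L -> 'M[R]_n) g : orth_rep gL r -> r g <> 1%:M ->
  \forall g' \near g, r g' <> 1%:M.
Proof.
move=> [_ _ rc] rg; have [i [j rij]] : exists i j, r g i j != (1%:M : 'M[R]_n) i j.
  apply: contrapT => h; apply: rg; apply/matrixP => i j; apply/eqP/negPn/negP => rij.
  by apply: h; exists i, j.
have : nbhs (r g i j) [set z | z != (1%:M : 'M[R]_n) i j].
  by apply: open_nbhs_nbhs; split => //; exact: open_neq.
move=> nb; have H : nbhs g [set g' | r g' i j != (1%:M : 'M[R]_n) i j] := rc i j g _ nb.
apply: (filterS _ H) => g' /= h rg'.
by rewrite rg' eqxx in h.
Qed.

(** By compactness finitely many representations exclude all elements outside [V], and their direct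
    sum does so alone. *)
Lemma small_kernel (V : set L) : hausdorff_space L -> nbhs (gone gL) V ->
  exists n (r : L -> 'M[R]_n), orth_rep gL r /\ forall g, r g = 1%:M -> V g.
Proof.
move=> hL nV.
have : forall x : L, exists U : set L, nbhs x U /\ exists n (r : L -> 'M[R]_n),
    orth_rep gL r /\ forall g, r g = 1%:M -> U g -> V g.
  move=> x; have [->|/(peter_weyl_separates R hG hL) [n [r [rr rx]]]] :=
      pselect (x = gone gL).
    (* Near the unit [V] itself is the neighbourhood, and the representation of dimension 0 does. *)
    exists V; split => //; exists 0%N, (fun=> 1%:M); split => //; split.
    - by move=> g g'; rewrite mulmx1.
    - by move=> g; rewrite trmx1 mulmx1.
    - by move=> [].
  exists [set g | r g <> 1%:M]; split; first exact: orth_rep_neq1 rr rx.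
  by exists n, r; split.
move=> /choice [U HU].
have [|s hs] := @finite_cover L U (cgroup_compact hG).
  by move=> x; case: (HU x).
have [n [r [rr hr]]] : exists n (r : L -> 'M[R]_n), orth_rep gL r /\
    forall g, r g = 1%:M -> forall x, x \in s -> U x g -> V g.
  elim: (s) => [|x s' [n [r [rr hr]]]].
    exists 0%N, (fun=> 1%:M); split => //; split.
    - by move=> g g'; rewrite mulmx1.
    - by move=> g; rewrite trmx1 mulmx1.
    - by move=> [].
  have [_ [n' [r' [rr' hr']]]] := HU x.
  exists (n + n')%N, (fun g => block_mx (r g) 0 0 (r' g)).
  split; first exact: orth_rep_sum.
  move=> g; rewrite (scalar_mx_block _ _ 1) => /eq_block_mx [rg _ _ rg'] y.
  by rewrite inE => /predU1P[->|ys]; [exact: hr'|exact: hr].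
by exists n, r; split => // g rg; have [x xs Ux] := hs g; exact: hr rg x xs Ux.
Qed.

End FaithfulRep.

(** A kernel is stable under squaring, so one contained in a neighbourhood without small subgroups
    is trivial. *)
Theorem faithful_orth_rep (R : realType) (L : charted R) (gL : group_data L) :
  lie_group gL -> compact [set: L] ->
  exists n (r : L -> 'M[R]_n), orth_rep gL r /\ forall g, r g = 1%:M -> g = gone gL.
Proof.
move=> lL cL; have hG := lie_compact_group lL cL.
have [V [nV hV]] := no_small_subgroups lL.
have [[_ hL _ _] _] := lL.
have [n [r [rr hr]]] := small_kernel R hG hL nV.
exists n, r; split => // g rg; apply: hV => k; apply: hr.
by elim: k => //= k ih; have [-> _ _] := rr; rewrite ih mulmx1.
Qed.

(** * Lifting curves through submersions *)

(** Banach's fixed point theorem is applied to row vectors, as a space both normed and complete. *)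
HB.instance Definition _ (R : realType) (m n : nat) := Complete.on 'M[R]_(m, n).

Section LocalSolve.
Variable R : realType.

Lemma vel_is_derive (f : R -> R) (t v : R) :
  vel (fun h => f (h + t)) v -> is_derive t 1 f v.
Proof.
move=> vf.
have cv : (fun h => h^-1 *: ((f \o shift t) (h *: 1) - f t)) @ (0 : R)^' --> v.
  apply/cvgrPdist_le => e e0; have H := vf e e0.
  have : \forall h \near (0 : R)^', `|f (h + t) - f (0 + t) - h *: v| <= e * `|h|.
    exact: nbhs_dnbhs.
  apply: filterS2 (nbhs_dnbhs_neq (0 : R)) => h h0.
  rewrite add0r /= [h *: 1]mulr1.
  have hp : 0 < `|h| by rewrite normr_gt0.
  have -> : f (h + t) - f t - h *: v = - (h * (v - h^-1 *: (f (h + t) - f t))).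
    by rewrite /GRing.scale /= mulrBr mulVKf// opprB.
  by rewrite normrN normrM mulrC ler_pM2r.
by apply: DeriveDef; [apply/cvg_ex; exists v|exact: cvg_lim].
Qed.

Lemma vel_entry m n (b : R -> 'M[R]_(m, n)) v i j : vel b v ->
  vel (fun h => b h i j) (v i j).
Proof.
move=> vb e /vb; apply: filterS => h; apply: le_trans.
by have := mx_entry_le (b h - b 0 - h *: v) i j; rewrite !mxE.
Qed.

Lemma subrACA (V : zmodType) (x y z t : V) : (x - y) - (z - t) = (x - z) - (y - t).
Proof. by rewrite opprD addrACA -opprD. Qed.

Lemma vel_sub (V : normedModType R) (b c : R -> V) v w : vel b v -> vel c w ->
  vel (fun h => b h - c h) (v - w).
Proof.
move=> vb vc e e0; have e2 : 0 < e / 2 by rewrite divr_gt0.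
apply: filterS2 (vb _ e2) (vc _ e2) => h h1 h2.
have -> : b h - c h - (b 0 - c 0) - h *: (v - w) =
    (b h - b 0 - h *: v) - (c h - c 0 - h *: w).
  by rewrite scalerBr (subrACA (b h) (c h)) (subrACA (b h - b 0)).
rewrite (splitr e) mulrDl (le_trans (ler_normB _ _))//; exact: lerD.
Qed.

Lemma half_contraction_fixpoint m (f : 'rV[R]_m -> 'rV[R]_m) (rho : R) : 0 <= rho ->
  `|f 0| <= rho / 2 ->
  (forall z z', `|z| <= rho -> `|z'| <= rho -> `|f z - f z'| <= 1 / 2 * `|z - z'|) ->
  exists2 z, `|z| <= rho & z = f z.
Proof.
move=> rho0 f0 hf; pose U := [set z : 'rV[R]_m | `|z| <= rho].
have fU : {homo f : x / U x >-> U x}.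
  move=> z Uz; rewrite /U /= -[f z](subrK (f 0)) (le_trans (ler_normD _ _))//.
  have := hf z 0 Uz; rewrite normr0 subr0 => /(_ rho0).
  by move: Uz; rewrite /U /=; lra.
have [|||z Uz fz] := @banach_fixed_point R 'rV[R]_m U (mkfun_fun fU).
- exists (1 / 2)%:nng; split => /=; first by rewrite ltr_pdivrMr// mul1r ltr1n.
  by move=> [z z'] /= [Uz Uz']; exact: hf.
- apply: (@closed_comp _ _ (fun z : 'rV[R]_m => `|z|) [set x | x <= rho]).
    by move=> z _; exact: norm_continuous.
  exact: closed_le.
- by exists 0; rewrite /U /= normr0.
by exists z.
Qed.

(* Newton iteration with a fixed right inverse of the differential *)
Lemma local_solve n m (f : 'rV[R]_n -> 'rV[R]_m) x0 :
  smooth_rV f x0 -> (forall w, exists v, 'd f x0 v = w) ->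
  exists k r : R, [/\ 0 <= k, 0 < r & forall p y, `|p - x0| <= r -> `|f p - y| <= r ->
    exists2 x, `|x - p| <= k * `|f p - y| & f x = y].
Proof.
move=> sf surj.
(* Preimages of the basis vectors define a linear right inverse [B] of the differential at [x0],
   bounded by [K]. *)
have /choice [b hb] : forall j : 'I_m, exists v, 'd f x0 v = delta_mx 0 j.
  by move=> j; exact: surj.
pose B (z : 'rV[R]_m) : 'rV[R]_n := \sum_(j < m) z 0 j *: b j.
have BA z z' : B (z + z') = B z + B z'.
  by rewrite /B -big_split; apply: eq_bigr => j _; rewrite !mxE scalerDl.
have BZ t z : B (t *: z) = t *: B z.
  by rewrite /B scaler_sumr; apply: eq_bigr => j _; rewrite mxE scalerA.
pose K := \sum_(j < m) `|b j|.
have K0 : 0 <= K by rewrite sumr_ge0.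
have Bn z : `|B z| <= K * `|z|.
  rewrite /B (le_trans (ler_norm_sum _ _ _))// mulr_suml; apply: ler_sum => j _.
  by rewrite normrZ mulrC ler_wpM2l// mx_entry_le.
have dB x z : differentiable f x -> 'd f x (B z) = \sum_(j < m) z 0 j *: 'D_(b j) f x.
  move=> df; rewrite /B linear_sum; apply: eq_bigr => j _.
  by rewrite linearZ deriveE.
have [r0 r00 hr0] : exists2 r0 : R, 0 < r0 & forall x, `|x - x0| <= r0 ->
    differentiable f x /\ forall z, `|'d f x (B z) - z| <= 1 / 2 * `|z|.
  have df0 := smooth_rV_diff sf.
  (* Each of the [m] basis directions contributes at most this error, in total at most 1/2; the
     successor covers [m = 0]. *)
  have e0 : (0 : R) < (m.+1%:R * 2)^-1 by rewrite invr_gt0 mulr_gt0.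
  have near_j (j : 'I_m) : \forall x \near x0,
      `|'D_(b j) f x - delta_mx 0 j| <= (m.+1%:R * 2)^-1.
    have /differentiable_continuous := nbhs_singleton sf [:: b j].
    move=> /cvgrPdist_le /(_ _ e0); apply: filterS => x /=.
    by rewrite (deriveE (b j) df0) hb distrC.
  have near_all : \forall x \near x0, forall j : 'I_m,
      `|'D_(b j) f x - delta_mx 0 j| <= (m.+1%:R * 2)^-1.
    exact: (@filter_forall _ _ (fun (j : 'I_m) x => `|'D_(b j) f x - delta_mx 0 j| <= (m.+1%:R * 2)^-1) (nbhs x0) _ near_j).
  have near_df : \forall x \near x0, differentiable f x.
    by apply: filterS sf => x /(_ [::]).
  have [r /= rp hr] := (nbhs_ballP _ _).1 (filterI near_all near_df).
  exists (r / 2); first by rewrite divr_gt0.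
  move=> x xr; have [|hj df] := hr x.
    by rewrite -ball_normE /= distrC (le_lt_trans xr)// ltr_pdivrMr// ltr_pMr// ltr1n.
  split => // z; rewrite dB//.
  have -> : \sum_(j < m) z 0 j *: 'D_(b j) f x - z =
      \sum_(j < m) z 0 j *: ('D_(b j) f x - delta_mx 0 j).
    rewrite [X in _ - X](row_sum_delta z) -sumrB.
    by apply: eq_bigr => j _; rewrite scalerBr.
  rewrite (le_trans (ler_norm_sum _ _ _))//.
  apply: le_trans (_ : \sum_(j < m) `|z| * (m.+1%:R * 2)^-1 <= _).
    apply: ler_sum => j _; rewrite normrZ ler_pM//; first exact: mx_entry_le.
  rewrite sumr_const card_ord -[leLHS]mulr_natl mulrCA [leRHS]mulrC ler_wpM2l//.
  rewrite invfM mulrA ler_wpM2r// ler_pdivrMr// mul1r ler_nat//.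
(* Half of [r0] is left for [p], the other half for the correction [B z], of norm at most
   [2 * K * r]. The summand 1 avoids a division by 0. *)
pose r := Num.min (r0 / 2) (r0 / 2 / (K * 2 + 1)).
have K1 : 0 < K * 2 + 1 by rewrite ltr_wpDl// mulr_ge0.
have rp : 0 < r by rewrite lt_min !divr_gt0.
exists (K * 2), r; split => //; first by rewrite mulr_ge0.
(* The iteration starts from [psi 0], of norm [|f p - y|], which is half the radius [rho]. *)
move=> p y px py; set rho := 2 * `|f p - y|.
have rho0 : 0 <= rho by rewrite mulr_ge0.
have inball z : `|z| <= rho -> `|p + B z - x0| <= r0.
  move=> zr; rewrite addrAC (le_trans (ler_normD _ _))// (splitr r0) lerD//.
    by rewrite (le_trans px)// ge_min lexx.
  apply: le_trans (Bn z) _; apply: le_trans (ler_wpM2l K0 zr) _.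
  rewrite /rho mulrA; apply: le_trans (ler_wpM2l _ py) _; first by rewrite mulr_ge0.
  have : r <= r0 / 2 / (K * 2 + 1) by rewrite ge_min lexx orbT.
  by rewrite ler_pdivlMr//; apply: le_trans; rewrite mulrC ler_pM2l// lerDl.
pose psi z := z - (f (p + B z) - y).
have [|||z zr] := @half_contraction_fixpoint m psi rho.
- by [].
- have B0 : B 0 = 0 by rewrite -(scale0r (0 : 'rV[R]_m)) BZ scale0r.
  by rewrite /psi B0 addr0 sub0r normrN /rho mulrC mulKf.
(* Contraction is checked entry by entry, with the mean value theorem on the segment from [z'] to
   [z]: the derivative of [psi] along [w] is [w - 'd f _ (B w)], at most half of [w]. *)
- move=> z z' zr z'r; apply: mx_norm_le => [|i0' i]; first by rewrite mulr_ge0// divr_ge0.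
  rewrite {i0'}ord1; pose w := z - z'.
  pose q (t : R) := z' + t *: w.
  pose g (t : R) : R := psi (q t) 0 i.
  pose dg t := (w - 'd f (p + B (q t)) (B w)) 0 i.
  have qr (t : R) : t \in `[0, 1] -> `|q t| <= rho.
    rewrite in_itv /= => /andP[t0 t1].
    have -> : q t = (1 - t) *: z' + t *: z.
      by rewrite /q /w scalerBr scalerBl scale1r addrA addrAC.
    rewrite (le_trans (ler_normD _ _))// !normrZ (ger0_norm t0) ger0_norm ?subr_ge0//.
    have : (1 - t) * `|z'| <= (1 - t) * rho by rewrite ler_wpM2l// subr_ge0.
    have : t * `|z| <= t * rho by rewrite ler_wpM2l.
    by rewrite mulrBl mul1r; lra.
  have der (t : R) : t \in `[0, 1] -> is_derive t 1 g (dg t).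
    move=> t01; apply: vel_is_derive; apply: (@vel_entry _ _ _ (w - 'd f (p + B (q t)) (B w)) 0 i).
    have [df _] := hr0 _ (inball _ (qr t t01)).
    have qE h : q (h + t) = q t + h *: w by rewrite /q scalerDl (addrC (h *: w)) addrA.
    apply: vel_sub.
      by apply: vel_near (vel_line (q t) w); apply: filterE => h; rewrite qE.
    rewrite -[X in vel _ X]subr0; apply: vel_sub; last exact: vel_cst.
    have vl := vel_line (p + B (q t)) (B w).
    have df' : differentiable f ((fun h : R => p + B (q t) + h *: B w) 0).
      by rewrite scale0r addr0.
    have := vel_diff df' vl; rewrite scale0r addr0; apply: vel_near.
    apply: filterE => h /=; rewrite qE; congr f.
    by rewrite (BA (q t)) BZ addrA.
  have der' (t : R) : t \in `]0, 1[ -> is_derive t 1 g (dg t).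
    by rewrite in_itv /= => /andP[t0 t1]; apply: der; rewrite in_itv /= !ltW.
  have cg : {within `[0, 1], continuous g}.
    by apply: derivable_within_continuous => t t01; have [] := der t t01.
  have [t t01] := MVT_segment ler01 der' cg.
  rewrite subr0 mulr1 => hg.
  have -> : (psi z - psi z') 0 i = g 1 - g 0.
    have q1 : q 1 = z by rewrite /q scale1r /w addrC subrK.
    have q0 : q 0 = z' by rewrite /q scale0r addr0.
    by rewrite /g q1 q0 !mxE.
  rewrite hg /dg.
  have [_ /(_ w) hw] := hr0 _ (inball _ (qr t t01)).
  by apply: le_trans (mx_entry_le _ 0 i) _; rewrite distrC.
move=> fz; exists (p + B z).
  rewrite addrAC subrr add0r (le_trans (Bn z))// -mulrA ler_wpM2l//.
apply/eqP; rewrite -subr_eq0; apply/eqP; move: fz; rewrite /psi => /eqP.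
by rewrite -subr_eq0 opprB addrCA subrr addr0 => /eqP.
Qed.

(** The line [x0 + h *: v] is corrected for each [h] to a solution. Its defect is [o(h)], since both
    sides have the same velocity, hence so is the correction, and the velocity remains [v]. *)
Lemma lift_curve_rV n m (f : 'rV[R]_n -> 'rV[R]_m) x0 (b : R -> 'rV[R]_m) v :
  smooth_rV f x0 -> (forall w, exists v, 'd f x0 v = w) ->
  b 0 = f x0 -> vel b ('d f x0 v) ->
  exists g : R -> 'rV[R]_n, [/\ g 0 = x0, vel g v & \forall h \near (0 : R), f (g h) = b h].
Proof.
move=> sf surj b0 vb; have [k [r [k0 r0 H]]] := local_solve sf surj.
have df := smooth_rV_diff sf.
have vl := vel_line x0 v.
have df' : differentiable f ((fun h : R => x0 + h *: v) 0) by rewrite scale0r addr0.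
have := vel_diff df' vl; rewrite scale0r addr0 => vfl.
have vd := vel_sub vfl vb; rewrite subrr in vd.
pose ok h x := `|x - (x0 + h *: v)| <= k * `|f (x0 + h *: v) - b h| /\ f x = b h.
have nok : \forall h \near (0 : R), exists x, ok h x.
  have /cvgrPdist_le /(_ _ r0) h1 := vel_cvg vl.
  have /cvgrPdist_le /(_ _ r0) h2 := vel_cvg vd.
  apply: filterS2 h1 h2 => h; rewrite scale0r addr0 distrC => hp.
  rewrite /= scale0r addr0 b0 subrr sub0r normrN => hy.
  by have [x xp fx] := H _ _ hp hy; exists x.
(* Where there is no solution the line itself is the default; this does not happen near 0. *)
pose g h := if pselect (exists x, ok h x) is left e then projT1 (cid e) else x0 + h *: v.
have gok h : (exists x, ok h x) -> ok h (g h).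
  by rewrite /g; case: pselect => // e _; exact: projT2 (cid e).
have g0 : g 0 = x0.
  have [] := gok 0 (nbhs_singleton nok).
  by rewrite scale0r addr0 b0 subrr normr0 mulr0 normr_le0 subr_eq0 => /eqP.
exists g; split => //; last by apply: filterS nok => h /gok [].
move=> e e0; have k1 : 0 < k + 1 by rewrite ltr_wpDl.
have e1 : 0 < e / (k + 1) by rewrite divr_gt0.
apply: filterS2 nok (vd _ e1) => h /gok [gh _].
rewrite /= scale0r addr0 b0 subrr subr0 scaler0 subr0 => hd.
rewrite g0 -addrA -opprD; apply: le_trans gh _.
apply: le_trans (ler_wpM2l k0 hd) _; rewrite mulrA ler_wpM2r//.
by rewrite mulrCA ger_pMr// ler_pdivrMr// mul1r lerDl.
Qed.

End LocalSolve.

(** * Velocities in manifolds *)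

Section ManifoldVelocity.
Variable R : realType.

Definition mvel (M : charted R) (g : R -> M) (v : tvector M) :=
  [/\ tangent (g 0) v, g @ (0 : R) --> g 0 &
      forall c, atlas M c -> dom c (g 0) -> vel (fun h => coord c (g h)) (v c)].

Lemma smooth_transition_diff (M : charted R) (c c' : chart R M) x :
  smooth_manifold M -> atlas M c -> atlas M c' -> dom c x -> dom c' x ->
  differentiable (coord c' \o param c) (coord c x).
Proof. by move=> [_ _ tr] ac ac' dx dx'; apply: smooth_rV_diff; exact: tr. Qed.

Lemma near_chart (M : charted R) (c : chart R M) (g : R -> M) :
  is_chart c -> g @ (0 : R) --> g 0 -> dom c (g 0) -> \forall h \near (0 : R), dom c (g h).
Proof. by move=> ic cg dg; exact: cg _ (chart_nbhs ic dg). Qed.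

Lemma tangent_eq (M : charted R) (c : chart R M) x (v w : tvector M) :
  tangent x v -> tangent x w -> atlas M c -> dom c x -> v c = w c -> v = w.
Proof.
move=> [vt v0] [wt w0] ac dx vw; apply: functional_extensionality_dep => c'.
have [[ac' dx']|n] := pselect (atlas M c' /\ dom c' x).
  by rewrite (vt c c')// (wt c c')// vw.
by rewrite v0// w0.
Qed.

Lemma vel_transition (M : charted R) (c c' : chart R M) (g : R -> M) xi :
  smooth_manifold M -> atlas M c -> atlas M c' -> g @ (0 : R) --> g 0 ->
  dom c (g 0) -> dom c' (g 0) -> vel (fun h => coord c (g h)) xi ->
  vel (fun h => coord c' (g h)) ('d (coord c' \o param c) (coord c (g 0)) xi).
Proof.
move=> hM ac ac' cg dx dx' vg; have [charts _ _] := hM.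
have := vel_diff (smooth_transition_diff hM ac ac' dx dx') vg; apply: vel_near.
apply: filterS (near_chart (charts _ ac) cg dx) => h dh.
by rewrite /= (chartK (charts _ ac) dh).
Qed.

Lemma mvel_one (M : charted R) (c : chart R M) (g : R -> M) xi :
  smooth_manifold M -> atlas M c -> dom c (g 0) -> g @ (0 : R) --> g 0 ->
  vel (fun h => coord c (g h)) xi -> exists2 v, mvel g v & v c = xi.
Proof.
move=> hM ac dx cg vg.
pose v : tvector M := fun c' =>
  if pselect (atlas M c' /\ dom c' (g 0)) is left _
  then 'd (coord c' \o param c) (coord c (g 0)) xi else 0.
have vv c' : atlas M c' -> dom c' (g 0) -> vel (fun h => coord c' (g h)) (v c').
  move=> ac' dx'; rewrite /v; case: pselect => [_|[]//].
  exact: vel_transition.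
exists v; last by exact: vel_uniq (vv c ac dx) vg.
split => //; split=> [c1 c2 a1 a2 d1 d2|c' n].
  exact: vel_uniq (vv c2 a2 d2) (vel_transition hM a1 a2 cg d1 d2 (vv c1 a1 d1)).
by rewrite /v; case: pselect.
Qed.

Lemma mvel_uniq (M : charted R) (g : R -> M) v w : smooth_manifold M ->
  mvel g v -> mvel g w -> v = w.
Proof.
move=> [_ cover _] [tv _ vv] [tw _ vw]; have [c ac dc] := cover (g 0).
by apply: (tangent_eq tv tw ac dc); exact: vel_uniq (vv c ac dc) (vw c ac dc).
Qed.

Lemma mvel_near (M : charted R) (g g' : R -> M) v :
  (\forall h \near (0 : R), g h = g' h) -> mvel g v -> mvel g' v.
Proof.
move=> gg' [tv cg vg]; have e0 := nbhs_singleton gg'; split.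
- by rewrite -e0.
- by rewrite -e0; apply: cvg_trans cg; apply: near_eq_cvg; apply: filterS gg' => h ->.
- move=> c ac; rewrite -e0 => dc; apply: vel_near (vg c ac dc).
  by apply: filterS gg' => h ->.
Qed.

Lemma param_curve (M : charted R) (c : chart R M) x (g : R -> 'rV[R]_(dim c)) xi :
  is_chart c -> dom c x -> g 0 = coord c x -> vel g xi ->
  [/\ param c (g 0) = x, (fun h => param c (g h)) @ (0 : R) --> x &
      vel (fun h => coord c (param c (g h))) xi].
Proof.
move=> ic dx g0 vg; have cg := vel_cvg vg; rewrite g0 in cg; split.
- by rewrite g0 (chartK ic).
- by apply: cvg_comp cg _; exact: param_cvg.
- apply: vel_near (vg).
  have H : \forall h \near (0 : R), dom c (param c (g h)) /\
     coord c (param c (g h)) = g h := cg _ (chart_paramK ic dx).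
  by apply: filterS H => h [].
Qed.

Lemma mvel_param (M : charted R) (c : chart R M) x (g : R -> 'rV[R]_(dim c)) xi :
  smooth_manifold M -> atlas M c -> dom c x -> g 0 = coord c x -> vel g xi ->
  exists v, [/\ mvel (fun h => param c (g h)) v, tangent x v & v c = xi].
Proof.
move=> hM ac dx g0 vg; have [charts _ _] := hM; have ic := charts c ac.
have [gx cg vgx] := param_curve ic dx g0 vg.
have [v vv vc] : exists2 v, mvel (fun h => param c (g h)) v & v c = xi.
  by apply: mvel_one vgx => //; rewrite gx.
by exists v; split => //; have [] := vv; rewrite gx.
Qed.

Lemma tangent_ex (M : charted R) (c : chart R M) x xi : smooth_manifold M ->
  atlas M c -> dom c x -> exists2 v : tvector M, tangent x v & v c = xi.
Proof.
move=> hM ac dx; have [|v [_ tv vc]] := mvel_param hM ac dx _ (vel_line (coord c x) xi).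
  by rewrite scale0r addr0.
by exists v.
Qed.

Lemma tangent_curve (M : charted R) (x : M) v : smooth_manifold M -> tangent x v ->
  exists2 g : R -> M, g 0 = x & mvel g v.
Proof.
move=> hM tv; have [charts cover _] := hM; have [c ac dx] := cover x.
have [|w [vw tw wc]] := mvel_param hM ac dx _ (vel_line (coord c x) (v c)).
  by rewrite scale0r addr0.
exists (fun h => param c (coord c x + h *: v c)).
  by rewrite scale0r addr0 (chartK (charts c ac)).
by have e := tangent_eq tw tv ac dx wc; rewrite e in vw.
Qed.

Section Maps.
Variables (M N : charted R) (F : M -> N).
Hypotheses (hM : smooth_manifold M) (hN : smooth_manifold N).

Lemma smooth_cvg x : smooth_at F x -> F @ x --> F x.
Proof. by case. Qed.

Lemma vel_smooth (c : chart R M) (c' : chart R N) (g : R -> M) xi :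
  smooth_at F (g 0) -> atlas M c -> atlas N c' -> g @ (0 : R) --> g 0 ->
  dom c (g 0) -> dom c' (F (g 0)) -> vel (fun h => coord c (g h)) xi ->
  vel (fun h => coord c' (F (g h))) ('d (coord c' \o F \o param c) (coord c (g 0)) xi).
Proof.
move=> [cF sF] ac ac' cg dx dx' vg; have [charts _ _] := hM.
have := vel_diff (smooth_rV_diff (sF c c' ac ac' dx dx')) vg; apply: vel_near.
apply: filterS (near_chart (charts _ ac) cg dx) => h dh.
by rewrite /= (chartK (charts _ ac) dh).
Qed.

Lemma mvel_smooth (g : R -> M) v : smooth_at F (g 0) -> mvel g v ->
  exists2 w, mvel (F \o g) w & differential F (g 0) v w.
Proof.
move=> sF [tv cg vg]; have [_ coverM _] := hM; have [_ coverN _] := hN.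
have [c ac dc] := coverM (g 0); have [c' ac' dc'] := coverN (F (g 0)).
have cFg : (F \o g) @ (0 : R) --> (F \o g) 0.
  by apply: cvg_comp cg _; exact: smooth_cvg.
have [w wF _] := @mvel_one N c' (F \o g) _ hN ac' dc' cFg
  (vel_smooth sF ac ac' cg dc dc' (vg c ac dc)).
exists w => //; have [tw _ vw] := wF; split => // c1 c1' a1 a1' d1 d1'.
exact: vel_uniq (vw c1' a1' d1') (vel_smooth sF a1 a1' cg d1 d1' (vg c1 a1 d1)).
Qed.

Lemma differential_uniq x v w w' : differential F x v w -> differential F x v w' -> w = w'.
Proof.
move=> [_ tw hw] [_ tw' hw']; have [_ coverM _] := hM; have [_ coverN _] := hN.
have [c ac dc] := coverM x; have [c' ac' dc'] := coverN (F x).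
by apply: (tangent_eq tw tw' ac' dc'); rewrite (hw c)// (hw' c).
Qed.

Lemma differential_mvel (g : R -> M) v w : smooth_at F (g 0) -> mvel g v ->
  differential F (g 0) v w -> mvel (F \o g) w.
Proof.
by move=> sF vg dw; have [w' wF dw'] := mvel_smooth sF vg; rewrite (differential_uniq dw dw').
Qed.

Lemma differential_ex x v : smooth_at F x -> tangent x v -> exists w, differential F x v w.
Proof.
move=> sF tv; have [g g0 vg] := tangent_curve hM tv.
rewrite -g0 in sF *; have [w _ dw] := mvel_smooth sF vg.
by exists w.
Qed.

Lemma lift_curve x v (b : R -> N) w : submersion F -> F x = b 0 ->
  differential F x v w -> mvel b w ->
  exists g : R -> M, [/\ g 0 = x, mvel g v & \forall h \near (0 : R), F (g h) = b h].
Proof.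
move=> [sF surj] Fx dw [tw cb vb]; have [chM coverM _] := hM; have [chN coverN _] := hN.
have [c ac dx] := coverM x; have [c' ac' dx'] := coverN (F x).
have ic := chM c ac; have ic' := chN c' ac'; have [tv _ dcc] := dw.
pose f := coord c' \o F \o param c.
have sf : smooth_rV f (coord c x) by have [_] := sF x; apply.
have fx : f (coord c x) = coord c' (b 0) by rewrite /f /= (chartK ic dx) Fx.
have fsurj om : exists xi, 'd f (coord c x) xi = om.
  have [om' tom oc] := tangent_ex om hN ac' dx'.
  have [v' [_ _ dv']] := surj x om' tom.
  by exists (v' c); rewrite -oc (dv' c c').
have vb' : vel (fun h => coord c' (b h)) ('d f (coord c x) (v c)).
  by rewrite -(dcc c c')//; apply: vb => //; rewrite -Fx.
have [g [g0 vg fg]] := lift_curve_rV sf fsurj (esym fx) vb'.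
have [gx cgc _] := param_curve ic dx g0 vg.
exists (fun h => param c (g h)); split => //.
  have [v' [vg' tv' vc']] := mvel_param hM ac dx g0 vg.
  by rewrite (tangent_eq tv tv' ac dx).
have n1 : \forall h \near (0 : R), dom c' (F (param c (g h))).
  have cF : F @ x --> F x by have [] := sF x.
  have cFg : (fun h => F (param c (g h))) @ (0 : R) --> F x by exact: cvg_comp cgc cF.
  exact: cFg _ (chart_nbhs ic' dx').
have n2 : \forall h \near (0 : R), dom c' (b h).
  by apply: near_chart => //; rewrite -Fx.
apply: filterS3 fg n1 n2 => h fgh d1 d2.
by rewrite -(chartK ic' d1) -(chartK ic' d2); congr (param c' _).
Qed.

End Maps.

(** The curve stays in [D], so a local smooth extension may replace [F]. The resulting velocity is
    left unspecified: for a product of arrows its images under source and target are recovered from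
    those of the factors. *)
Lemma mvel_pair (M N P : charted R) (F : M * N -> P) (D : set (M * N))
    (g : R -> M) (g' : R -> N) v v' :
  smooth_manifold M -> smooth_manifold N -> smooth_manifold P ->
  @smooth_on R (charted_prod M N) P D F ->
  (\forall h \near (0 : R), D (g h, g' h)) -> mvel g v -> mvel g' v' ->
  exists w, mvel (fun h => F (g h, g' h)) w.
Proof.
move=> hM hN hP sF nD [tv cg vg] [tv' cg' vg'].
have [F' [cF' sF'] FF'] := sF _ (nbhs_singleton nD).
have [chM coverM _] := hM; have [chN coverN _] := hN; have [_ coverP _] := hP.
have [c ac dc] := coverM (g 0); have [c' ac' dc'] := coverN (g' 0).
have [e ae de] := coverP (F' (g 0, g' 0)).
have cp : (fun h => (g h, g' h)) @ (0 : R) --> (g 0, g' 0) by exact: cvg_pair.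
have cFp : (fun h => F' (g h, g' h)) @ (0 : R) --> F' (g 0, g' 0).
  exact: (cvg_comp _ _ cp cF').
pose f := coord e \o F' \o param (prod_chart c c').
have df : differentiable (f : 'rV[R]_(dim c + dim c') -> _) (row_mx (coord c (g 0)) (coord c' (g' 0))).
  by apply: smooth_rV_diff; apply: (sF' (prod_chart c c') e) => //; exists c, c'.
have vr := vel_row (vg c ac dc) (vg' c' ac' dc').
have vF : vel (fun h => coord e (F' (g h, g' h)))
    ('d (f : 'rV[R]_(dim c + dim c') -> _) (row_mx (coord c (g 0)) (coord c' (g' 0))) (row_mx (v c) (v' c'))).
  have := vel_diff (b := fun h => row_mx (coord c (g h)) (coord c' (g' h))) df vr.
  apply: vel_near; apply: filterS2 (near_chart (chM _ ac) cg dc) (near_chart (chN _ ac') cg' dc') => h dh dh'.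
  by rewrite /f /= row_mxKl row_mxKr (chartK (chM _ ac) dh) (chartK (chN _ ac') dh').
have [w wF _] := mvel_one hP ae de cFp vF.
exists w; apply: mvel_near wF.
have H : \forall h \near (0 : R), D (g h, g' h) -> F' (g h, g' h) = F (g h, g' h) := cp _ FF'.
by apply: filterS2 H nD => h h1 /h1.
Qed.

End ManifoldVelocity.

(** * Ineffective arrows *)

Lemma tangentB (R : realType) (M : charted R) (x : M) v w :
  tangent x v -> tangent x w -> tangent x (fun c => v c - w c).
Proof.
move=> [vt v0] [wt w0]; split=> [c c' ac ac' dx dx'|c n].
  by rewrite linearB -(vt c c')// -(wt c c').
by rewrite v0// w0// subrr.
Qed.

Lemma tangent0 (R : realType) (M : charted R) (x : M) : tangent x (fun=> 0).
Proof. by split => // c c' ac ac' dx dx'; rewrite linear0. Qed.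

Lemma differentialB (R : realType) (M N : charted R) (F : M -> N) x v w v' w' :
  differential F x v w -> differential F x v' w' ->
  differential F x (fun c => v c - v' c) (fun c => w c - w' c).
Proof.
move=> [tv tw h] [tv' tw' h']; split; [exact: tangentB|exact: tangentB|].
by move=> c c' ac ac' dx dx'; rewrite linearB -(h c c')// -(h' c c').
Qed.

Lemma differential0 (R : realType) (M N : charted R) (F : M -> N) x :
  differential F x (fun=> 0) (fun=> 0).
Proof. by split; [exact: tangent0|exact: tangent0|move=> *; rewrite linear0]. Qed.

Section Ineffective.
Variables (R : realType) (G0 G1 : charted R) (G : groupoid G0 G1) (a : G0).
Hypothesis G_lie : lie_groupoid G.

Let gG : is_groupoid G. Proof. by case: G_lie => [[]]. Qed.
Let hM0 : smooth_manifold G0. Proof. by case: G_lie => [_ [[]]]. Qed.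
Let hM1 : smooth_manifold G1. Proof. by case: G_lie => [_ [[]]]. Qed.
Let sub_s : submersion (src G). Proof. by case: G_lie => [_ [_ []]]. Qed.
Let sm_t : smooth (tgt G). Proof. by case: G_lie => [_ [_ []]]. Qed.
Let sm_i : smooth (inv_ar G). Proof. by case: G_lie => [_ [_ []]]. Qed.
Let sm_s : smooth (src G). Proof. by case: sub_s. Qed.
Let sm_m : @smooth_on R (charted_prod G1 G1) G1 [set p | src G p.1 = tgt G p.2]
  (fun p => mul G p.1 p.2).
Proof. by case: G_lie => [_ [_ []]]. Qed.

Lemma src_mul g g' : src G g = tgt G g' -> src G (mul G g g') = src G g'.
Proof. by case: gG => _ [h _] /h []. Qed.
Lemma tgt_mul g g' : src G g = tgt G g' -> tgt G (mul G g g') = tgt G g.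
Proof. by case: gG => _ [h _] /h []. Qed.
Lemma src_inv g : src G (inv_ar G g) = tgt G g.
Proof. by case: gG => _ [_ [_ [_ /(_ g) []]]]. Qed.
Lemma tgt_inv g : tgt G (inv_ar G g) = src G g.
Proof. by case: gG => _ [_ [_ [_ /(_ g) []]]]. Qed.
Lemma mulK_ar g g' : src G g = tgt G g' -> mul G (mul G g g') (inv_ar G g') = g.
Proof.
move=> e; case: gG => _ [_ [ass [un inv]]].
have [i1 i2 i3 i4] := inv g'; rewrite -ass//.
by rewrite i3 -e; have [] := un g.
Qed.

Local Notation OT := (orbit_tangent G a).

Lemma orbit_tangent0 : OT (fun=> 0).
Proof. by exists (fun=> 0); exact: differential0. Qed.

Lemma orbit_tangentB w w' : OT w -> OT w' -> OT (fun c => w c - w' c).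
Proof.
move=> [v sv tv] [v' sv' tv']; exists (fun c => v c - v' c); last exact: differentialB.
have := differentialB sv sv'.
by rewrite (_ : (fun c => 0 - 0) = (fun=> 0))//; apply: functional_extensionality_dep => c; rewrite subr0.
Qed.

Lemma orbit_tangentD w w' : OT w -> OT w' -> OT (fun c => w c + w' c).
Proof.
move=> ow ow'; have := orbit_tangentB ow (orbit_tangentB orbit_tangent0 ow').
rewrite (_ : (fun c => w c - (0 - w' c)) = (fun c => w c + w' c))//.
by apply: functional_extensionality_dep => c; rewrite sub0r opprK.
Qed.

(** Over an isotropy arrow both images of [v] are tangent at [a], so they can be subtracted.
    Changing representatives of normal classes alters the difference by orbit tangents only. *)
Lemma ineffP g : isotropy G a g -> ineffective G a g <->
  forall v w w', differential (src G) g v w -> differential (tgt G) g v w' ->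
    OT (fun c => w' c - w c).
Proof.
move=> [sg tg]; split=> [[_ Kg] v w w' sv tv|H]; last first.
  split=> // u u' [v [w [w' [sv tv [tu tw ow] [tu' tw' ow']]]]].
  rewrite sg in tu tw ow; rewrite tg in tu' tw' ow'.
  split => //; have := orbit_tangentB (orbit_tangentD ow (H _ _ _ sv tv)) ow'.
  rewrite (_ : (fun c => _) = (fun c => u' c - u c))//.
  apply: functional_extensionality_dep => c.
  by rewrite [w c - u c + _]addrC addrA subrK subrACA subrr sub0r opprB.
have [_ tw _] := sv; have [_ tw' _] := tv.
have [] := Kg w w'; last by [].
exists v, w, w'; rewrite sg tg in tw tw' *.
have o0 u : OT (fun c => u c - u c).
  rewrite (_ : (fun c => _) = (fun=> 0)); first exact: orbit_tangent0.
  by apply: functional_extensionality_dep => c; rewrite subrr.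
by split.
Qed.

(** A curve [X] through the product is written as [Z Y], with [Y] through [g'] lifting the sources
    of [X] and [Z] through [g]. As the sources of [Z] are the targets of [Y], the difference of the
    target and source velocities of [X] is the sum of those for [Z] and [Y]. *)
Lemma ineffective_mul g g' : ineffective G a g -> ineffective G a g' ->
  ineffective G a (mul G g g').
Proof.
move=> Kg Kg'; have [[sg tg] _] := Kg; have [[sg' tg'] _] := Kg'.
have e : src G g = tgt G g' by rewrite sg tg'.
have ig : isotropy G a (mul G g g') by split; rewrite ?src_mul ?tgt_mul.
apply/(ineffP ig) => v w w' sv tv.
have [tv_ tw _] := sv.
have [v1 sv1] : exists v1, differential (src G) g' v1 w.
  by apply: sub_s.2; rewrite -(src_mul e).
have [tv1 _ _] := sv1.
have [w1 dw1] := differential_ex hM1 hM0 (sm_t g') tv1.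
have [X X0 vX] := tangent_curve hM1 tv_.
rewrite -X0 in sv tv.
have vsX := differential_mvel hM1 hM0 (sm_s _) vX sv.
have vtX := differential_mvel hM1 hM0 (sm_t _) vX tv.
have [|Y [Y0 vY YX]] := lift_curve hM1 hM0 sub_s (x := g') _ sv1 vsX.
  by rewrite /= X0 src_mul.
have [u vi _] := mvel_smooth hM1 hM1 (sm_i _) vY.
have nD : \forall h \near (0 : R), [set p | src G p.1 = tgt G p.2] (X h, inv_ar G (Y h)).
  by apply: filterS YX => h /= <-; rewrite tgt_inv.
have [z vZ] := mvel_pair hM1 hM1 hM1 sm_m nD vX vi.
have Z0 : mul G (X 0) (inv_ar G (Y 0)) = g by rewrite X0 Y0 mulK_ar.
have [wz vsZ dsZ] := mvel_smooth hM1 hM0 (sm_s _) vZ.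
have [wz' vtZ dtZ] := mvel_smooth hM1 hM0 (sm_t _) vZ.
rewrite Z0 in dsZ dtZ.
rewrite -Y0 in dw1; have vtY := differential_mvel hM1 hM0 (sm_t _) vY dw1.
rewrite Y0 in dw1.
have e1 : wz = w1.
  apply: (mvel_uniq hM0 _ vtY); apply: mvel_near vsZ.
  by apply: filterS nD => h /= eh; rewrite src_mul// src_inv.
have e2 : wz' = w'.
  apply: (mvel_uniq hM0 _ vtX); apply: mvel_near vtZ.
  by apply: filterS nD => h /= eh; rewrite tgt_mul.
rewrite e1 in dsZ; rewrite e2 in dtZ.
have o1 := (ineffP Kg.1).1 Kg _ _ _ dsZ dtZ.
have o2 := (ineffP Kg'.1).1 Kg' _ _ _ sv1 dw1.
have := orbit_tangentD o1 o2.
rewrite (_ : (fun c => _) = (fun c => w' c - w c))//.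
by apply: functional_extensionality_dep => c; rewrite addrA subrK.
Qed.

(** The orbit tangent space is the image under the target differential of the kernel of the source
    differential. Writing it as the zero set of a cokernel matrix gives equations that pass to
    limits. *)
Lemma orbit_tangent_chart (c : chart R G0) : atlas G0 c -> dom c a ->
  exists C : 'M[R]_(dim c), forall w, tangent a w -> OT w <-> w c *m C = 0.
Proof.
move=> ac da; have [_ cover1 _] := hM1; have [e ae de] := cover1 (unit_ar G a).
have [su tu] : src G (unit_ar G a) = a /\ tgt G (unit_ar G a) = a by case: gG => /(_ a).
pose S := lin1_mx ('d (coord c \o src G \o param e) (coord e (unit_ar G a))).
pose T := lin1_mx ('d (coord c \o tgt G \o param e) (coord e (unit_ar G a))).
exists (cokermx (kermx S *m T)) => w tw; split=> [[v [tv tw0 sv] [_ _ tv']]|wC].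
  have hS : v e *m S = 0.
    by rewrite mul_rV_lin1 -(sv e c)//= su.
  have hT : v e *m T = w c.
    by rewrite mul_rV_lin1 -(tv' e c)//= tu.
  have /submxP [D vD] : (v e <= kermx S)%MS by apply/sub_kermxP.
  apply/eqP; rewrite -submxE -hT vD -mulmxA; exact: submxMl.
have /submxP [D wD] : (w c <= kermx S *m T)%MS by rewrite submxE wC.
have [v tv ve] := tangent_ex (D *m kermx S) hM1 ae de.
have [w0 dw0] := differential_ex hM1 hM0 (sm_s _) tv.
have [w1 dw1] := differential_ex hM1 hM0 (sm_t _) tv.
exists v.
  suff -> : (fun=> 0) = w0 by [].
  have [_ tw0 sv] := dw0; rewrite su in tw0.
  apply: (tangent_eq (tangent0 a) tw0 ac da).
  rewrite (sv e c)//= ?su// ve -[RHS](mul_rV_lin1 ('d (coord c \o src G \o param e) _)).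
  by rewrite -/S -mulmxA mulmx_ker mulmx0.
suff -> : w = w1 by [].
have [_ tw1 sv] := dw1; rewrite tu in tw1.
apply: (tangent_eq tw tw1 ac da).
rewrite (sv e c)//= ?tu// ve -[RHS](mul_rV_lin1 ('d (coord c \o tgt G \o param e) _)).
by rewrite -/T -mulmxA wD.
Qed.

Hypothesis G_proper : proper_groupoid G.

Lemma isotropy_compact : compact (isotropy G a).
Proof.
have [_ _ pr] := G_proper; have := pr _ (@compact_set1 _ (a, a)).
suff -> : ((fun g => (src G g, tgt G g)) @^-1` [set (a, a)]) = isotropy G a by [].
apply/seteqP; split => g /= [e1 e2]; first by split.
by rewrite e1 e2.
Qed.

Lemma ineffective_closed : closed (ineffective G a).
Proof.
have [_ h1 _] := G_proper.
have ci : closed (isotropy G a) := compact_closed h1 isotropy_compact.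
move=> g clg; have ig : isotropy G a g.
  by apply: ci; apply: closureS clg => x [].
apply/(ineffP ig) => v w w' sv tv; have [sg tg] := ig.
have [ch1 cover1 _] := hM1; have [d ad dg] := cover1 g.
have [_ cover0 _] := hM0; have [c ac da] := cover0 a.
have [C HC] := orbit_tangent_chart ac da.
have [tv0 tw _] := sv; have [_ tw' _] := tv.
rewrite sg in tw; rewrite tg in tw'.
apply/HC; first exact: tangentB.
pose ss := coord c \o src G \o param d; pose tt := coord c \o tgt G \o param d.
(* The coordinate vector of [v] is kept fixed and moved to arrows near [g]; all isotropy arrows at
   [a] share the chart [c] and the equations [C]. *)
pose phi z := 'D_(v d) tt z - 'D_(v d) ss z.
have dss h : dom d h -> isotropy G a h -> differentiable ss (coord d h).
  move=> dh [sh th]; apply: smooth_rV_diff; have [_] := sm_s h; apply => //.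
  by rewrite sh.
have dtt h : dom d h -> isotropy G a h -> differentiable tt (coord d h).
  move=> dh [sh th]; apply: smooth_rV_diff; have [_] := sm_t h; apply => //.
  by rewrite th.
have phiE h u y y' : dom d h -> isotropy G a h -> u d = v d ->
    differential (src G) h u y -> differential (tgt G) h u y' ->
    phi (coord d h) = y' c - y c.
  move=> dh ih ud [_ _ sy] [_ _ ty]; have [sh th] := ih.
  rewrite /phi !deriveE; [|exact: dss|exact: dtt].
  by rewrite (sy d c)//= ?sh// (ty d c)//= ?th// ud.
rewrite -(phiE g v w w')//; apply/matrixP => i j; rewrite {i}ord1.
rewrite [RHS]mxE.
have cphi : {for coord d g, continuous phi}.
  have s1 : smooth_rV ss (coord d g).
    by have [_] := sm_s g; apply => //; rewrite sg.
  have s2 : smooth_rV tt (coord d g).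
    by have [_] := sm_t g; apply => //; rewrite tg.
  have d1 := differentiable_continuous (nbhs_singleton s1 [:: v d]).
  have d2 := differentiable_continuous (nbhs_singleton s2 [:: v d]).
  exact: continuousB d2 d1.
have cC : continuous (fun z : 'rV[R]_(dim c) => (z *m C) 0 j).
  have -> : (fun z : 'rV[R]_(dim c) => (z *m C) 0 j) = fun z => \sum_k z 0 k * C k j.
    by apply/funext => z; rewrite mxE.
  apply: (sum_cont (F := fun k (z : 'rV[R]_(dim c)) => z 0 k * C k j)) => k.
  apply: (mul_cont (f := fun z : 'rV[R]_(dim c) => z 0 k)); last exact: cst_continuous.
  exact: (@coord_continuous R 1 (dim c) 0 k).
have cg : (fun h => (phi (coord d h) *m C) 0 j) @ g --> (phi (coord d g) *m C) 0 j.
  have c1 : (fun h => phi (coord d h)) @ g --> phi (coord d g).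
    exact: cvg_comp (chart_cvg (ch1 _ ad) dg) cphi.
  exact: cvg_comp c1 (cC _).
(* If an equation failed at [g], by continuity it would fail at an ineffective arrow near [g]. *)
apply/eqP/negPn/negP => n0.
have nb : nbhs g [set h | (phi (coord d h) *m C) 0 j != 0].
  apply: (cg [set x | x != 0]); apply: open_nbhs_nbhs; split => //.
have [h [Kh [/= hn dh]]] := clg _ (filterI nb (chart_nbhs (ch1 _ ad) dg)).
have [u tu ud] := tangent_ex (v d) hM1 ad dh.
have [y dy] := differential_ex hM1 hM0 (sm_s _) tu.
have [y' dy'] := differential_ex hM1 hM0 (sm_t _) tu.
have oy := (ineffP Kh.1).1 Kh _ _ _ dy dy'.
have [_ ty _] := dy; have [_ ty' _] := dy'.
rewrite Kh.1.1 in ty; rewrite Kh.1.2 in ty'.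
have yC := (HC _ (tangentB ty' ty)).1 oy.
by rewrite (phiE h u y y') ?yC ?mxE ?eqxx in hn; [| |exact: Kh.1|..].
Qed.

Lemma ineffective_compact : compact (ineffective G a).
Proof.
by apply: subclosed_compact ineffective_closed isotropy_compact _ => g [].
Qed.

End Ineffective.

Lemma compact_set_type (T : topologicalType) (A : set T) :
  compact A -> compact [set: set_type A].
Proof.
move=> cA F FF _.
have [x [Ax clx]] : A `&` cluster ((set_val : set_type A -> T) @ F) !=set0.
  by apply: cA; apply: (@filterE _ F) => y; exact: set_valP.
exists (exist _ x (mem_set Ax)); split=> // B U FB [_ /= [[W oW <-] Wx] WU].
have FB' : F (set_val @^-1` (set_val @` B : set T)).
  by apply: filterS FB => y By; exists y.
have [||_ [[b Bb <-] Wb]] := clx (set_val @` B) W.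
- exact: FB'.
- by apply: open_nbhs_nbhs; split.
- by exists b; split => //; apply: WU.
Qed.

(** * Close orthogonal families *)

Section MatrixAnalysis.
Variable R : realType.

Lemma cvg_mx (T : Type) (F : set_system T) {FF : Filter F} m n
    (f : T -> 'M[R]_(m, n)) (A : 'M[R]_(m, n)) :
  (forall i j, (fun t => f t i j) @ F --> A i j) -> f @ F --> A.
Proof.
move=> h; apply/cvgrPdist_le => e e0.
have : \forall t \near F, forall ij : 'I_m * 'I_n, `|A ij.1 ij.2 - f t ij.1 ij.2| <= e.
  apply: filter_forall => -[i j] /=.
  exact: ((cvgrPdist_le _ _).1 (h i j)).
apply: filterS => t H; apply: mx_norm_le; first exact: ltW.
by move=> i j; rewrite !mxE; exact: (H (i, j)).
Qed.

Lemma continuous_mx (X : topologicalType) m n (f : X -> 'M[R]_(m, n)) (x : X) :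
  (forall i j, {for x, continuous (fun t => f t i j)}) -> {for x, continuous f}.
Proof. by move=> h; have FF := nbhs_filter x; apply: (cvg_mx (F := nbhs x)) => i j; exact: h. Qed.

Lemma entry_cont m n (i : 'I_m) (j : 'I_n) : continuous (fun A : 'M[R]_(m, n) => A i j).
Proof. exact: (@coord_continuous R m n i j). Qed.

Lemma mulmx_sandwich_cont m n p q (A : 'M[R]_(m, n)) (B : 'M[R]_(p, q)) :
  continuous (fun X : 'M[R]_(n, p) => A *m X *m B).
Proof.
move=> X; apply: continuous_mx => i j.
have -> : (fun t : 'M[R]_(n, p) => (A *m t *m B) i j) =
    fun t => \sum_k (\sum_l A i l * t l k) * B k j.
  by apply/funext => t; rewrite mxE; apply: eq_bigr => k _; rewrite mxE.
apply: (sum_cont (F := fun k (t : 'M[R]_(n, p)) => (\sum_l A i l * t l k) * B k j)) => k.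
apply: (mul_cont (f := fun t : 'M[R]_(n, p) => \sum_l A i l * t l k)); last exact: cst_continuous.
apply: (sum_cont (F := fun l (t : 'M[R]_(n, p)) => A i l * t l k)) => l.
by apply: mul_cont; [exact: cst_continuous|exact: entry_cont].
Qed.

Definition frob m n (X : 'M[R]_(m, n)) : R := \sum_i \sum_j X i j * X i j.

Lemma frob_tr m n (X : 'M[R]_(m, n)) : frob X = \tr (X *m X^T).
Proof.
by apply: eq_bigr => i _; rewrite mxE; apply: eq_bigr => j _; rewrite mxE.
Qed.

Lemma frob_cont m n : continuous (@frob m n).
Proof.
apply: (sum_cont (F := fun i (X : 'M[R]_(m, n)) => \sum_j X i j * X i j)) => i.
apply: (sum_cont (F := fun j (X : 'M[R]_(m, n)) => X i j * X i j)) => j.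
by apply: mul_cont; exact: entry_cont.
Qed.

Lemma frob_ge0 m n (X : 'M[R]_(m, n)) : 0 <= frob X.
Proof. by do 2!apply: sumr_ge0 => ? _; rewrite -expr2 sqr_ge0. Qed.

Lemma frob_eq0 m n (X : 'M[R]_(m, n)) : frob X = 0 -> X = 0.
Proof.
have h i : 0 <= \sum_j X i j * X i j by apply: sumr_ge0 => ? _; rewrite -expr2 sqr_ge0.
move=> /eqP; rewrite psumr_eq0// => /allP X0; apply/matrixP => i j; rewrite mxE.
have := X0 i (mem_index_enum _); rewrite psumr_eq0/= => [/allP Xi0|k _]; last by rewrite -expr2 sqr_ge0.
by have := Xi0 j (mem_index_enum _); rewrite /= mulf_eq0 orbb => /eqP.
Qed.

(** The parallelogram law, from which a point of least norm in a convex set is unique. *)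
Lemma frob_midpoint m n (X Y : 'M[R]_(m, n)) :
  frob (2^-1 *: (X + Y)) + frob (2^-1 *: (X - Y)) = 2^-1 * (frob X + frob Y).
Proof.
rewrite /frob -!big_split mulr_sumr; apply: eq_bigr => i _ /=.
by rewrite -!big_split mulr_sumr; apply: eq_bigr => j _ /=; rewrite !mxE; field.
Qed.

Lemma frob_orth n (s r X : 'M[R]_n) : s^T *m s = 1%:M -> r^T *m r = 1%:M ->
  frob (s *m X *m r^T) = frob X.
Proof.
move=> hs hr; rewrite !frob_tr !trmx_mul trmxK -!mulmxA [r^T *m _]mulmxA hr mul1mx.
by rewrite mxtrace_mulC -!mulmxA hs mulmx1.
Qed.

Lemma orth_entry n (r : 'M[R]_n) i j : r^T *m r = 1%:M -> `|r i j| <= 1.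
Proof.
move=> /matrixP /(_ j j); rewrite !mxE eqxx => e.
have : r i j ^+ 2 <= 1.
  rewrite -[leRHS]e (bigD1 i)//= mxE -expr2 lerDl.
  by apply: sumr_ge0 => k _; rewrite mxE -expr2 sqr_ge0.
by rewrite -(@ler_sqr R `|_| 1) ?nnegrE// expr1n real_normK// num_real.
Qed.

(** A row vector killed by [A] is fixed by [1%:M - A], which multiplies norms by at most
    [e * n%:R < 1]. *)
Lemma near1_unitmx n (A : 'M[R]_n) (e : R) : e * n%:R < 1 ->
  (forall i j, `|A i j - (1%:M : 'M[R]_n) i j| <= e) -> A \in unitmx.
Proof.
move=> en hA; rewrite -row_free_unit -kermx_eq0; apply/eqP/row_matrixP => i0.
rewrite row0; set v := row i0 _.
have vA : v *m A = 0 by apply/sub_kermxP; exact: row_sub.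
have ev : v = v *m (1%:M - A) by rewrite mulmxBr vA mulmx1 subr0.
have e0 : 0 <= e := le_trans (normr_ge0 _) (hA i0 i0).
have h : `|v| <= `|v| * (e * n%:R).
  have vn0 := normr_ge0 v.
  rewrite {1}ev; apply: mx_norm_le; first by rewrite !mulr_ge0.
  move=> i j; rewrite {i}ord1 mxE; apply: le_trans (ler_norm_sum _ _ _) _.
  have -> : `|v| * (e * n%:R) = \sum_(k < n) `|v| * e.
    by rewrite sumr_const card_ord -[RHS]mulr_natr mulrA.
  apply: ler_sum => k _; rewrite normrM; apply: ler_pM => //; first exact: mx_entry_le.
  by rewrite !mxE distrC; have := hA k j; rewrite mxE.
apply/eqP; rewrite -normr_le0.
have : `|v| * (1 - e * n%:R) <= 0 by lra.
by rewrite pmulr_lle0// subr_gt0.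
Qed.

Lemma matrix_box_compact n (A : 'M[R]_n) (e : R) :
  compact [set X : 'M[R]_n | forall i j, `|X i j - A i j| <= e].
Proof.
pose B := [set u : 'rV[R]_(n * n) | forall i, `|u 0 i - mxvec A 0 i| <= e].
have -> : [set X : 'M[R]_n | forall i j, `|X i j - A i j| <= e] = vec_mx @` B.
  apply/seteqP; split=> [X hX|_ [u hu <-] i j].
    exists (mxvec X); last exact: mxvecK.
    by move=> i; case/mxvec_indexP: i => i j; rewrite !mxvecE; exact: hX.
  by have := hu (mxvec_index i j); rewrite mxvecE mxE.
apply: continuous_compact.
  apply: continuous_subspaceT => u; apply: continuous_mx => i j.
  have -> : (fun t : 'rV[R]_(n * n) => vec_mx t i j) = fun t => t 0 (mxvec_index i j).
    by apply/funext => t; rewrite mxE.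
  exact: entry_cont.
apply: bounded_closed_compact.
  exists (`|mxvec A| + `|e|); split; first exact: num_real.
  move=> M hM u hu; apply: le_trans (ltW hM); apply: mx_norm_le; first exact: addr_ge0.
  move=> i j; rewrite {i}ord1; have := hu j; have := mx_entry_le (mxvec A) 0 j.
  have := ler_norm e; have := ler_normD (u 0 j - mxvec A 0 j) (mxvec A 0 j); rewrite subrK; lra.
have -> : B = \bigcap_(i in setT) [set u | `|u 0 i - mxvec A 0 i| <= e].
  by apply/seteqP; split=> [u hu i _|u hu i]; [exact: hu|exact: (hu i I)].
apply: closed_bigI => i _.
apply: (@closed_comp _ _ (fun u : 'rV[R]_(n*n) => `|u 0 i - mxvec A 0 i|) [set x : R | x <= e]).
  move=> u _; have c1 : {for u, continuous (fun u : 'rV[R]_(n * n) => u 0 i - mxvec A 0 i)}.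
    by apply: continuousB; [exact: entry_cont|exact: cst_continuous].
  exact: (continuous_comp c1 (@norm_continuous R R _)).
exact: closed_le.
Qed.

End MatrixAnalysis.

Lemma orth_close_intertwiner (R : realType) (K : Type) n (s r : K -> 'M[R]_n) (e : R) :
  (forall k, (s k)^T *m s k = 1%:M) -> (forall k, (r k)^T *m r k = 1%:M) ->
  (forall k1 k2, exists k3, s k3 = s k1 *m s k2 /\ r k3 = r k1 *m r k2) ->
  K ->
  (forall k i j, `|(s k *m (r k)^T) i j - (1%:M : 'M[R]_n) i j| <= e) ->
  exists A : 'M[R]_n, (forall i j, `|A i j - (1%:M : 'M[R]_n) i j| <= e) /\
    forall k, s k *m A = A *m r k.
Proof.
(* The point of least Frobenius norm in the closed convex hull of the
   [s k *m (r k)^T] is fixed by all maps [X |-> s k *m X *m (r k)^T]. *)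
move=> os or_ mul k0 close.
pose gen k := s k *m (r k)^T.
(* For closed sets, stability under midpoints amounts to convexity. *)
pose hull_set (D : set 'M[R]_n) := [/\ closed D,
  forall X Y, D X -> D Y -> D (2^-1 *: (X + Y)) & forall k, D (gen k)].
pose C X := forall D, hull_set D -> D X.
have Cgen k : C (gen k) by move=> D [_ _]; exact.
have Cmid X Y : C X -> C Y -> C (2^-1 *: (X + Y)).
  by move=> CX CY D hD; have [_ mid _] := hD; apply: mid; [exact: CX|exact: CY].
(* The box is one of these sets, so the hull is compact and the fixed point inherits the distance
   [e] to the identity. *)
pose box := [set X : 'M[R]_n | forall i j, `|X i j - (1%:M : 'M[R]_n) i j| <= e].
have cbox : compact box by exact: matrix_box_compact.
have Hbox : hull_set box.
  split=> //; first exact: compact_closed (@norm_hausdorff _ _) cbox.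
  move=> X Y bX bY i j; have := bX i j; have := bY i j.
  rewrite (_ : (2^-1 *: (X + Y)) i j - (1%:M : 'M[R]_n) i j =
     2^-1 * ((X i j - (1%:M : 'M[R]_n) i j) + (Y i j - (1%:M : 'M[R]_n) i j))); last by rewrite !mxE; field.
  move: (X i j - _) (Y i j - _) => x y hy hx; rewrite normrM [X in X * _]ger0_norm; last lra.
  by have := ler_normD x y; lra.
have Cbox : C `<=` box by move=> X CX; exact: CX.
have Ccl : closed C.
  move=> X clX D hD; have [cD _ _] := hD; apply: cD.
  by apply: closureS clX => Y CY; exact: CY.
have cC : compact C := subclosed_compact Ccl cbox Cbox.
pose T k X := s k *m X *m (r k)^T.
have CT k X : C X -> C (T k X).
  move=> CX D [cD mid gD].
  (* The preimage of [D] under [T k] is again closed and convex, and it contains the generators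
     because [T k] sends the generator of [k'] to that of the product. *)
  apply: (CX (T k @^-1` D)); split=> [|Y Z DY DZ|k'].
  - by apply: closed_comp cD => ? _; exact: mulmx_sandwich_cont.
  - rewrite /= /T -scalemxAr -scalemxAl mulmxDr mulmxDl; exact: mid.
  - have [k3 [s3 r3]] := mul k k'.
    by rewrite /= /T /gen (_ : _ *m _ = gen k3)// /gen s3 r3 trmx_mul !mulmxA.
have [|||A /set_mem CA minA_] := @compact_EVT_min _ R (@frob R n n) C.
- by exists (gen k0); exact: Cgen.
- exact: cC.
- by apply: continuous_subspaceT; exact: frob_cont.
have minA X : C X -> frob A <= frob X by move=> /mem_set; exact: minA_.
exists A; split; first exact: Cbox.
(* [T k A] has the same norm as [A], and their midpoint has no smaller one; the parallelogram law
   leaves nothing for the difference. *)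
move=> k; have := frob_midpoint (T k A) A.
rewrite frob_orth//.
have := minA _ (Cmid _ _ (CT k _ CA) CA).
have := frob_ge0 (2^-1 *: (T k A - A)) => h1 h2 h3.
have /frob_eq0/eqP : frob (2^-1 *: (T k A - A)) = 0 by lra.
rewrite scaler_eq0 invr_eq0 pnatr_eq0/= subr_eq0 => /eqP e1.
by rewrite -{2}e1 /T -!mulmxA or_ mulmx1.
Qed.

(** The threshold depends on the size [n] only, so continuity alone yields equivalence of nearby
    members of a family. *)
Lemma orth_close_similar (R : realType) n : exists2 e : R, 0 < e &
  forall (K : Type) (s r : K -> 'M[R]_n),
  (forall k, (s k)^T *m s k = 1%:M) -> (forall k, (r k)^T *m r k = 1%:M) ->
  (forall k1 k2, exists k3, s k3 = s k1 *m s k2 /\ r k3 = r k1 *m r k2) ->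
  (forall k i j, `|s k i j - r k i j| <= e) ->
  exists2 A : 'M[R]_n, A \in unitmx & forall k, s k *m A = A *m r k.
Proof.
(* The entries of [s k *m (r k)^T - 1%:M] are sums of [n] terms of at most this size, hence at most
   [n.+1%:R^-1], and [n] times that is below 1, as [near1_unitmx] demands. *)
exists (n.+1%:R^-1 ^+ 2); first by rewrite exprn_gt0// invr_gt0.
move=> K s r os or_ mul close.
have [[k0]|nK] := pselect (inhabited K); last first.
  by exists 1%:M; [exact: unitmx1|move=> k; case: nK].
have n1 : (n.+1%:R^-1 * n%:R : R) < 1.
  by rewrite mulrC ltr_pdivrMr// mul1r ltr_nat.
have [|A [hA HA]] := @orth_close_intertwiner R K n s r n.+1%:R^-1 os or_ mul k0.
  move=> k i j.
  have e1 : r k *m (r k)^T = 1%:M by apply: mulmx1C.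
  have -> : (s k *m (r k)^T) i j - (1%:M : 'M[R]_n) i j =
      \sum_l (s k i l - r k i l) * r k j l.
    transitivity (((s k - r k) *m (r k)^T) i j); first by rewrite mulmxBl e1 !mxE.
    by rewrite mxE; apply: eq_bigr => l _; rewrite !mxE.
  apply: le_trans (ler_norm_sum _ _ _) _.
  apply: (@le_trans _ _ (\sum_(l < n) n.+1%:R^-1 ^+ 2)).
    apply: ler_sum => l _; rewrite normrM -[leRHS]mulr1.
    by apply: ler_pM => //; exact: orth_entry.
  rewrite sumr_const card_ord -[leLHS]mulr_natr expr2 -mulrA -[leRHS]mulr1.
  by apply: ler_wpM2l; [rewrite invr_ge0|exact: ltW].
by exists A => //; exact: near1_unitmx hA.
Qed.

(** * From similarity to unitary equivalence *)

Section UnitaryEquivalence.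
Variable C : numClosedFieldType.
Local Open Scope sesquilinear_scope.

Lemma adjointM m n p (A : 'M[C]_(m, n)) (B : 'M[C]_(n, p)) :
  (A *m B)^t* = B^t* *m A^t*.
Proof. by rewrite trmx_mul map_mxM. Qed.

(** A matrix commuting with a diagonal one has no entries between distinct eigenvalues, so it
    commutes with every function of that diagonal. *)
Lemma diag_mx_comm n (d e : 'rV[C]_n) (X : 'M[C]_n) :
  (forall i j, d 0 i = d 0 j -> e 0 i = e 0 j) ->
  X *m diag_mx d = diag_mx d *m X -> X *m diag_mx e = diag_mx e *m X.
Proof.
move=> de /matrixP H; apply/matrixP => i j; have := H i j.
rewrite !mul_mx_diag !mul_diag_mx !mxE => h.
have [dij|dij] := eqVneq (d 0 i) (d 0 j); first by rewrite (de _ _ dij) mulrC.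
have /eqP : X i j * (d 0 j - d 0 i) = 0 by rewrite mulrBr h mulrC subrr.
by rewrite mulf_eq0 subr_eq0 [d 0 j == _]eq_sym (negbTE dij) orbF => /eqP ->; rewrite mul0r mulr0.
Qed.

(** Polar decomposition: [H = A^t* *m A] commutes with every [r k] because both families are
    unitary. [B] is the inverse square root of [H], formed by diagonalization; it commutes with
    [r k] too, and [A *m B] is unitary. *)
Lemma similar_unitary_families (K : Type) n (s r : K -> 'M[C]_n) (A : 'M[C]_n) :
  (forall k, s k \is unitarymx) -> (forall k, r k \is unitarymx) ->
  A \in unitmx -> (forall k, s k *m A = A *m r k) ->
  exists2 u : 'M[C]_n, u \is unitarymx & forall k, s k *m u = u *m r k.
Proof.
move=> us ur Au sA; have [H HH] : exists H, H = A^t* *m A by exists (A^t* *m A).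
have unitl (X : 'M[C]_n) : X \is unitarymx -> X^t* *m X = 1%:M.
  by move=> /unitarymxP; exact: mulmx1C.
have rH k : r k *m H = H *m r k.
  have e : H = (r k)^t* *m H *m r k.
    have <- : (A *m r k)^t* *m (A *m r k) = (r k)^t* *m H *m r k by rewrite HH adjointM !mulmxA.
    by rewrite -sA adjointM -mulmxA [(s k)^t* *m _]mulmxA unitl// mul1mx HH.
  by rewrite {1}e !mulmxA (unitarymxP (ur k)) mul1mx.
have Hn : H \is normalmx.
  by apply/normalmxP; rewrite HH adjointM trmxCK.
have /orthomx_spectralP := Hn; set P := spectralmx H; set d := spectral_diag H => HE.
have Pu : P \is unitarymx := spectral_unitarymx H.
have Pl := unitl _ Pu; have Pr := unitarymxP Pu.
rewrite invmx_unitary// in HE.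
have dE : diag_mx d = (A *m P^t*)^t* *m (A *m P^t*).
  by rewrite adjointM trmxCK -mulmxA [A^t* *m _]mulmxA -HH HE -!mulmxA Pr mulmx1 mulmxA Pr mul1mx.
have d_gt0 i : 0 < d 0 i.
  have dn0 : d 0 i != 0.
    have : diag_mx d \in unitmx.
      have e : P *m H *m P^t* = diag_mx d by rewrite HE !mulmxA Pr mul1mx -mulmxA Pr mulmx1.
      have Hu : H \in unitmx by rewrite HH unitmx_mul Au andbT map_unitmx unitmx_tr.
      by rewrite -e !unitmx_mul Hu (unitarymx_unit Pu) unitarymx_unit// trmxC_unitary.
    by rewrite unitmxE det_diag unitfE => /prodf_neq0/(_ i isT).
  rewrite lt0r dn0/=; have -> : d 0 i = diag_mx d i i by rewrite mxE eqxx mulr1n.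
  rewrite dE mxE; apply: sumr_ge0 => k _; rewrite !mxE mulrC; exact: mul_conjC_ge0.
pose e : 'rV[C]_n := \row_i (sqrtC (d 0 i))^-1.
have e_conj : (diag_mx e)^t* = diag_mx e.
  apply/matrixP => i j; rewrite !mxE eq_sym; case: eqP => [->|_]; last by rewrite !mulr0n rmorph0.
  by rewrite !mulr1n conj_Creal// realV ger0_real// sqrtC_ge0 ltW.
pose B := P^t* *m diag_mx e *m P.
have Bc : B^t* = B by rewrite /B !adjointM trmxCK e_conj mulmxA.
have rB k : r k *m B = B *m r k.
  have c1 : (P *m r k *m P^t*) *m diag_mx e = diag_mx e *m (P *m r k *m P^t*).
    apply: (@diag_mx_comm _ d) => [i j dij|]; first by rewrite !mxE dij.
    have e1 : diag_mx d = P *m H *m P^t* by rewrite HE !mulmxA Pr mul1mx -mulmxA Pr mulmx1.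
    rewrite e1 -!mulmxA [P^t* *m (P *m _)]mulmxA Pl mul1mx.
    by rewrite [P^t* *m (P *m _)]mulmxA Pl mul1mx [r k *m _]mulmxA rH -[H *m r k *m _]mulmxA.
  have : P^t* *m (P *m r k *m P^t* *m diag_mx e) *m P = P^t* *m (diag_mx e *m (P *m r k *m P^t*)) *m P by rewrite c1.
  by rewrite !mulmxA Pl mul1mx -!mulmxA Pl mulmx1 /B !mulmxA.
exists (A *m B); last by move=> k; rewrite mulmxA sA -mulmxA rB mulmxA.
apply/unitarymxP; apply: mulmx1C.
rewrite adjointM Bc -mulmxA [A^t* *m _]mulmxA -HH /B HE.
rewrite !mulmxA -[P^t* *m _ *m _ *m P^t*]mulmxA Pr mulmx1.
rewrite -[_ *m P *m P^t*]mulmxA Pr mulmx1.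
have -> : P^t* *m diag_mx e *m diag_mx d *m diag_mx e *m P = P^t* *m (diag_mx e *m diag_mx d *m diag_mx e) *m P by rewrite !mulmxA.
rewrite (_ : _ *m diag_mx d *m _ = 1%:M) ?mulmx1//.
rewrite !mulmx_diag; apply/matrixP => i j; rewrite !mxE; case: eqP => // ->.
have s0 : sqrtC (d 0 j) != 0 by rewrite sqrtC_eq0 gt_eqF.
by rewrite !mulr1n -{2}[d 0 j]sqrtCK expr2; field.
Qed.

End UnitaryEquivalence.

Lemma real_complex_unitary (R : realType) n (s : 'M[R]_n) :
  s^T *m s = 1%:M -> map_mx (real_complex R) s \is unitarymx.
Proof.
move=> /mulmx1C hs; apply/unitarymxP.
rewrite (_ : map_mx _ (_ ^T) = map_mx (real_complex R) s^T).
  by rewrite -map_mxM hs map_mx1.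
apply/matrixP => i j; rewrite !mxE; apply/eqP; rewrite eq_complex /= oppr0 !eqxx.
done.
Qed.

Lemma similar_unitary (R : realType) (K : Type) n (s r : K -> 'M[R]_n) (A : 'M[R]_n) :
  (forall k, (s k)^T *m s k = 1%:M) -> (forall k, (r k)^T *m r k = 1%:M) ->
  A \in unitmx -> (forall k, s k *m A = A *m r k) ->
  exists2 u : 'M[R[i]]_n, u \is unitarymx &
    forall k, map_mx (real_complex R) (s k) = u *m map_mx (real_complex R) (r k) *m invmx u.
Proof.
move=> os or_ Au sA.
have [||||u uu H] := @similar_unitary_families R[i] K n (fun k => map_mx (real_complex R) (s k))
  (fun k => map_mx (real_complex R) (r k)) (map_mx (real_complex R) A).
- by move=> k; exact: real_complex_unitary.
- by move=> k; exact: real_complex_unitary.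
- by rewrite map_unitmx.
- by move=> k; rewrite -!map_mxM sA.
exists u => // k; rewrite -H mulmxK//; exact: unitarymx_unit.
Qed.

(** * Transport of isotropy through principal bundles *)

Lemma continuous_within_comp (X Y Z : topologicalType) (A : set Y) (f : Y -> Z)
    (g : X -> Y) (x : X) :
  {within A, continuous f} -> {for x, continuous g} ->
  (\forall y \near x, A (g y)) -> {for x, continuous (f \o g)}.
Proof.
move=> /subspace_continuousP cf cg nA.
move=> U /= nU; have fU := cf _ (nbhs_singleton nA) U nU.
by apply: filterS2 nA (cg _ fU) => y Ay; exact.
Qed.

Lemma hausdorff_set_type (T : topologicalType) (A : set T) :
  hausdorff_space T -> hausdorff_space (set_type A).
Proof.
move=> hT p q pq; apply: val_inj; apply: hT => U V nU nV.
have [x [/= Ux Vx]] := pq (set_val @^-1` U) (set_val @^-1` V)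
  (@initial_continuous _ _ set_val p _ nU) (@initial_continuous _ _ set_val q _ nV).
by exists (set_val x).
Qed.

Lemma evaluation_continuous (X Y Z : topologicalType)
    (f : Y -> {compact-open, X -> Z}) (x : X) (y : Y) :
  hausdorff_space X -> compact [set: X] -> {for y, continuous f} ->
  continuous (f y : X -> Z) ->
  {for (x, y), continuous (fun p : X * Y => f p.2 p.1)}.
Proof.
move=> hX cX cf cfy U /= nU.
have [V [oV Vx] VU] : exists2 V, open_nbhs (f y x) V & V `<=` U by move: nU; rewrite nbhsE.
have nV : nbhs x (f y @^-1` V) by apply: cfy; exact: open_nbhs_nbhs.
have [W nW WV] := compact_regular hX cX filterT nV.
have cW : compact (closure W).
  by apply: subclosed_compact cX _ => //; exact: closed_closure.
have nf : nbhs (f y) [set g : {compact-open, X -> Z} | g @` closure W `<=` V].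
  apply: open_nbhs_nbhs; split; first exact: compact_open_open.
  by move=> _ [w Ww <-]; exact: WV.
exists (W, f @^-1` [set g : {compact-open, X -> Z} | g @` closure W `<=` V]).
  by split => //; exact: cf.
move=> [x' y'] /= [Wx' fy']; apply: VU; apply: fy'; exists x' => //; exact: subset_closure.
Qed.

Lemma unit_interval_connected (R : realType) : connected [set: unit_interval R].
Proof.
have clamp01 (x : R) : Num.min 1 (Num.max 0 x) \in (`[0, 1]%classic : set R).
  by rewrite inE /= in_itv /= ge_min lexx le_min ler01 le_max lexx.
pose clamp x : unit_interval R := exist (fun y : R => y \in (`[0, 1]%classic : set R)) _ (clamp01 x).
have <- : clamp @` [set: R] = [set: unit_interval R].
  apply/seteqP; split=> // -[x x01] _; exists x => //; apply: val_inj => /=.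
  move: x01; rewrite inE /= in_itv /= => /andP[x0 x1].
  by rewrite (max_idPr x0) (min_idPr x1).
apply: connected_continuous_connected.
  by apply/connected_intervalP => x y _ _ z _.
have clamp_cont : continuous ((cst 1 : R -> R^o) \min ((cst 0 : R -> R^o) \max id)).
  move=> x; apply: (@continuous_min R R^o); first exact: cst_continuous.
  by apply: (@continuous_max R R^o); [exact: cst_continuous|exact: cvg_id].
by apply: continuous_subspaceT; apply: continuous_comp_initial; exact: clamp_cont.
Qed.

Lemma division_ex (Ob Ar H0 H1 TQ : topologicalType) (G : groupoid Ob Ar)
    (H : groupoid H0 H1) (Q : bibundle Ob Ar H0 H1 TQ) :
  principal_bundle G H Q -> exists d : TQ * TQ -> H1,
  [/\ forall q q', proj Q q = proj Q q' ->
        moment Q q = tgt H (d (q, q')) /\ ract Q q (d (q, q')) = q',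
      forall q h, moment Q q = tgt H h -> d (q, ract Q q h) = h &
      {within [set z | proj Q z.1 = proj Q z.2], continuous d}].
Proof.
move=> [_ [_ [_ [_ [_ [_ [_ [f [fA fc fl fr]]]]]]]]].
exists (fun z => (f z).2); split.
- move=> q q' e; have /= := fr (q, q') e; have /= := fA (q, q') e.
  by case: (f (q, q')) => q1 h /= e1 [e2 e3]; rewrite -e2 in e1 e3 *.
- by move=> q h e; have /= -> := fl (q, h) e.
- move=> z; apply: (@continuous_comp (subspace _) _ _ f snd); first exact: fc.
  exact: cvg_snd.
Qed.

(** * Representations of isotropy arrows through a bibundle *)

Section Division.
Variables (Ob Ar H0 H1 TQ : topologicalType).
Variables (G : groupoid Ob Ar) (H : groupoid H0 H1) (Q : bibundle Ob Ar H0 H1 TQ).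
Hypotheses (gG : is_groupoid G) (gH : is_groupoid H) (pQ : principal_bundle G H Q).

Variable d : TQ * TQ -> H1.
Hypothesis dP : forall q q', proj Q q = proj Q q' ->
  moment Q q = tgt H (d (q, q')) /\ ract Q q (d (q, q')) = q'.
Hypothesis dE : forall q h, moment Q q = tgt H h -> d (q, ract Q q h) = h.
Hypothesis dC : {within [set z | proj Q z.1 = proj Q z.2], continuous d}.

(* The arrow of [H] corresponding to the loop [g] at [proj Q q]. *)
Definition twist q g := d (q, lact Q g q).

Let lactP g q : src G g = proj Q q -> 
  proj Q (lact Q g q) = tgt G g /\ moment Q (lact Q g q) = moment Q q.
Proof. by case: pQ => [_ [[h _ _] _]] /h. Qed.
Let ractP q h : moment Q q = tgt H h ->
  moment Q (ract Q q h) = src H h /\ proj Q (ract Q q h) = proj Q q.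
Proof. by case: pQ => [_ [_ [[hm _ _] _]]]; exact: hm. Qed.
Let lactM g g' q : src G g = tgt G g' -> src G g' = proj Q q ->
  lact Q (mul G g g') q = lact Q g (lact Q g' q).
Proof. by case: pQ => [_ [[_ _ hm] _]]; exact: hm. Qed.
Let ractM q h h' : moment Q q = tgt H h -> src H h = tgt H h' ->
  ract Q q (mul H h h') = ract Q (ract Q q h) h'.
Proof. by case: pQ => [_ [_ [[_ _ hM] _]]]; exact: hM. Qed.
Let lractC g q h : src G g = proj Q q -> moment Q q = tgt H h ->
  lact Q g (ract Q q h) = ract Q (lact Q g q) h.
Proof. by case: pQ => [_ [_ [_ [hm _]]]]; exact: hm. Qed.
Let tgtM h h' : src H h = tgt H h' -> tgt H (mul H h h') = tgt H h.
Proof. by case: gH => _ [h1 _] /h1 []. Qed.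

Lemma twistP q g : src G g = proj Q q -> tgt G g = proj Q q ->
  [/\ moment Q q = tgt H (twist q g), moment Q q = src H (twist q g) &
      ract Q q (twist q g) = lact Q g q].
Proof.
move=> sg tg; have [p1 m1] := lactP sg.
have [e1 e2] := dP (q := q) (q' := lact Q g q) (etrans (esym tg) (esym p1)).
by split => //; have [<- _] := ractP e1; rewrite e2 m1.
Qed.

Lemma twistE q g h : moment Q q = tgt H h -> ract Q q h = lact Q g q -> twist q g = h.
Proof. by move=> mq e; rewrite /twist -e dE. Qed.

Lemma twist_mul q g g' : isotropy G (proj Q q) g -> isotropy G (proj Q q) g' ->
  twist q (mul G g g') = mul H (twist q g) (twist q g').
Proof.
move=> [sg tg] [sg' tg']; have [a1 a2 a3] := twistP sg tg; have [b1 b2 b3] := twistP sg' tg'.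
have e : src H (twist q g) = tgt H (twist q g') by rewrite -a2.
apply: twistE; first by rewrite tgtM.
by rewrite ractM// a3 -lractC// b3 lactM// tg'.
Qed.

Lemma twist_ract q h g : isotropy G (proj Q q) g -> moment Q q = tgt H h ->
  mul H h (twist (ract Q q h) g) = mul H (twist q g) h.
Proof.
move=> [sg tg] mq; have [a1 a2 a3] := twistP sg tg; have [m1 p1] := ractP mq.
have [||b1 b2 b3] := @twistP (ract Q q h) g; rewrite ?p1//.
have e1 : src H h = tgt H (twist (ract Q q h) g) by rewrite -b1 m1.
have e2 : src H (twist q g) = tgt H h by rewrite -a2.
rewrite -[LHS](dE (q := q)) ?tgtM//.
by rewrite ractM// b3 lractC// -a3 -ractM// dE// tgtM.
Qed.

Lemma twist_lact q g g' g0 : src G g0 = proj Q q -> isotropy G (tgt G g0) g ->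
  isotropy G (proj Q q) g' -> mul G g0 g' = mul G g g0 ->
  twist (lact Q g0 q) g = twist q g'.
Proof.
move=> s0 [sg tg] [sg' tg'] e; have [a1 a2 a3] := twistP sg' tg'.
have [p1 m1] := lactP s0; apply: twistE; first by rewrite m1.
by rewrite -lractC// a3 -lactM// ?tg'// e lactM.
Qed.

Variables (R : realType) (n : nat) (c : H1 -> 'M[R]_n).
Hypothesis c_orth : forall h, (c h)^T *m c h = 1%:M.
Hypothesis c_mul : forall h h', src H h = tgt H h' -> c (mul H h h') = c h *m c h'.
Hypothesis c_cont : forall i j, continuous (fun h => c h i j).

Lemma c_unit h : c h \in unitmx.
Proof. by have /mulmx1_unit [_] := c_orth h. Qed.

(** The points [q] and [g q'] lie in one fibre of [proj Q], and the image under [c] of the arrow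
    between them intertwines. *)
Lemma twist_similar (K : Type) (x x' : K -> Ar) q q' g :
  src G g = proj Q q' -> tgt G g = proj Q q ->
  (forall k, isotropy G (proj Q q) (x k)) -> (forall k, isotropy G (proj Q q') (x' k)) ->
  (forall k, mul G g (x' k) = mul G (x k) g) ->
  exists2 A : 'M[R]_n, A \in unitmx &
    forall k, c (twist q (x k)) *m A = A *m c (twist q' (x' k)).
Proof.
move=> sg tg ix ix' e; have [p1 m1] := lactP sg.
have [e1 e2] := dP (q := q) (q' := lact Q g q') (etrans (esym tg) (esym p1)).
move: (d _) e1 e2 => h0 e1 e2.
exists (c h0); first exact: c_unit.
move=> k; have [sx tx] := ix k; have [a1 a2 a3] := twistP sx tx.
have ixg : isotropy G (tgt G g) (x k) by rewrite tg; exact: ix.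
rewrite -(twist_lact sg ixg (ix' k) (e k)) -e2 -!c_mul.
- by rewrite twist_ract.
- have [m2 p2] := ractP e1; rewrite e2 in m2 p2 *.
  by have [||b1 b2 b3] := @twistP (lact Q g q') (x k); rewrite ?p2// -b1.
- by rewrite -a2.
Qed.

(** Compactness of [K] makes the matrices at [t] and at [t0] close uniformly in [k], and
    [orth_close_similar] applies. *)
Lemma twist_locally_similar (X K : topologicalType) (x : X -> K -> Ar) (q : X -> TQ) (t0 : X) :
  compact [set: K] ->
  (forall k, {for (k, t0), continuous (fun p : K * X => x p.2 p.1)}) ->
  {for t0, continuous q} ->
  (\forall t \near t0, forall k, isotropy G (proj Q (q t)) (x t k)) ->
  (forall k1 k2, exists k3, forall t, x t k3 = mul G (x t k1) (x t k2)) ->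
  \forall t \near t0, exists2 A : 'M[R]_n, A \in unitmx &
    forall k, c (twist (q t) (x t k)) *m A = A *m c (twist (q t0) (x t0 k)).
Proof.
move=> cK xc qc iso xM.
have [e e0 He] := orth_close_similar R n.
have [_ _ lc _] := pQ.1.
have iso0 := nbhs_singleton iso.
have near_snd (S : set X) (k : K) : nbhs t0 S -> \forall p \near (k, t0), S p.2.
  by move=> nS; apply: (@cvg_snd _ _ (nbhs k) (nbhs t0)).
have F_cont ij k : {for (k, t0), continuous (fun p : K * X => c (twist (q p.2) (x p.2 p.1)) ij.1 ij.2)}.
  have cq : {for (k, t0), continuous (fun p : K * X => q p.2)}.
    by apply: (@continuous_comp _ _ _ snd q); [exact: cvg_snd|].
  have cl : {for (k, t0), continuous (fun p : K * X => lact Q (x p.2 p.1) (q p.2))}.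
    apply: (@continuous_within_comp _ _ _ _ _ (fun p : K * X => (x p.2 p.1, q p.2)) _ lc).
      by apply: cvg_pair; [exact: xc|exact: cq].
    by apply: filterS (near_snd _ k iso) => p /= ip; have [] := ip p.1.
  have cd : {for (k, t0), continuous (fun p : K * X => twist (q p.2) (x p.2 p.1))}.
    apply: (@continuous_within_comp _ _ _ _ _ (fun p : K * X => (q p.2, lact Q (x p.2 p.1) (q p.2))) _ dC).
      by apply: cvg_pair; [exact: cq|exact: cl].
    apply: filterS (near_snd _ k iso) => p /= ip; have [sp tp] := ip p.1.
    by have [-> _] := lactP sp.
  by apply: (@continuous_comp _ _ _ (fun p : K * X => twist (q p.2) (x p.2 p.1))
    (fun h => c h ij.1 ij.2)); [exact: cd|exact: c_cont].
have nF : \forall t \near t0, forall ij : 'I_n * 'I_n, forall k,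
    `|c (twist (q t) (x t k)) ij.1 ij.2 - c (twist (q t0) (x t0 k)) ij.1 ij.2| < e.
  apply: filter_forall => ij.
  exact: (@tube_at R K X (fun k t => c (twist (q t) (x t k)) ij.1 ij.2) t0 cK (F_cont ij) e e0).
apply: filterS2 iso nF => t it Ft.
apply: He => [k|k|k1 k2|k i j]; [exact: c_orth|exact: c_orth| |exact/ltW/(Ft (i, j))].
have [k3 e3] := xM k1 k2; exists k3; rewrite !e3 !twist_mul//.
by rewrite !c_mul//; [have [s1 t1] := iso0 k1|have [s1 t1] := it k1];
  [have [s2 t2] := iso0 k2|have [s2 t2] := it k2];
  have [_ <- _] := twistP s1 t1; have [] := twistP s2 t2.
Qed.

Variables (X K TB : topologicalType) (B : bibundle X X Ob Ar TB).
Variable y : TB -> {compact-open, K -> Ar}.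
Hypotheses (pB : principal_bundle (unit_groupoid X) G B).
Hypotheses (cK : compact [set: K]) (hK : hausdorff_space K).
Hypotheses (y_cont : continuous y) (yb_cont : forall b, continuous (y b : K -> Ar)).
Hypothesis y_iso : forall b k, isotropy G (moment B b) (y b k).
Hypothesis y_equiv : forall b g, moment B b = tgt G g -> forall k,
  y (ract B b g) k = mul G (inv_ar G g) (mul G (y b k) g).
Hypothesis y_mul : forall k1 k2, exists k3, forall b, y b k3 = mul G (y b k1) (y b k2).

Let similar b q b' q' := exists2 A : 'M[R]_n, A \in unitmx &
  forall k, c (twist q (y b k)) *m A = A *m c (twist q' (y b' k)).

Let similar_sym b q b' q' : similar b q b' q' -> similar b' q' b q.
Proof.
move=> [A Au h]; exists (invmx A) => [|k]; first by rewrite unitmx_inv.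
by rewrite -[c _ *m _](mulKmx Au) [A *m (_ *m _)]mulmxA -h -[_ *m A *m _]mulmxA mulmxV// mulmx1.
Qed.

Let similar_trans b q b' q' b'' q'' :
  similar b q b' q' -> similar b' q' b'' q'' -> similar b q b'' q''.
Proof.
move=> [A Au h] [A' Au' h']; exists (A *m A') => [|k]; first by rewrite unitmx_mul Au.
by rewrite mulmxA h -mulmxA h' mulmxA.
Qed.

(** Quantifying over all points above [t] and [t'] makes this a relation between base points, so
    local sections can be chosen afresh near each of them. *)
Let similar_at t t' := forall b b' q q', proj B b = t -> proj B b' = t' ->
  proj Q q = moment B b -> proj Q q' = moment B b' -> similar b q b' q'.

(** Two points of the bundle over [t] differ by an arrow of [G], which by equivariance conjugates
    the values of [y]. *)
Lemma similar_fibre t : similar_at t t.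
Proof.
move=> b b' q q' bt bt' qb qb'.
have [dB [dBP _ _]] := division_ex pB.
have [mb eb] := dBP b b' (etrans bt (esym bt')).
move: (dB _) mb eb => g mb eb.
have [mb' _] : moment B (ract B b g) = src G g /\ proj B (ract B b g) = proj B b.
  by case: pB => [_ [_ [[hm _ _] _]]]; exact: hm.
rewrite eb in mb'.
apply: (@twist_similar K (y b) (y b') q q' g); rewrite ?qb ?qb'//.
move=> k; rewrite -{1}eb y_equiv//.
have [sy ty] := y_iso b k; case: gG => _ [mulP [ass [un inv]]].
have [i1 i2 i3 i4] := inv g; have [s3 t3] := mulP (y b k) g (etrans sy mb).
by rewrite ass ?i3 ?t3 ?ty ?mb// -?mb -?ty -?t3; have [] := un (mul G (y b k) g).
Qed.

(** A section of [B] near [t0], followed by one of [Q], supplies the continuous family;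
    [similar_fibre] passes from these points to arbitrary ones. *)
Lemma similar_near t0 : \forall t \near t0, similar_at t t0.
Proof.
have [_ [_ [_ [_ [secB _]]]]] := pB; have [_ [_ [_ [_ [secQ _]]]]] := pQ.
have [U [tau [oU Ut0 tc tauP]]] := secB t0.
have [V [sg [oV Vx sc sgP]]] := secQ (moment B (tau t0)).
have [[_ mc _ _] _] := pB.
have nU : nbhs t0 U by exact: open_nbhs_nbhs.
have tc0 : {for t0, continuous tau}.
  exact: (@continuous_within_comp _ _ _ _ tau id t0 tc (@cvg_id _ _) nU).
have mtc : {for t0, continuous (moment B \o tau)} by apply: continuous_comp; [|exact: mc].
have nV : \forall t \near t0, V (moment B (tau t)) by apply: mtc; exact: open_nbhs_nbhs.
pose q := sg \o (moment B \o tau).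
have qc : {for t0, continuous q} by exact: continuous_within_comp sc mtc nV.
have iso : \forall t \near t0, forall k, isotropy G (proj Q (q t)) (y (tau t) k).
  by apply: filterS nV => t Vt k; rewrite /q /= sgP//; exact: y_iso.
have jc k : {for (k, t0), continuous (fun p : K * X => y (tau p.2) p.1)}.
  apply: (@evaluation_continuous K X Ar (y \o tau)) => //.
    by apply: (continuous_comp tc0); exact: y_cont.
  exact: yb_cont.
have jm k1 k2 : exists k3, forall t, y (tau t) k3 = mul G (y (tau t) k1) (y (tau t) k2).
  by have [k3 e3] := y_mul k1 k2; exists k3 => t.
have loc := @twist_locally_similar X K (fun t k => y (tau t) k) q t0 cK jc qc iso jm.
apply: filterS3 nU nV loc => t Ut Vt st b b' p p' bt bt' pb pb'.
have e1 : similar b p (tau t) (q t).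
  by apply: (@similar_fibre t); rewrite ?tauP// /q /= sgP.
have e2 : similar (tau t0) (q t0) b' p'.
  by apply: (@similar_fibre t0); rewrite ?tauP// /q /= sgP.
exact: similar_trans e1 (similar_trans st e2).
Qed.

(** The base points equivalent to that of [b] form an open and closed set. *)
Lemma lift_similar b b' q q' : connected [set: X] ->
  proj Q q = moment B b -> proj Q q' = moment B b' ->
  exists2 A : 'M[R]_n, A \in unitmx &
    forall k, c (twist q (y b k)) *m A = A *m c (twist q' (y b' k)).
Proof.
move=> cX qb qb'.
have secB t : exists b0, proj B b0 = t.
  have [_ [_ [_ [_ [secB _]]]]] := pB; have [U [tau [_ Ut _ tauP]]] := secB t.
  by exists (tau t); exact: tauP.
have secQ x : exists q0, proj Q q0 = x.
  have [_ [_ [_ [_ [secQ _]]]]] := pQ; have [U [tau [_ Ut _ tauP]]] := secQ x.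
  by exists (tau x); exact: tauP.
have at_sym t t' : similar_at t t' -> similar_at t' t.
  by move=> h b1 b2 q1 q2 *; apply: similar_sym; exact: h.
have at_trans t t' t'' : similar_at t t' -> similar_at t' t'' -> similar_at t t''.
  move=> h h' b1 b2 q1 q2 e1 e2 f1 f2.
  have [b0 eb0] := secB t'; have [q0 eq0] := secQ (moment B b0).
  by apply: (@similar_trans _ _ b0 q0); [exact: h|exact: h'].
pose S := [set t | similar_at (proj B b) t].
have SX : S = [set: X].
  apply: cX.
  - by exists (proj B b); exact: similar_fibre.
  - exists S; last by rewrite setTI.
    rewrite openE => t St; apply: filterS (similar_near t) => t' tt'.
    exact: at_trans St (at_sym _ _ tt').
  - exists S; last by rewrite setTI.
    move=> t clt; have [t' [St' tt']] := clt _ (similar_near t).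
    exact: at_trans St' tt'.
have : S (proj B b') by rewrite SX.
by apply.
Qed.

End Division.

(** * The representation of the group of ineffective arrows *)

Lemma translation_is_groupoid (R : realType) (L M : charted R) (gL : group_data L)
    (act : L -> M -> M) : compact_group gL -> smooth_left_action gL act ->
  is_groupoid (translation_groupoid gL act).
Proof.
move=> hG [_ act1 actM].
split; first by move=> x; split => //=; exact: act1.
split; first by move=> g g' /= e; split => //; rewrite actM -e.
split; first by move=> g g' g'' /= _ _; rewrite (cgroupA hG).
split; first by case=> g x /=; rewrite (cgroup1l hG) (cgroup1r hG).
case=> g x /=; split => //; last by rewrite (cgroupVl hG).
  by rewrite -actM (cgroupVl hG) act1.
by rewrite (cgroupVr hG).
Qed.

(* Tensoring with [P] turns the left action on [Q] into left multiplication in [G]. *)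
Lemma tensor_unit_free (R : realType) (G0 G1 H0 H1 TP TQ : charted R)
    (G : groupoid G0 G1) (H : groupoid H0 H1) (P : bibundle H0 H1 G0 G1 TP)
    (Q : bibundle G0 G1 H0 H1 TQ) q g g' :
  is_groupoid G -> set_surj [set: TP] [set: H0] (proj P) ->
  tensor_iso G H G Q P (unit_bibundle G) ->
  src G g = proj Q q -> src G g' = proj Q q -> lact Q g q = lact Q g' q -> g = g'.
Proof.
move=> gG surj [phi [_ [_ [_ [h _]]]]] sg sg' e.
have [p _ pq] := surj (moment Q q) I.
have [/= t1 _ l1 _] := h q p (esym pq).
have := congr1 (fun z => phi (z, p)) e; rewrite /= !l1// => /(congr1 (fun x => mul G x (inv_ar G (phi (q, p))))).
have cancel x : src G x = proj Q q -> mul G (mul G x (phi (q, p))) (inv_ar G (phi (q, p))) = x.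
  move=> sx; case: gG => _ [_ [ass [un inv]]]; have [i1 i2 i3 i4] := inv (phi (q, p)).
  by rewrite -ass ?i2 ?t1// i3 t1 -sx; have [] := un x.
by rewrite !cancel.
Qed.

Lemma orth_rep_inj (R : realType) (L : topologicalType) (gL : group_data L) n
    (r : L -> 'M[R]_n) : compact_group gL -> orth_rep gL r ->
  (forall g, r g = 1%:M -> g = gone gL) -> injective r.
Proof.
move=> hG rr faithful g g' e.
have /faithful e1 : r (gmul gL (ginv gL g) g') = 1%:M.
  by have [rM _ _] := rr; rewrite rM -e -rM (cgroupVl hG) (orth_rep1 hG rr).
by rewrite -[LHS](cgroup1r hG) -e1 (cgroupVKl hG).
Qed.

Lemma continuous_pair (X Y Z : topologicalType) (f : X -> Y) (g : X -> Z) x :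
  {for x, continuous f} -> {for x, continuous g} ->
  {for x, continuous (fun t => (f t, g t))}.
Proof. by move=> cf cg; apply: (cvg_pair cf cg). Qed.

Theorem theorem15 (R : realType) (G0 G1 : charted R) (G : groupoid G0 G1)
    (a : G0) (G_lie : lie_groupoid G) (G_connected : connected_groupoid R G)
    (G_proper : proper_groupoid G) (G_regular : regular_groupoid G)
    (G_translation :
       exists (L M : charted R) (gL : group_data L) (act : L -> M -> M),
         [/\ lie_group gL, compact [set: L] & connected [set: L]] /\
         [/\ smooth_manifold M, hausdorff_space M & smooth_left_action gL act] /\
         morita_equivalent G (translation_groupoid gL act)) :
  exists (m : nat) (r : ineff G a -> 'M[R[i]]_m),
    [/\ unitary_representation r, injective r &
        monodromy_image G a `<=` pi0_W r].
Proof.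
have [L [M [gL [act [[lL cL _] [[_ _ actL] [TP [TQ [P [Q [sP sQ tPQ _]]]]]]]]]]] := G_translation.
have hG := lie_compact_group lL cL.
have [n [rho [[rhoM rho_orth rho_cont] rho_faithful]]] := faithful_orth_rep lL cL.
have gG : is_groupoid G by case: G_lie => [[]].
have gH := translation_is_groupoid hG actL.
have [pQ [_ [[_ surjQ _ _ _] _]]] := sQ; have [_ [_ [[_ surjP _ _ _] _]]] := sP.
have [q0 _ q0a] := surjQ a I.
have [d [dP dE dC]] := division_ex pQ.
(* Only the group component of an arrow is represented; it is multiplicative whatever the points of
   [M] are. *)
pose c (h : charted_prod L M) := rho h.1.
have c_orth h : (c h)^T *m c h = 1%:M by exact: rho_orth.
have c_mul h h' : src (translation_groupoid gL act) h = tgt (translation_groupoid gL act) h' ->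
  c (mul (translation_groupoid gL act) h h') = c h *m c h' by move=> _; exact: rhoM.
have c_cont i j : continuous (fun h => c h i j).
  by move=> h; apply: (@continuous_comp _ _ _ fst (fun g => rho g i j)); [exact: cvg_fst|exact: rho_cont].
have iso k : isotropy G (proj Q q0) (ineff_val (k : ineff G a)).
  by rewrite q0a; have [] := set_valP k.
pose r0 (k : ineff G a) := c (twist Q d q0 (ineff_val k)).
have r0_cont i j : continuous (fun k => r0 k i j).
  move=> k; have cv : {for k, continuous (@ineff_val R G0 G1 G a)} by exact: initial_continuous.
  have [_ _ lc _] := pQ.1.
  have cl : {for k, continuous (fun k => lact Q (@ineff_val R G0 G1 G a k) q0)}.
    apply: (@continuous_within_comp _ _ _ _ _ (fun k => (@ineff_val R G0 G1 G a k, q0)) _ lc).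
      by apply: continuous_pair; [exact: cv|exact: cst_continuous].
    by apply: (@filterE _ _ (nbhs_filter k)) => k'; have [] := iso k'.
  apply: (@continuous_comp _ _ _ (fun k => twist Q d q0 (ineff_val k)) (fun h => c h i j)); last exact: c_cont.
  apply: (@continuous_within_comp _ _ _ _ _ (fun k => (q0, lact Q (@ineff_val R G0 G1 G a k) q0)) _ dC).
    by apply: continuous_pair; [exact: cst_continuous|exact: cl].
  apply: (@filterE _ _ (nbhs_filter k)) => k'; have [s1 t1] := iso k'.
  by have [_ [[/(_ _ _ s1)[/= -> _] _ _] _]] := pQ.
exists n, (fun k => map_mx (real_complex R) (r0 k)); split.
- split=> [k|k1 k2 k3 e|i j].
  + by apply: real_complex_unitary; exact: c_orth.
  + rewrite -map_mxM; congr map_mx; rewrite /r0 e (twist_mul gH pQ dP dE)// c_mul//.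
    by have [s1 t1] := iso k1; have [s2 t2] := iso k2;
       have [_ <- _] := twistP pQ dP s1 t1; have [] := twistP pQ dP s2 t2.
  + split.
      rewrite (_ : (fun k => _) = (fun k => r0 k i j)); first exact: r0_cont.
      by apply/funext => k; rewrite mxE.
    rewrite (_ : (fun k => _) = cst 0); first exact: cst_continuous.
    by apply/funext => k; rewrite mxE.
- move=> k k' /map_mx_inj e.
  have [s1 t1] := iso k; have [s2 t2] := iso k'.
  have [a1 a2 a3] := twistP pQ dP s1 t1; have [b1 b2 b3] := twistP pQ dP s2 t2.
  (* Faithfulness of [rho] recovers the group component, and the point of [M] is the source of the
     arrow, namely the moment of [q0]. Then both loops move [q0] alike, and the left action is
     free. *)
  have e1 : (twist Q d q0 (ineff_val k)).1 = (twist Q d q0 (ineff_val k')).1.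
    apply: (orth_rep_inj hG _ rho_faithful) e; by split.
  have e2 : twist Q d q0 (ineff_val k) = twist Q d q0 (ineff_val k').
    by rewrite [LHS]surjective_pairing [RHS]surjective_pairing e1 -[X in (_, X)]a2 -[X in _ = (_, X)]b2.
  apply: val_inj; apply: (tensor_unit_free gG surjP tPQ s1 s2).
  by rewrite -a3 e2 b3.
- move=> A [C [B0 _ CB] [B [ebar [alpha [/CB [mB _] [eb_cont eb_hom eb_eq eb0] al e1 ->]]]]].
  have [pB mS _] := mB.
  have [_ hausG1 _] := G_proper.
  have cK : compact [set: ineff G a] by apply: compact_set_type; exact: ineffective_compact.
  have hK : hausdorff_space (ineff G a) by exact: hausdorff_set_type.
  have ebc b : continuous (ebar b : ineff G a -> G1) by have [] := eb_hom b.
  have ebi b k : isotropy G (moment B b) (ebar b k) by have [] := eb_hom b.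
  (* One [k3] serves at every point of the bundle: it is the product in K, and all values of the
     lift are homomorphisms. *)
  have eb_mul k1 k2 : exists k3, forall b, ebar b k3 = mul G (ebar b k1) (ebar b k2).
    have K3 : ineffective G a (mul G (ineff_val k1) (ineff_val k2)).
      by apply: ineffective_mul => //; exact: set_valP.
    exists (exist (fun g => g \in ineffective G a) _ (mem_set K3)) => b; have [_ _] := eb_hom b; exact.
  have [_ m0] := mS (i0 R) (or_introl erefl); have [_ m1] := mS (i1 R) (or_intror erefl).
  (* Both marked points have moment [a], so the same [q0] is used at the two ends of the loop. *)
  have [|||A' Au hA] := @lift_similar _ _ _ _ _ G _ Q gG gH pQ d dP dE dC R n c c_orth c_mul c_cont
    (unit_interval R) (ineff G a) (Defs.total B) B ebar pB cK hK eb_cont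
    ebc ebi eb_eq eb_mul (msec B (i1 R)) (msec B (i0 R)) q0 q0.
  + exact: unit_interval_connected.
  + by rewrite m1.
  + by rewrite m0.
  exists alpha => //; split => //.
  apply: (@similar_unitary R _ n (r0 \o alpha) r0 A') => // [k|k|k]; [exact: c_orth|exact: c_orth|].
  by have := hA k; rewrite eb0 e1.
Qed.
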